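(* Let $n$ be a positive integer, let $\mu,\nu,\lambda$ be partitions with $\ell(\mu),\ell(\nu),\ell(\lambda)\leq n$, let $k=(3n+2)(n+1)/2$, and let $\mathcal{P}_{\mu,\nu}^{\lambda}\subset\mathbb{R}^k$ be the associated $K$-polytope. Then $$n_{\mu,\nu}^{\lambda}=i(\mathcal{P}_{\mu,\nu}^{\lambda},1):=\#\left(\mathcal{P}_{\mu,\nu}^{\lambda}\cap\mathbb{Z}^k\right)$$ and, for integer stretching parameter $t\geq0$, $$n_{t\mu,t\nu}^{t\lambda}=i(\mathcal{P}_{\mu,\nu}^{\lambda},t):=\#\left(\mathcal{P}_{t\mu,t\nu}^{t\lambda}\cap\mathbb{Z}^k\right),$$ where $i(\mathcal{P},t)$ is the Ehrhart quasi-polynomial of the polytope $\mathcal{P}$.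
   Context: Newell--Littlewood coefficients: $n_{\mu,\nu}^{\lambda}=\sum_{\alpha,\beta,\gamma} c_{\alpha,\beta}^{\mu}c_{\alpha,\gamma}^{\nu}c_{\beta,\gamma}^{\lambda}$, summed over all partitions $\alpha,\beta,\gamma$, where $c_{\mu,\nu}^{\lambda}$ is the Littlewood--Richardson coefficient (coefficient of the Schur function $s_\lambda$ in $s_\mu s_\nu$). $\ell(\kappa)$ is the number of nonzero parts of a partition $\kappa$, $|\kappa|$ the sum of its parts, and $t\kappa=(t\kappa_1,t\kappa_2,\ldots)$. Partitions of length $\le n$ are padded with zeros to $n$ parts. The $K$-polytope. Let $T_n=\{(i,j)\in\mathbb{Z}^2: 0\leq i\leq 2n,\ i\leq j\leq \min(i+n,2n)\}$, a set with $k=(3n+2)(n+1)/2$ elements (the vertices of a trapezoidal composite hive of edge length $n$); it is the union of the three triangles $T_\mu=\{0\leq i\leq j\leq n\}$, $T_\nu=\{n\leq i\leq j\leq 2n\}$ and $T^\lambda=\{0\leq i\leq n\leq j\leq i+n\}$. Identify $\mathbb{R}^k$ with the set of real labellings $(a_{i,j})_{(i,j)\in T_n}$. Then $\mathcal{P}_{\mu,\nu}^{\lambda}$ is the set of all $(a_{i,j})\in\mathbb{R}^k$ such that: (i) $a_{0,0}=0$ and $a_{0,n}-a_{0,0}=(|\mu|+|\nu|-|\lambda|)/2$; (ii) $a_{n+j,2n}-a_{n,2n}=a_{0,j}-a_{0,0}$ for $j=1,\ldots,n-1$; (iii) $\mu_i=a_{i,i}-a_{i-1,i-1}$, $\nu_i=a_{n+i,n+i}-a_{n+i-1,n+i-1}$,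 $\lambda_i=a_{i,n+i}-a_{i-1,n+i-1}$ for $i=1,\ldots,n$; (iv) for all $i,j$, each of the rhombus inequalities $R_{i,j}\geq0$, $U_{i,j}\geq0$, $L_{i,j}\geq0$ holds whenever the four vertices appearing in it all lie in one and the same triangle $T_\mu$, $T_\nu$ or $T^\lambda$, where $R_{i,j}=a_{i-1,j-1}+a_{i,j-1}-a_{i,j}-a_{i-1,j-2}$, $U_{i,j}=a_{i-1,j-1}+a_{i,j}-a_{i-1,j}-a_{i,j-1}$, $L_{i,j}=a_{i,j-1}+a_{i,j}-a_{i-1,j-1}-a_{i+1,j}$.
   Formalization: The K-polytope gets the extra condition that the edge differences along its three inner sides (the parts of alpha, beta, gamma) are nonnegative, and the identity with the Ehrhart quasi-polynomial at t=0 is stated only when the polytope is nonempty; both fail otherwise. *)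

(* Defs.v *)
From HB Require Import structures.
From mathcomp Require Import all_boot all_order all_algebra.
From mathcomp Require Import finmap mpoly.
From mathcomp Require Import boolp classical_sets functions cardinality fsbigop.
From mathcomp Require Import reals.
From mathcomp Require Import zify.

Set Implicit Arguments.
Unset Strict Implicit.
Unset Printing Implicit Defensive.

Import Order.TTheory GRing.Theory Num.Theory.

Definition vertex (n : nat) : finType :=
  {p : 'I_(2 * n).+1 * 'I_(2 * n).+1
     | (p.1 <= p.2 <= minn (p.1 + n) (2 * n))%N}.
Lemma card_vertex (n : nat) : #|vertex n| = ((3 * n + 2) * n.+1 %/ 2)%N.
Proof.
have cnt (i : 'I_(2 * n).+1) :
    (\sum_(j < (2 * n).+1 | i <= j <= minn (i + n) (2 * n)) 1 =
     (minn (i + n) (2 * n)).+1 - i)%N.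
  rewrite -(big_mkord (fun j => i <= j <= minn (i + n) (2 * n))%N (fun=> 1%N)).
  have iN := ltn_ord i.
  have im : (i <= (minn (i + n) (2 * n)).+1)%N by lia.
  rewrite (big_cat_nat (n := i)) //=; last by lia.
  rewrite (big_cat_nat (m := i) (n := (minn (i + n) (2 * n)).+1)) //=; last by lia.
  rewrite big_nat_cond big1 ?add0n; last by move=> j; lia.
  rewrite [X in (_ + X)%N]big_nat_cond [X in (_ + X)%N]big1 ?addn0; last by move=> j; lia.
  rewrite big_nat_cond (eq_bigl (fun j => (i <= j < (minn (i + n) (2 * n)).+1) && true)%N); last by move=> j; lia.
  by rewrite -big_nat_cond sum_nat_const_nat muln1.
rewrite card_sig -sum1_card.
rewrite -(pair_big_dep xpredT (fun i j : 'I_(2 * n).+1 => i <= j <= minn (i + n) (2 * n))%N (fun _ _ => 1%N)) /=.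
rewrite (eq_bigr _ (fun i _ => cnt i)).
rewrite -(big_mkord xpredT (fun i => (minn (i + n) (2 * n)).+1 - i)%N).
have aux m : (m <= (2 * n).+1 -> 2 * \sum_(0 <= i < m) ((minn (i + n) (2 * n)).+1 - i) =
   if m <= n.+1 then 2 * (m * n.+1) else 2 * (n.+1 * n.+1) + (m - n.+1) * (3 * n + 2 - m))%N.
  elim: m => [|m IH] mn; first by rewrite big_geq.
  rewrite big_nat_recr //= mulnDr IH; last by lia.
  by case: ifP; case: ifP; nia.
have := aux _ (leqnn _).
case: ifP => h h2; have : ((3 * n + 2) * n.+1 = 2 * \sum_(0 <= i < (2 * n).+1) ((minn (i + n) (2 * n)).+1 - i))%N; try nia.
all: by move=> ->; rewrite mulKn.
Qed.

Local Open Scope classical_set_scope.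
Local Open Scope ring_scope.

Definition is_intpart (s : seq nat) : bool := sorted geq s && (0%N \notin s).

Record intpart : Type :=
  IntPart { parts :> seq nat; intpartP : is_intpart parts }.

HB.instance Definition _ := [isSub for parts].
HB.instance Definition _ := [Countable of intpart by <:].

Definition plength (k : intpart) : nat := size k.
Definition psize (k : intpart) : nat := sumn k.

(* The parts are numbered from 1 and padded with zeros. *)
Definition part (k : intpart) (i : nat) : nat := nth 0%N k i.-1.

(* The filter only matters for t = 0. *)
Definition scale_parts (t : nat) (s : seq nat) : seq nat :=
  [seq x <- [seq (t * y)%N | y <- s] | (0 < x)%N].

Lemma scale_partsP (t : nat) (k : intpart) : is_intpart (scale_parts t k).
Proof.
have /andP[sk _] := intpartP k.
apply/andP; split; last by rewrite mem_filter.
apply: sorted_filter; first by move=> x y z yx xz; exact: leq_trans xz yx.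
by apply: homo_sorted sk => x y yx; rewrite /= leq_mul2l orbC (yx : (y <= x)%N).
Qed.

Definition pscale (t : nat) (k : intpart) : intpart :=
  IntPart (scale_partsP t k).

Definition cell (k : intpart) : finType :=
  {i : 'I_(size k) & 'I_(nth 0%N k i)}.
Definition row_of (k : intpart) (b : cell k) : nat := tag b.
Definition col_of (k : intpart) (b : cell k) : nat := tagged b.

Definition semistandard (k : intpart) (N : nat)
    (T : {ffun cell k -> 'I_N}) : bool :=
  [forall b, forall b',
    ((row_of b == row_of b') && (col_of b < col_of b')%N ==> (T b <= T b')%N)
    && ((col_of b == col_of b') && (row_of b < row_of b')%N
        ==> (T b < T b')%N)].

Definition schur (k : intpart) (N : nat) : {mpoly int[N]} :=
  \sum_(T : {ffun cell k -> 'I_N} | semistandard T) \prod_b 'X_(T b).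

(* An identity between symmetric functions is an identity between their
   restrictions to N variables for every N, so this set consists of the
   finite families c with s_mu s_nu = \sum_k c k *: s_k.  As the Schur
   functions form a Z-basis of the ring of symmetric functions, it is a
   singleton. *)
Definition schur_expansion (mu nu : intpart) :
    set {fsfun intpart -> int with 0} :=
  [set c | forall N : nat,
     schur mu N * schur nu N = \sum_(k <- finsupp c) c k *: schur k N].

Definition LR_coef (mu nu la : intpart) : int :=
  xget [fsfun] (schur_expansion mu nu) la.

(* A sum with finite support over all triples of partitions: a nonzero term
   has |al| + |be| = |mu|, |al| + |ga| = |nu| and |be| + |ga| = |la|. *)
Definition NL_coef (mu nu la : intpart) : int :=
  \sum_(p \in [set: intpart * intpart * intpart])
    let: (al, be, ga) := p in
    LR_coef al be mu * LR_coef al ga nu * LR_coef be ga la.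

Section Labellings.
Variables (R : realType) (n : nat).

Definition labelling : Type := {ffun vertex n -> R}.

(* a_{i,j}, with the junk value 0 outside T_n.  Integer indices avoid
   truncated subtraction in i - 1, j - 2. *)
Definition lab (a : labelling) (i j : int) : R :=
  if [pick v : vertex n | ((val v).1%:Z == i) && ((val v).2%:Z == j)] is Some v
  then a v else 0.

Definition tri_mu : pred (int * int) :=
  fun p => (0 <= p.1 <= p.2) && (p.2 <= n%:Z).
Definition tri_nu : pred (int * int) :=
  fun p => (n%:Z <= p.1 <= p.2) && (p.2 <= 2 * n%:Z).
Definition tri_la : pred (int * int) :=
  fun p => (0 <= p.1 <= n%:Z) && (n%:Z <= p.2 <= p.1 + n%:Z).

Definition rhombus_R (a : labelling) (i j : int) : R :=
  lab a (i - 1) (j - 1) + lab a i (j - 1) - lab a i j - lab a (i - 1) (j - 2).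
Definition rhombus_U (a : labelling) (i j : int) : R :=
  lab a (i - 1) (j - 1) + lab a i j - lab a (i - 1) j - lab a i (j - 1).
Definition rhombus_L (a : labelling) (i j : int) : R :=
  lab a i (j - 1) + lab a i j - lab a (i - 1) (j - 1) - lab a (i + 1) j.

Definition rhombus_ineqs (D : pred (int * int)) (a : labelling) : Prop :=
  forall i j : int,
  [/\ all D [:: (i - 1, j - 1); (i, j - 1); (i, j); (i - 1, j - 2)] ->
        0 <= rhombus_R a i j,
      all D [:: (i - 1, j - 1); (i, j); (i - 1, j); (i, j - 1)] ->
        0 <= rhombus_U a i j
    & all D [:: (i, j - 1); (i, j); (i - 1, j - 1); (i + 1, j)] ->
        0 <= rhombus_L a i j].

Record in_K_polytope (mu nu la : intpart) (a : labelling) : Prop := {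
  K_origin : lab a 0 0 = 0;
  K_alpha_size : lab a 0 n%:Z - lab a 0 0 =
    ((psize mu)%:R + (psize nu)%:R - (psize la)%:R) / 2;
  K_glue : forall j : nat, (1 <= j <= n.-1)%N ->
    lab a (n%:Z + j%:Z) (2 * n%:Z) - lab a n%:Z (2 * n%:Z) =
    lab a 0 j%:Z - lab a 0 0;
  K_mu : forall i : nat, (1 <= i <= n)%N ->
    (part mu i)%:R = lab a i%:Z i%:Z - lab a (i%:Z - 1) (i%:Z - 1);
  K_nu : forall i : nat, (1 <= i <= n)%N ->
    (part nu i)%:R = lab a (n%:Z + i%:Z) (n%:Z + i%:Z)
                     - lab a (n%:Z + i%:Z - 1) (n%:Z + i%:Z - 1);
  K_la : forall i : nat, (1 <= i <= n)%N ->
    (part la i)%:R = lab a i%:Z (n%:Z + i%:Z)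
                     - lab a (i%:Z - 1) (n%:Z + i%:Z - 1);
  K_rhombus_mu : rhombus_ineqs tri_mu a;
  K_rhombus_nu : rhombus_ineqs tri_nu a;
  K_rhombus_la : rhombus_ineqs tri_la a;
  (* The rhombus inequalities only make the differences along the sides of
     the triangles (the parts of alpha, beta and gamma) weakly decreasing.
     Without their nonnegativity the set is unbounded (n = 2,
     mu = nu = la = 0) and may contain integer points when the
     Newell-Littlewood coefficient vanishes (n = 1, mu = nu = 0, la = 2). *)
  K_alpha_ge0 : forall i : nat, (1 <= i <= n)%N ->
    0 <= lab a 0 i%:Z - lab a 0 (i%:Z - 1);
  K_beta_ge0 : forall i : nat, (1 <= i <= n)%N ->
    0 <= lab a i%:Z n%:Z - lab a (i%:Z - 1) n%:Z;
  K_gamma_ge0 : forall i : nat, (1 <= i <= n)%N ->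
    0 <= lab a n%:Z (n%:Z + i%:Z) - lab a n%:Z (n%:Z + i%:Z - 1)
}.

Definition K_polytope (mu nu la : intpart) : set labelling :=
  [set a | in_K_polytope mu nu la a].

Definition integer_points (P : set labelling) : set labelling :=
  P `&` [set a | forall v, a v \is a Num.int].

Definition dilate (t : nat) (P : set labelling) : set labelling :=
  [set [ffun v => t%:R * a v] | a in P].

Definition has_card (A : set labelling) (m : int) : Prop :=
  finite_set A /\ m = #|` fset_set A|%:Z.

(* A polynomial in t whose coefficients are periodic functions of t. *)
Definition quasi_polynomial (q : nat -> R) : Prop :=
  exists2 d : nat, (0 < d)%N & exists p : nat -> {poly R},
    forall t : nat, q t = (p (t %% d)%N).[t%:R].

(* The counts for t > 0 determine q, including its value at 0. *)
Definition ehrhart_quasi_polynomial (P : set labelling) (q : nat -> R) : Prop :=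
  quasi_polynomial q /\
  forall t : nat, (0 < t)%N ->
    finite_set (integer_points (dilate t P)) /\
    q t = #|` fset_set (integer_points (dilate t P))|%:R.

End Labellings.

(* Main.v *)
Require Import Defs.
From HB Require Import structures.
From mathcomp Require Import all_boot all_order all_algebra.
From mathcomp Require Import fingroup perm.
From mathcomp Require Import finmap mpoly.
From mathcomp Require Import boolp classical_sets functions cardinality fsbigop.
From mathcomp Require Import reals.
From mathcomp Require Import zify ring lra.

Set Implicit Arguments.
Unset Strict Implicit.
Unset Printing Implicit Defensive.

(* Littlewood-Richardson coefficients.  A semistandard tableau is encoded by the
   Gelfand-Tsetlin pattern x, where x k i counts the entries smaller than k in
   row i.  With a(v) the alternant of exponent v, symmetry of Schur polynomials
   gives a(la + rho) s_mu = sum_x a(la + weight x + rho) over the patterns x of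
   shape mu.  Following Stembridge, the patterns for which la plus the weight of
   some set of final columns fails to be a partition cancel: take the rightmost
   failing column, the least failing index there, and apply a Bender-Knuth
   toggle to the columns further left.  The surviving patterns are, after
   summation of their rows, the integer hives; this turns triples of
   Littlewood-Richardson patterns into integer points of the K-polytope, whose
   three triangles are hives with boundaries (alpha, beta, mu),
   (gamma, alpha, nu) and, reflected, (beta, gamma, la).

   Ehrhart quasi-polynomiality.  The variables of a homogeneous system of
   integral inequalities in (t, a) are summed out one at a time.  The partial
   counts are quasi-polynomial on each closed face of an arrangement of
   hyperplanes through the origin; working with closed faces makes the final
   formula valid at t = 0 as soon as the polytope is nonempty. *)

(** * Gelfand-Tsetlin patterns *)

(** [LR_coef] is read off an expansion valid in every number of variables, so such an expansion must
    be shown to exist. It is obtained in |al| + |be| variables, passes to fewer variables by setting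
    the others to 0, and cannot change in more variables, because all partitions that occur have at
    most |al| + |be| parts. Its coefficients are recovered as coefficients of x^(mu + rho) after
    multiplication by the Vandermonde alternant, which is nonzero in an integral domain. The
    cancellation reverses signs because the first failing column leaves a deficit of exactly one,
    the gap between consecutive parts of rho: the toggle then exchanges two exponents of an
    alternant. Linking the top rows of three patterns turns the sum over all (alpha, beta, gamma)
    into one finite count. In the Ehrhart part, the fibre over a point runs from the greatest lower
    bound to the least upper bound. It is cut into one point and half-open intervals ending at roots
    of the forms; on each piece a single closed face applies, and the sum telescopes through a
    quasi-polynomial antidifference evaluated at floors. *)

Section Patterns.
Variable N : nat.
Implicit Types (x : nat -> nat -> nat) (mu la : nat -> nat).

(* [x k i] is the number of entries smaller than [k] in row [i] of a tableau
   with entries in {0, ..., N-1}. *)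
Definition gt_pattern mu x : Prop :=
  [/\ forall k i, (k <= i)%N -> x k i = 0%N,
      forall k i, (k < N)%N -> (x k.+1 i.+1 <= x k i <= x k.+1 i)%N
    & forall i, x N i = mu i].

Definition row_sum (J : nat) x (k : nat) : nat := (\sum_(i < N) (x k i - J))%N.

(* As [row_sum J] only sees the columns after the first [J], this says that
   [la] plus the weight of these columns does not increase from [k-1] to [k]. *)
Definition dominant_at la x (k J : nat) : bool :=
  (la k + row_sum J x k.+1 + row_sum J x k.-1 <= la k.-1 + 2 * row_sum J x k)%N.

Definition dominant la x : Prop :=
  forall k J, (0 < k < N)%N -> dominant_at la x k J.

Definition weight x (k : nat) : nat := (row_sum 0 x k.+1 - row_sum 0 x k)%N.

(** The upper bound that level [k-1] puts on [x k i]. Row 0 has no such bound; [x k.+1 0], which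
    bounds [x k 0] anyway, takes its place. *)
Definition above_neighbour x (k i : nat) : nat := if i is i'.+1 then x k.-1 i' else x k.+1 0.

(* The Bender-Knuth involution exchanging the entries [k-1] and [k] of the first
   [J] columns. *)
Definition toggle (J k : nat) x : nat -> nat -> nat := fun r i =>
  if r == k then
    (x k i - J + (minn (minn (above_neighbour x k i) (x k.+1 i)) J
      + minn (maxn (x k.-1 i) (x k.+1 i.+1)) J - minn (x k i) J))%N
  else x r i.

Section Rows.
Variables (x : nat -> nat -> nat) (mu : nat -> nat).
Hypothesis xP : gt_pattern mu x.

Lemma gt_pattern0 k i : (k <= i)%N -> x k i = 0%N.
Proof. by case: xP => h _ _; apply: h. Qed.

Lemma gt_pattern_le k i : (k < N)%N -> (x k i <= x k.+1 i)%N.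
Proof. by case: xP => _ h _ kN; case/andP: (h k i kN). Qed.

Lemma gt_pattern_ge k i : (k < N)%N -> (x k.+1 i.+1 <= x k i)%N.
Proof. by case: xP => _ h _ kN; case/andP: (h k i kN). Qed.

Lemma gt_pattern_top i : x N i = mu i.
Proof. by case: xP. Qed.

Lemma gt_pattern_decr k i : (k <= N)%N -> (x k i.+1 <= x k i)%N.
Proof.
case: k => [|k] kN; first by rewrite !gt_pattern0.
exact: leq_trans (gt_pattern_ge i kN) (gt_pattern_le i kN).
Qed.

Lemma gt_pattern_decr_le k i j : (k <= N)%N -> (i <= j)%N -> (x k j <= x k i)%N.
Proof.
move=> kN /subnK <-; elim: (j - i)%N => [|d IH] //.
by rewrite addSn; apply: leq_trans IH; apply: gt_pattern_decr.
Qed.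

Lemma gt_pattern_le_top k i : (k <= N)%N -> (x k i <= mu i)%N.
Proof.
move=> kN; rewrite -gt_pattern_top -(subnKC kN).
have : (k + (N - k) <= N)%N by lia.
elim: (N - k)%N => [|d IH]; first by rewrite addn0.
rewrite addnS => dN; apply: leq_trans (IH (ltnW dN)) _.
exact: gt_pattern_le.
Qed.

Lemma gt_pattern_le_top0 k i : (k <= N)%N -> (x k i <= mu 0)%N.
Proof.
move=> kN; apply: leq_trans (gt_pattern_decr_le kN (leq0n i)) _.
exact: gt_pattern_le_top.
Qed.

Lemma row_sum_le J k : (k < N)%N -> (row_sum J x k <= row_sum J x k.+1)%N.
Proof.
by move=> kN; apply: leq_sum => i _; apply: leq_sub2r; apply: gt_pattern_le.
Qed.

(** Truncated to the first [J] columns, the toggle reflects [x k i] in its interlacing interval: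
    lower + upper - value. The hypothesis says that column [J] holds no entry [k-1]; hence if
    [x k i] exceeds [J], both truncated bounds equal [J] and the row is left unchanged. *)
Lemma toggleK_val J k (i : nat) : (0 < k < N)%N ->
  (forall i, (J < x k i)%N -> (J < x k.-1 i)%N) ->
  [/\ (toggle J k x k i <= minn (above_neighbour x k i) (x k.+1 i))%N,
      (maxn (x k.-1 i) (x k.+1 i.+1) <= toggle J k x k i)%N,
      minn (toggle J k x k i) J = (minn (minn (above_neighbour x k i) (x k.+1 i)) J
      + minn (maxn (x k.-1 i) (x k.+1 i.+1)) J - minn (x k i) J)%N
    & forall J', (J <= J')%N -> (toggle J k x k i - J' = x k i - J')%N].
Proof.
case/andP; case: k => // k _ kN /= crit.
have h1 := gt_pattern_le i (ltnW kN).
have h2 := gt_pattern_le i kN.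
have h3 := gt_pattern_ge i kN.
have h0 : (x k.+1 i <= above_neighbour x k.+1 i)%N.
  by case: (i) => [|i']; [exact: gt_pattern_le | exact: gt_pattern_ge (ltnW kN)].
have h4 : (x k i <= above_neighbour x k.+1 i)%N.
  exact: leq_trans h1 h0.
have h5 : (x k.+2 i.+1 <= above_neighbour x k.+1 i)%N.
  exact: leq_trans h3 h0.
have := crit i; rewrite /toggle eqxx.
move: h1 h2 h3 h0 h4 h5; move: (above_neighbour _ _ _) => h h1 h2 h3 h0 h4 h5.
move=> /implyP cr; move: h1 h2 h3 h0 h4 h5 cr.
move: (x k i) (x k.+1 i) (x k.+2 i) (x k.+2 i.+1) => a b c c' *.
by split=> [|||J' JJ']; lia.
Qed.

Lemma toggle_pattern J k : (0 < k < N)%N ->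
  (forall i, (J < x k i)%N -> (J < x k.-1 i)%N) -> gt_pattern mu (toggle J k x).
Proof.
move=> k0N crit; have tv i := toggleK_val i k0N crit.
case/andP: (k0N) => k0 kN.
have other (r i : nat) : r != k -> toggle J k x r i = x r i by rewrite /toggle => /negPf ->.
split=> [r i ri|r i rN|i]; last by rewrite other ?gt_pattern_top //; lia.
  have [e|rk] := eqVneq r k; last by rewrite other ?gt_pattern0.
  have [+ _ _ _] := tv i; rewrite e.
  rewrite /above_neighbour; case: (i) (ri) => [|i'] ri'; first by lia.
  by rewrite (@gt_pattern0 k.-1 i'); lia.
have [e|rk] := eqVneq r k.
  have o j : toggle J k x k.+1 j = x k.+1 j by apply: other; lia.
  have [h1 h2 _ _] := tv i; have [h3 _ _ _] := tv i.+1.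
  by rewrite e !o; move: h1 h2; lia.
rewrite !(@other r) //.
have [e|rk'] := eqVneq r.+1 k; last by rewrite !other // gt_pattern_le // gt_pattern_ge.
have [_ h2 _ _] := tv i; have [h1 _ _ _] := tv i.+1.
have er : r = k.-1 by lia.
have en : above_neighbour x k i.+1 = x k.-1 i by [].
by rewrite en in h1; rewrite e er; lia.
Qed.

Lemma toggle_involutive J k : (0 < k < N)%N ->
  (forall i, (J < x k i)%N -> (J < x k.-1 i)%N) ->
  forall r i, toggle J k (toggle J k x) r i = x r i.
Proof.
move=> k0N crit r i; have [h1 h2 h3 h4] := toggleK_val i k0N crit.
case/andP: (k0N) => k0 kN.
have other (s j : nat) : s != k -> toggle J k x s j = x s j by rewrite /toggle => /negPf ->.
have [->|rk] := eqVneq r k; last by rewrite {1}/toggle (negPf rk) other.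
rewrite {1}/toggle eqxx h3 (h4 J (leqnn _)).
have -> : above_neighbour (toggle J k x) k i = above_neighbour x k i.
  by rewrite /above_neighbour; case: (i) => [|i']; rewrite other //; lia.
rewrite !(@other k.+1) ?(@other k.-1); try lia.
have := gt_pattern_le i kN; have := gt_pattern_ge i kN.
have : (x k.-1 i <= x k i)%N by rewrite -{2}(prednK k0); apply: gt_pattern_le; lia.
have : (x k i <= above_neighbour x k i)%N.
  case: (i) => [|i']; first exact: gt_pattern_le.
  by rewrite -{1}(prednK k0); apply: gt_pattern_ge; lia.
move: (above_neighbour _ _ _) => h bh ab cb bc.
have : (maxn (x k.-1 i) (x k.+1 i.+1) <= x k i)%N by rewrite geq_max ab.
have : (x k i <= minn h (x k.+1 i))%N by rewrite leq_min bh.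
move: (minn h _) (maxn _ _) (x k i) => u l b; clear; lia.
Qed.

Lemma row_sum_toggle J k J' r : (0 < k < N)%N ->
  (forall i, (J < x k i)%N -> (J < x k.-1 i)%N) -> (J <= J')%N ->
  row_sum J' (toggle J k x) r = row_sum J' x r.
Proof.
move=> k0N crit JJ'; apply: eq_bigr => i _.
have [->|rk] := eqVneq r k; last by rewrite /toggle (negPf rk).
by have [_ _ _ ->] := toggleK_val i k0N crit.
Qed.

Lemma row_sum_split J k : row_sum 0 x k = (row_sum J x k + \sum_(i < N) minn (x k i) J)%N.
Proof. by rewrite -big_split; apply: eq_bigr => i _ /=; lia. Qed.

(** Shifting the index of the upper bounds by one pairs the minimum and the maximum of [x k.-1 i]
    and [x k.+1 i.+1], whose sum is that of the two numbers. The unpaired terms are the first upper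
    bound, from [x k.+1 0], and the last lower bound, which is 0. *)
Lemma sum_row_max_min J k : (0 < k < N)%N ->
  (\sum_(i < N) (minn (minn (above_neighbour x k i) (x k.+1 i)) J
      + minn (maxn (x k.-1 i) (x k.+1 i.+1)) J) =
   \sum_(i < N) minn (x k.-1 i) J + \sum_(i < N) minn (x k.+1 i) J)%N.
Proof.
move=> k0N; have N0 : (0 < N)%N by lia.
pose M := N.-1; have eN : N = M.+1 by lia.
rewrite big_split /= -!(big_mkord xpredT (fun i => minn (x _ i) J)).
rewrite -(big_mkord xpredT (fun i => minn (minn (above_neighbour x k i) (x k.+1 i)) J)).
rewrite -(big_mkord xpredT (fun i => minn (maxn (x k.-1 i) (x k.+1 i.+1)) J)).
rewrite eN [X in (X + _)%N]big_nat_recl // big_nat_recr //=.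
rewrite [X in _ = (X + _)%N]big_nat_recr //= [X in _ = (_ + X)%N]big_nat_recl //=.
rewrite (@gt_pattern0 k.-1 M) ?[x k.+1 M.+1]gt_pattern0; [|lia|lia].
rewrite minnn maxn0 !min0n.
have : (\sum_(0 <= i < M) (minn (minn (x k.-1 i) (x k.+1 i.+1)) J +
          minn (maxn (x k.-1 i) (x k.+1 i.+1)) J) =
        \sum_(0 <= i < M) (minn (x k.-1 i) J + minn (x k.+1 i.+1) J))%N.
  by apply: eq_bigr => i _; lia.
by rewrite !big_split /=; lia.
Qed.

(** Adding up the reflections shows that the first [J] columns exchange their numbers of entries
    [k-1] and [k]. The additive form avoids truncated subtraction. *)
Lemma row_sum0_toggle J k : (0 < k < N)%N ->
  (forall i, (J < x k i)%N -> (J < x k.-1 i)%N) ->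
  (row_sum 0 (toggle J k x) k + row_sum 0 x k + row_sum J x k.-1 + row_sum J x k.+1 =
   2 * row_sum J x k + row_sum 0 x k.-1 + row_sum 0 x k.+1)%N.
Proof.
move=> k0N crit; have := sum_row_max_min J k0N.
rewrite (row_sum_split J k) (row_sum_split J k.-1) (row_sum_split J k.+1).
rewrite [row_sum 0 (toggle _ _ _) _](_ : _ = row_sum J x k +
    \sum_(i < N) minn (toggle J k x k i) J)%N; last first.
  rewrite -big_split; apply: eq_bigr => i _ /=.
  by have [_ _ _ <- //] := toggleK_val i k0N crit; lia.
suff : (\sum_(i < N) minn (toggle J k x k i) J + \sum_(i < N) minn (x k i) J =
  \sum_(i < N) (minn (minn (above_neighbour x k i) (x k.+1 i)) J
      + minn (maxn (x k.-1 i) (x k.+1 i.+1)) J))%N by lia.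
rewrite -big_split; apply: eq_bigr => i _ /=.
have [_ _ -> _] := toggleK_val i k0N crit.
suff : (minn (x k i) J <= minn (above_neighbour x k i) (x k.+1 i))%N by lia.
case/andP: (k0N) => k0 kN; have := gt_pattern_le i kN.
suff : (x k i <= above_neighbour x k i)%N by lia.
case: (nat_of_ord i) => [|i']; first exact: gt_pattern_le.
by rewrite -{1}(prednK k0); apply: gt_pattern_ge; lia.
Qed.

Definition above J k : nat := (\sum_(i < N) (J < x k i))%N.

Lemma row_sumS J k : row_sum J x k = (row_sum J.+1 x k + above J k)%N.
Proof. by rewrite -big_split; apply: eq_bigr => i _ /=; lia. Qed.

(** [above J k] counts the entries smaller than [k] in column [J], columns being numbered from 0; a
    column contains the value [k] at most once. *)
Lemma above_le J k : (k < N)%N -> (above J k <= above J k.+1 <= (above J k).+1)%N.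
Proof.
move=> kN; apply/andP; split.
  by apply: leq_sum => i _; have := gt_pattern_le i kN; lia.
rewrite /above -!(big_mkord xpredT (fun i => J < x _ i : nat)%N).
have -> : N = N.-1.+1 by lia.
rewrite big_nat_recl // -[leqRHS]add1n leq_add ?leq_b1 //.
rewrite big_nat_recr //=; apply: leq_trans (leq_addr _ _).
by apply: leq_sum => i _; have := gt_pattern_ge i kN; lia.
Qed.

(* A violation appearing when the column [J] is added creates a deficit of
   exactly one, and comes from a column containing [k] but not [k-1]. *)
Lemma dominant_at_first_failure la J k : (0 < k < N)%N ->
  ~~ dominant_at la x k J -> dominant_at la x k J.+1 ->
  (la k + row_sum J x k.+1 + row_sum J x k.-1 = (la k.-1 + 2 * row_sum J x k).+1)%N /\
  (forall i, (J < x k i)%N -> (J < x k.-1 i)%N).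
Proof.
move=> /andP[k0 kN]; rewrite /dominant_at !(row_sumS J) -ltnNge => h1 h2.
have /andP[h3 h4] := above_le J kN.
have := @above_le J k.-1; rewrite prednK // => /(_ (ltnW kN)) /andP[h5 h6].
have eab : above J k = above J k.-1 by lia.
split; first by lia.
have xle i : (x k.-1 i <= x k i)%N by rewrite -{2}(prednK k0); apply: gt_pattern_le; lia.
move=> i ji; case: (leqP N i) => iN.
  by rewrite gt_pattern0 in ji => //; lia.
have : (\sum_(j < N | j != Ordinal iN) (J < x k.-1 j) <= \sum_(j < N | j != Ordinal iN) (J < x k j))%N.
  by apply: leq_sum => j _; have := xle j; lia.
move: eab; rewrite /above (bigD1 (Ordinal iN)) //= [X in _ = X](bigD1 (Ordinal iN)) //= ji.
by case: (J < x k.-1 i)%N => //; rewrite add0n add1n => <-; rewrite ltnn.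
Qed.

Lemma dominant_at_large la J k : (0 < k < N)%N ->
  (la k <= la k.-1)%N -> (mu 0 <= J)%N -> dominant_at la x k J.
Proof.
move=> k0N lak muJ; rewrite /dominant_at.
have r0 r : (r <= N)%N -> row_sum J x r = 0%N.
  move=> rN; rewrite /row_sum big1 // => i _; apply/eqP; rewrite subn_eq0.
  exact: leq_trans (gt_pattern_le_top0 i rN) muJ.
by rewrite !r0; lia.
Qed.

End Rows.

(** The first [J] columns exchange their numbers of entries [k-1] and [k], while the later columns
    keep theirs and miss dominance by exactly one. In total the two values of [la + weight] are
    exchanged up to 1, which is the difference of consecutive values of [rho]. *)
Lemma weight_toggle mu la x J k : gt_pattern mu x -> (0 < k < N)%N ->
  (forall i, (J < x k i)%N -> (J < x k.-1 i)%N) ->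
  (la k + row_sum J x k.+1 + row_sum J x k.-1 = (la k.-1 + 2 * row_sum J x k).+1)%N ->
  [/\ (la k.-1 + weight (toggle J k x) k.-1 + 1 = la k + weight x k)%N,
      (la k + weight (toggle J k x) k = la k.-1 + weight x k.-1 + 1)%N
    & forall r, (r != k) -> (r != k.-1) -> weight (toggle J k x) r = weight x r].
Proof.
move=> xP k0N crit dj; have tP := toggle_pattern xP k0N crit.
have rs := row_sum0_toggle xP k0N crit.
have other (r : nat) : r != k -> row_sum 0 (toggle J k x) r = row_sum 0 x r.
  by move=> /negPf rk; apply: eq_bigr => i _; rewrite /toggle rk.
case/andP: (k0N) => k0 kN.
have := row_sum_le tP 0 kN; have := row_sum_le xP 0 kN.
have := @row_sum_le _ _ tP 0 k.-1; have := @row_sum_le _ _ xP 0 k.-1.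
rewrite /weight !prednK // => /(_ (ltnW kN)) h1 /(_ (ltnW kN)) h2 h3 h4.
have e1 : row_sum 0 (toggle J k x) k.-1 = row_sum 0 x k.-1 by apply: other; lia.
have e2 : row_sum 0 (toggle J k x) k.+1 = row_sum 0 x k.+1 by apply: other; lia.
move: h2 h4; rewrite e1 e2 => h2 h4.
split; try lia.
by move=> r rk rk'; rewrite !other //; lia.
Qed.

Lemma dominant_weight_decr la mu x k : gt_pattern mu x -> dominant la x ->
  (0 < k < N)%N -> (la k + weight x k <= la k.-1 + weight x k.-1)%N.
Proof.
move=> xP xd k0N; have := xd k 0%N k0N; rewrite /dominant_at.
case/andP: k0N => k0 kN.
have := row_sum_le xP 0 kN; have := @row_sum_le _ _ xP 0 k.-1.
by rewrite /weight !prednK // => /(_ (ltnW kN)); lia.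
Qed.

Lemma dominant0_row mu x : gt_pattern mu x -> dominant (fun=> 0%N) x ->
  forall k i, (k <= N)%N -> (i < k)%N -> x k i = mu i.
Proof.
move=> xP xd.
have step i : forall k, (i < k < N)%N -> x k i = x k.+1 i.
  elim/ltn_ind: i => i IH k /andP[ik kN].
  have k0N : (0 < k < N)%N by lia.
  have iN : (i < N)%N by lia.
  have e1 : (forall j, j < i -> x k.-1 j = x k j)%N.
    by move=> j ji; rewrite IH ?prednK //; lia.
  have e2 : (forall j, j < i -> x k.+1 j = x k j)%N.
    by move=> j ji; rewrite -IH //; lia.
  (* After the first [x k i] columns, the rows before [i] agree on levels [k-1], [k] and [k+1] by
     induction, and the rows from [i] on contain nothing smaller than [k]. Dominance then leaves no
     room for an entry [k] in row [i]. *)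
  have := xd k (x k i) k0N; rewrite /dominant_at.
  have rs r : row_sum (x k i) x r = (\sum_(0 <= j < i) (x r j - x k i) + (x r i - x k i) +
      \sum_(i.+1 <= j < N) (x r j - x k i))%N.
    rewrite /row_sum -(big_mkord xpredT (fun j => x r j - x k i)%N).
    by rewrite (@big_cat_nat _ _ _ i.+1) //= big_nat_recr.
  rewrite !rs (eq_big_nat _ _ (F1 := fun j => x k.+1 j - x k i) (F2 := fun j => x k j - x k i))%N; last first.
    by move=> j /andP[_ ji]; rewrite e2.
  rewrite (eq_big_nat _ _ (F1 := fun j => x k.-1 j - x k i) (F2 := fun j => x k j - x k i))%N; last first.
    by move=> j /andP[_ ji]; rewrite e1.
  have -> : (\sum_(i.+1 <= j < N) (x k j - x k i) = 0)%N.
    rewrite big_nat big1 // => j /andP[ij _]; apply/eqP; rewrite subn_eq0.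
    by apply: (gt_pattern_decr_le xP) => //; lia.
  by have := gt_pattern_le xP i kN; lia.
move=> k i kN ik; rewrite -(gt_pattern_top xP) -(subnKC kN).
have : (k + (N - k) <= N)%N by lia.
elim: (N - k)%N => [|d IH]; first by rewrite addn0.
rewrite addnS => dN; rewrite IH; last by lia.
by apply: step; lia.
Qed.

(** The pattern of the tableau whose row [i] is filled with the entry [i]. *)
Definition highest_pattern mu : nat -> nat -> nat :=
  fun k i => if (i < k)%N then mu i else 0%N.

Lemma highest_patternP mu : (forall i, mu i.+1 <= mu i)%N -> (forall i, (N <= i)%N -> mu i = 0%N) ->
  gt_pattern mu (highest_pattern mu).
Proof.
move=> mud mu0; rewrite /highest_pattern; split=> [k i|k i kN|i].
- by rewrite ltnNge => ->.
- have := mud i; rewrite ltnS.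
  by case: (ltnP i k) => ik; case: (ltnP i k.+1) => ik'; lia.
- by case: ltnP => // /mu0 ->.
Qed.

Lemma row_sum_highest mu J k : (k < N)%N ->
  row_sum J (highest_pattern mu) k.+1 = (row_sum J (highest_pattern mu) k + (mu k - J))%N.
Proof.
move=> kN; rewrite /row_sum /highest_pattern.
rewrite (bigD1 (Ordinal kN)) //= ltnSn [in RHS](bigD1 (Ordinal kN)) //= ltnn sub0n add0n addnC.
congr addn; apply: eq_bigr => i /eqP ik.
have {}ik : (i : nat) <> k by move=> e; apply: ik; apply: val_inj.
by have -> : (i < k.+1)%N = (i < k)%N by lia.
Qed.

Lemma weight_highest mu k : (k < N)%N -> weight (highest_pattern mu) k = mu k.
Proof. by move=> kN; rewrite /weight row_sum_highest // addKn subn0. Qed.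

Lemma dominant_highest mu : (forall i, mu i.+1 <= mu i)%N ->
  dominant (fun=> 0%N) (highest_pattern mu).
Proof.
move=> mud [|k] J // /andP[_ kN]; rewrite /dominant_at /= !row_sum_highest //; last by lia.
by have := mud k; lia.
Qed.

End Patterns.

(** * Dominance as inequalities between partial row sums *)

Lemma sum_sub_prefix (N m J : nat) (y : nat -> nat) : (m <= N)%N ->
  (forall j, (j < m)%N -> (J <= y j)%N) -> (forall j, (m <= j)%N -> (y j <= J)%N) ->
  (\sum_(j < N) (y j - J) + m * J = \sum_(0 <= j < m) y j)%N.
Proof.
move=> mN yJ Jy; rewrite -(big_mkord xpredT (fun j => y j - J)%N) (@big_cat_nat _ _ _ m) //=.
rewrite [X in (_ + X + _)%N]big_nat [X in (_ + X + _)%N]big1 ?addn0; last first.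
  by move=> j /andP[mj _]; apply/eqP; rewrite subn_eq0 Jy.
have := sum_nat_const_nat 0 m J; rewrite subn0 => <-.
by rewrite -big_split; apply: eq_big_nat => j /andP[_ /yJ] /=; lia.
Qed.

Section RowConditions.
Variables (N : nat) (x : nat -> nat -> nat) (mu la : nat -> nat).
Hypothesis xP : gt_pattern N mu x.

Definition row_prefix (k m : nat) : nat := (\sum_(0 <= j < m) x k j)%N.

Definition row_dominant_at (k i : nat) : bool :=
  (la k + row_prefix k.+1 i.+1 + row_prefix k.-1 i <=
   la k.-1 + row_prefix k i.+1 + row_prefix k i)%N.

Lemma row_prefixS k m : row_prefix k m.+1 = (row_prefix k m + x k m)%N.
Proof. exact: big_nat_recr. Qed.

(* The defect of [dominant_at] is, as a function of [J], piecewise linear and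
   concave between two consecutive parts of row [k], so it suffices to test it
   at these parts. *)
Lemma row_dominantP k : (0 < k < N)%N ->
  (forall J, dominant_at N la x k J) <-> (forall i, (i < k)%N -> row_dominant_at k i).
Proof.
case: k => // k /andP[_ kN].
have ge2 i : (x k.+2 i.+1 <= x k.+1 i)%N by apply: (gt_pattern_ge xP).
have le2 i : (x k.+1 i <= x k.+2 i)%N by apply: (gt_pattern_le xP).
have ge1 i : (x k.+1 i.+1 <= x k i)%N by apply: (gt_pattern_ge xP); lia.
have le1 i : (x k i <= x k.+1 i)%N by apply: (gt_pattern_le xP); lia.
have decr i j : (i <= j)%N -> (x k.+1 j <= x k.+1 i)%N by apply: (gt_pattern_decr_le xP); lia.
have i1 i j : (i <= j)%N -> (x k.+2 j.+1 <= x k.+1 i)%N.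
  by move=> ij; apply: leq_trans (ge2 j) (decr _ _ ij).
have i2 i j : (j <= i)%N -> (x k.+1 i <= x k.+2 j)%N.
  by move=> ij; apply: leq_trans (decr _ _ ij) (le2 j).
have i3 i j : (i <= j)%N -> (x k j <= x k.+1 i)%N.
  by move=> ij; apply: leq_trans (le1 j) (decr _ _ ij).
have i4 i j : (j < i)%N -> (x k.+1 i <= x k j)%N.
  by move=> ij; apply: leq_trans (decr _ _ ij) (ge1 j).
rewrite /dominant_at /row_dominant_at /=; split=> [dom i ik|row J].
  have eb : (row_sum N (x k.+1 i) x k.+1 + i.+1 * x k.+1 i = row_prefix k.+1 i.+1)%N.
    by apply: sum_sub_prefix => [|j|j] *; [lia|apply: decr; lia..].
  have ec : (row_sum N (x k.+1 i) x k.+2 + i.+1 * x k.+1 i = row_prefix k.+2 i.+1)%N.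
    by apply: sum_sub_prefix => [|j|[|j]] *; [lia|apply: i2; lia|by []|apply: i1; lia].
  have ea : (row_sum N (x k.+1 i) x k + i * x k.+1 i = row_prefix k i)%N.
    by apply: sum_sub_prefix => [|j|j] *; [lia|apply: i4; lia|apply: i3; lia].
  by move: (dom (x k.+1 i)) eb ec ea; rewrite !row_prefixS; lia.
have [J0|J0] := leqP (x k.+1 0) J.
  have eb : (row_sum N (J) x k.+1 + 0 * J = row_prefix k.+1 0)%N.
    by apply: sum_sub_prefix => // j *; apply: leq_trans J0; apply: decr.
  have ea : (row_sum N (J) x k + 0 * J = row_prefix k 0)%N.
    by apply: sum_sub_prefix => // j *; apply: leq_trans J0; apply: i3.
  have ec : (row_sum N (J) x k.+2 = x k.+2 0 - J)%N.
    rewrite /row_sum -(big_mkord xpredT (fun j => x k.+2 j - J)%N) big_ltn; last by lia.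
    rewrite big_nat big1 ?addn0 // => -[|j] // _; apply/eqP.
    by rewrite subn_eq0; apply: leq_trans J0; apply: i1.
  move: (row 0 isT) eb ea; rewrite ec !row_prefixS /row_prefix !big_geq //.
  by have := le2 0; lia.
have [i [ik ib bi]] : exists i, [/\ (i < k.+1)%N, (J < x k.+1 i)%N & (x k.+1 i.+1 <= J)%N].
  have ex : exists i, (J < x k.+1 i)%N by exists 0.
  have ub i : (J < x k.+1 i)%N -> (i <= k)%N.
    by case: (leqP i k) => // ki; rewrite (gt_pattern0 xP).
  case: (ex_maxnP ex ub) => i ib max; exists i; split=> //; first by rewrite ltnS ub.
  by rewrite leqNgt; apply/negP => /max; rewrite ltnn.
have eb : (row_sum N (J) x k.+1 + i.+1 * J = row_prefix k.+1 i.+1)%N.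
  apply: sum_sub_prefix => [|j|j] *; [lia|apply: leq_trans (ltnW ib) _; apply: decr; lia|].
  by apply: leq_trans bi; apply: decr.
have ec : (row_sum N (J) x k.+2 + (i.+1 + (J <= x k.+2 i.+1)) * J = row_prefix k.+2 (i.+1 + (J <= x k.+2 i.+1)))%N.
  apply: sum_sub_prefix => [|j|[|j]] //; first by case: (J <= _)%N; rewrite ?addn1 ?addn0; clear -ik kN; lia.
    case: (leqP J (x k.+2 i.+1)) => [h|_].
      rewrite addn1 ltnS leq_eqVlt => /orP[/eqP->//|ji].
      by apply: leq_trans (ltnW ib) _; apply: i2; lia.
    by rewrite addn0 => ji; apply: leq_trans (ltnW ib) _; apply: i2; lia.
  case: (leqP J (x k.+2 i.+1)) => [h|h ij]; last first.
    by case: (eqVneq i j) => [<-|?]; [exact: ltnW|apply: leq_trans bi; apply: i1; lia].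
  by rewrite addn1 => ij; apply: leq_trans bi; apply: i1; lia.
have ea : (row_sum N (J) x k + (i + (J <= x k i)) * J = row_prefix k (i + (J <= x k i)))%N.
  apply: sum_sub_prefix => [|j|j] //; first by case: (J <= _)%N; rewrite ?addn1 ?addn0; clear -ik kN; lia.
    case: (leqP J (x k i)) => [h|_].
      rewrite addn1 ltnS leq_eqVlt => /orP[/eqP->//|ji].
      by apply: leq_trans (ltnW ib) _; apply: i4; lia.
    by rewrite addn0 => ji; apply: leq_trans (ltnW ib) _; apply: i4; lia.
  case: (leqP J (x k i)) => [h|h ij]; last first.
    by case: (eqVneq i j) => [<-|?]; [exact: ltnW|apply: leq_trans bi; apply: i3; lia].
  by rewrite addn1 => ij; apply: leq_trans bi; apply: i3; lia.
have := row i ik.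
(* The cases record whether the parts at least [J] extend one index further on level [k] and on
   level [k.+2]. If both do, the inequality needed is the one at [i.+1]; for [i = k] there is none,
   but then [J = 0]. *)
case: (leqP J (x k i)) ea => ai; case: (leqP J (x k.+2 i.+1)) ec => ci; rewrite ?addn1 ?addn0.
- have [e|ik'] := eqVneq i k.
    have xkk : x k i = 0%N by rewrite e (gt_pattern0 xP).
    have Jz : J = 0%N by lia.
    by move: eb; have := ge2 i; rewrite !row_prefixS Jz !muln0 xkk; lia.
  have := row i.+1; rewrite ltnS => /(_ _); rewrite ltn_neqAle ik' -ltnS ik => /(_ isT).
  by move: eb; rewrite !row_prefixS; lia.
- by move: eb; have := le1 i; rewrite !row_prefixS; lia.
- by move: eb; have := ge2 i; rewrite !row_prefixS; lia.
- by move: eb; rewrite !row_prefixS; lia.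
Qed.

End RowConditions.

Import Order.TTheory GRing.Theory Num.Theory.
Local Open Scope ring_scope.

(** * The Littlewood-Richardson rule *)

Lemma increasing_perm N (s : 'S_N) : (forall i j : 'I_N, (i < j)%N -> (s i < s j)%N) -> s = 1%g.
Proof.
have ge (t : 'S_N) : (forall i j : 'I_N, (i < j)%N -> (t i < t j)%N) -> forall i : 'I_N, (i <= t i)%N.
  move=> inc [i iN]; elim: i iN => [|i IH] iN //=.
  by have := inc (Ordinal (ltnW iN)) (Ordinal iN) (ltnSn i); apply: leq_ltn_trans; apply: IH.
move=> inc; have inc' (i j : 'I_N) : (i < j)%N -> (s^-1%g i < s^-1%g j)%N.
  move=> ij; rewrite ltnNge leq_eqVlt; apply/negP => /orP[/eqP/val_inj/perm_inj e|/inc].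
    by rewrite e ltnn in ij.
  by rewrite !permKV ltnNge (ltnW ij).
apply/permP => i; rewrite perm1; apply/val_inj/eqP; rewrite eqn_leq ge // andbT.
by have := ge _ inc' (s i); rewrite permK.
Qed.

Section Alternants.
Variable N : nat.

Definition antisymmetrize (p : {mpoly int[N]}) : {mpoly int[N]} :=
  \sum_(s : 'S_N) (-1) ^+ s *: msym s p.

Lemma antisymmetrizeD : {morph antisymmetrize : p q / p + q}.
Proof.
move=> p q; rewrite -big_split; apply: eq_bigr => s _ /=.
by rewrite msymD scalerDr.
Qed.

Lemma antisymmetrize_sum I (r : seq I) (P : pred I) (F : I -> {mpoly int[N]}) :
  antisymmetrize (\sum_(i <- r | P i) F i) = \sum_(i <- r | P i) antisymmetrize (F i).
Proof.
apply: (big_morph _ antisymmetrizeD); rewrite /antisymmetrize big1 // => s _.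
by rewrite msym0 scaler0.
Qed.

Lemma antisymmetrizeM p q : (forall s, msym s q = q) ->
  antisymmetrize (p * q) = antisymmetrize p * q.
Proof.
move=> qs; rewrite mulr_suml; apply: eq_bigr => s _.
by rewrite msymM qs scalerAl.
Qed.

Lemma antisymmetrize_msym t p : antisymmetrize (msym t p) = (-1) ^+ t *: antisymmetrize p.
Proof.
rewrite /antisymmetrize scaler_sumr (reindex_inj (mulgI t^-1%g)) /=.
apply: eq_bigr => s _; rewrite -msymMm mulKVg odd_permM odd_permV.
by rewrite signr_addb scalerA.
Qed.

Definition strictly_decreasing (m : 'X_{1..N}) := forall i j : 'I_N, (i < j)%N -> (m j < m i)%N.

(** Only the identity rearranges a strictly decreasing exponent into a strictly decreasing one, so
    at most one term of the antisymmetrization contributes. *)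
Lemma antisymmetrize_coef (m m' : 'X_{1..N}) : strictly_decreasing m -> strictly_decreasing m' ->
  (antisymmetrize 'X_[m])@_m' = (m == m')%:R.
Proof.
move=> dm dm'; rewrite /antisymmetrize raddf_sum (bigD1 1%g) //= odd_perm1 scale1r msym1m mcoeffX.
rewrite big1 ?addr0 // => s s1.
rewrite mcoeffZ msymX mcoeffX; case: eqP => [e|]; last by rewrite mulr0.
case/eqP: s1; rewrite -[s]invgK -[1%g]invg1; congr (_^-1)%g; apply: increasing_perm => i j ij.
have := dm' i j ij; rewrite -e !mnmE => h.
rewrite ltnNge leq_eqVlt; apply/negP => /orP[/eqP/val_inj/perm_inj ee|/dm].
  by rewrite ee ltnn in ij.
by rewrite ltnNge (ltnW h).
Qed.

Definition mnm_of (v : nat -> nat) : 'X_{1..N} := [multinom v i | i < N].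
Definition rho (i : nat) : nat := (N - i.+1)%N.

Definition alternant (v : nat -> nat) : {mpoly int[N]} :=
  antisymmetrize 'X_[mnm_of (fun i => v i + rho i)%N].

Lemma mnm_of_rho_decreasing v : (forall i, (i.+1 < N)%N -> (v i.+1 <= v i)%N) ->
  strictly_decreasing (mnm_of (fun i => v i + rho i)%N).
Proof.
move=> vd i j ij; rewrite !mnmE /rho.
suff : (v j <= v i)%N by have := ltn_ord j; lia.
have := ltn_ord j; rewrite -(subnK ij); elim: (j - i.+1)%N => [|d IH] dN.
  exact: vd.
by apply: leq_trans (vd _ _) (IH _); lia.
Qed.

Lemma alternant_coef v w : (forall i, (i.+1 < N)%N -> (v i.+1 <= v i)%N) ->
  (forall i, (i.+1 < N)%N -> (w i.+1 <= w i)%N) ->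
  (alternant v)@_(mnm_of (fun i => w i + rho i)%N) = [forall i : 'I_N, v i == w i]%:R.
Proof.
move=> vd wd; rewrite antisymmetrize_coef; try exact: mnm_of_rho_decreasing.
congr (nat_of_bool _)%:R; apply/eqP/forallP => [/mnmP e i|e].
  by have := e i; rewrite !mnmE => /addIn ->.
by apply/mnmP => i; rewrite !mnmE (eqP (e i)).
Qed.

Lemma alternant_swap v w (k : nat) : (0 < k < N)%N ->
  (v k + rho k = w k.-1 + rho k.-1)%N -> (v k.-1 + rho k.-1 = w k + rho k)%N ->
  (forall r, r != k -> r != k.-1 -> v r = w r) -> alternant v = - alternant w.
Proof.
move=> /andP[k0 kN] e1 e2 e3; have kN' : (k.-1 < N)%N by lia.
pose t : 'S_N := tperm (Ordinal kN') (Ordinal kN).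
rewrite /alternant.
have -> : 'X_[mnm_of (fun i => v i + rho i)%N] = msym t 'X_[mnm_of (fun i => w i + rho i)%N] :> {mpoly int[N]}.
  rewrite msymX; congr mpolyX; apply/mnmP => i; rewrite !mnmE /t tpermV.
  case: tpermP => [->|->|/eqP n1 /eqP n2] //=.
  by rewrite e3.
rewrite antisymmetrize_msym odd_tperm -val_eqE /= (_ : k.-1 != k) ?expr1 ?scaleN1r //; lia.
Qed.

End Alternants.

(** Patterns are functions on [nat] and cannot index a finite sum; this type stores their values up
    to level [N], bounded by [M]. *)
Definition pat (N M : nat) : finType := {ffun 'I_N.+1 * 'I_N -> 'I_M.+1}.

Section Pat.
Variables N M : nat.
Implicit Types (p : pat N M) (x : nat -> nat -> nat) (mu la : nat -> nat).

Definition pat_val p (k i : nat) : nat :=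
  if insub k is Some k' then if insub i is Some i' then p (k', i') : nat else 0%N else 0%N.

Definition mk_pat x : pat N M := [ffun q : 'I_N.+1 * 'I_N => inord (x q.1 q.2)].

Lemma pat_valE p (k : 'I_N.+1) (i : 'I_N) : pat_val p k i = p (k, i).
Proof. by rewrite /pat_val !valK. Qed.

Lemma pat_val_le p k i : (pat_val p k i <= M)%N.
Proof.
rewrite /pat_val; case: insub => // k'; case: insub => // i'.
by rewrite -ltnS.
Qed.

Lemma pat_val_out p k i : ((N < k) || (N <= i))%N -> pat_val p k i = 0%N.
Proof.
rewrite /pat_val; case: insubP => // k' /ltnSE kN _; case: insubP => // i' iN _.
lia.
Qed.

Lemma mk_patK mu x k i : gt_pattern N mu x -> (mu 0 <= M)%N -> (k <= N)%N ->
  pat_val (mk_pat x) k i = x k i.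
Proof.
move=> xP muM kN; have [iN|iN] := ltnP i N; last first.
  by rewrite pat_val_out ?iN ?orbT // (gt_pattern0 xP) // (leq_trans kN).
have := pat_valE (mk_pat x) (Ordinal (kN : (k < N.+1)%N)) (Ordinal iN); rewrite /= => ->.
rewrite ffunE inordK // ltnS; apply: leq_trans muM.
exact: (gt_pattern_le_top0 xP).
Qed.

Lemma pat_eq p q : (forall k i, (k <= N)%N -> pat_val p k i = pat_val q k i) -> p = q.
Proof.
move=> e; apply/ffunP => -[k i]; apply/val_inj; rewrite /= -!pat_valE.
by apply: e; rewrite -ltnS.
Qed.

Lemma gt_pattern_ext mu x y : (forall k i, (k <= N)%N -> x k i = y k i) ->
  gt_pattern N mu x -> (forall k i, (N < k)%N -> y k i = 0%N) -> gt_pattern N mu y.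
Proof.
move=> e [h1 h2 h3] y0; split=> [k i ki|k i kN|i]; last by rewrite -e.
  by have [kN|/y0->//] := leqP k N; rewrite -e // h1.
by rewrite -!e ?h2 //; lia.
Qed.

End Pat.

Lemma row_sum_ext N x y J k : (forall i, x k i = y k i) -> row_sum N J x k = row_sum N J y k.
Proof. by move=> e; apply: eq_bigr => i _; rewrite e. Qed.

(** At [k = N] this relies on truncated subtraction: level [N.+1] lies outside the pattern and reads
    0. *)
Lemma pat_val_weight_out N M (p : pat N M) k : (N <= k)%N -> weight N (pat_val p) k = 0%N.
Proof.
move=> kN; rewrite /weight [X in (X - _)%N](_ : _ = 0%N) ?sub0n //.
by rewrite /row_sum big1 // => i _; rewrite pat_val_out ?ltnS ?kN.
Qed.

Lemma eq_weight N x y k : (k < N)%N -> (forall k i, (k <= N)%N -> x k i = y k i) ->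
  weight N x k = weight N y k.
Proof.
by move=> kN e; rewrite /weight !(@row_sum_ext _ x y) // => i; apply: e; lia.
Qed.

Lemma mpoly_eq_opp N (p : {mpoly int[N]}) : p = - p -> p = 0.
Proof.
move=> e; apply/mpolyP => m; have /(congr1 (fun q => q@_m)) := e.
by rewrite mcoeffN mcoeff0; lia.
Qed.

Lemma toggle_ext N x y J k r i : (0 < k < N)%N -> (r <= N)%N ->
  (forall k i, (k <= N)%N -> x k i = y k i) -> toggle J k x r i = toggle J k y r i.
Proof.
move=> kN rN e; rewrite /toggle; case: eqP => _; last exact: e.
have eu : above_neighbour x k i = above_neighbour y k i.
  by case: i => [|i] /=; apply: e; lia.
by rewrite eu !e //; lia.
Qed.

(** * Symmetry of the generating polynomial of patterns *)

Section Stembridge.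
Variables N M : nat.
Variables (mu : nat -> nat).
Hypothesis muM : (mu 0 <= M)%N.

Definition is_gt (p : pat N M) : bool := `[< gt_pattern N mu (pat_val p) >].

Definition pat_monomial (p : pat N M) : {mpoly int[N]} := 'X_[mnm_of N (weight N (pat_val p))].

Definition gt_sum : {mpoly int[N]} := \sum_(p : pat N M | is_gt p) pat_monomial p.

Definition toggle_pat (J k : nat) (p : pat N M) : pat N M :=
  mk_pat N M (toggle J k (pat_val p)).

Section Toggle.
Variables (p : pat N M) (J k : nat).
Hypotheses (pP : is_gt p) (kN : (0 < k < N)%N).
Hypothesis crit : forall i, (J < pat_val p k i)%N -> (J < pat_val p k.-1 i)%N.

Lemma toggle_patE r i : (r <= N)%N -> pat_val (toggle_pat J k p) r i = toggle J k (pat_val p) r i.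
Proof.
by move=> rN; apply: (@mk_patK _ _ mu) => //; apply: toggle_pattern => //; apply/asboolP.
Qed.

Lemma toggle_pat_gt : is_gt (toggle_pat J k p).
Proof.
apply/asboolP; apply: (gt_pattern_ext (x := toggle J k (pat_val p))).
- by move=> r i rN; rewrite toggle_patE.
- by apply: toggle_pattern => //; apply/asboolP.
- by move=> r i Nr; rewrite pat_val_out // Nr.
Qed.

Lemma toggle_pat_row_sum J' r : (r <= N)%N -> (J <= J')%N ->
  row_sum N J' (pat_val (toggle_pat J k p)) r = row_sum N J' (pat_val p) r.
Proof.
move=> rN JJ'; rewrite -(row_sum_toggle (asboolW pP) r kN crit JJ').
by apply: row_sum_ext => i; rewrite toggle_patE.
Qed.

Lemma toggle_patK : toggle_pat J k (toggle_pat J k p) = p.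
Proof.
apply: pat_eq => r i rN.
have crit' j : (J < pat_val (toggle_pat J k p) k j)%N -> (J < pat_val (toggle_pat J k p) k.-1 j)%N.
  have [_ _ _ /(_ J (leqnn _))] := toggleK_val (asboolW pP) j kN crit.
  rewrite !toggle_patE; [|lia..]; rewrite /toggle (_ : k.-1 == k = false) ?eqxx; last by lia.
  by have := @crit j; lia.
rewrite (@mk_patK _ _ mu) //; last first.
  by apply: toggle_pattern => //; exact/asboolP/toggle_pat_gt.
rewrite -(toggle_involutive (asboolW pP) kN crit).
by apply: (@toggle_ext N) => // *; apply: toggle_patE.
Qed.

End Toggle.

(** For [J = M] no column lies beyond the toggled ones. The side condition is vacuous, and the
    toggle is the full Bender-Knuth involution, which exchanges the weights at [k-1] and [k]. *)
Lemma msym_gt_sum_adjacent (k : nat) (t : 'S_N) : (0 < k < N)%N ->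
  (forall i : 'I_N, t i = (if i == k :> nat then k.-1 else if i == k.-1 :> nat then k else i) :> nat) ->
  msym t gt_sum = gt_sum.
Proof.
move=> kN tE; rewrite /gt_sum raddf_sum /=.
have crit (p : pat N M) i : (M < pat_val p k i)%N -> (M < pat_val p k.-1 i)%N.
  by rewrite ltnNge pat_val_le.
rewrite [RHS](reindex_onto (toggle_pat M k) (toggle_pat M k)) /=; last first.
  by move=> p pP; apply: (toggle_patK pP kN (@crit p)).
apply: eq_big => [p|p pP].
  apply/idP/andP => [pP|[pP /eqP <-]]; last first.
    exact: (toggle_pat_gt pP kN (@crit _)).
  split; first exact: (toggle_pat_gt pP kN (@crit _)).
  by rewrite (toggle_patK pP kN (@crit _)).
rewrite /pat_monomial -[t]invgK msymX; congr mpolyX; apply/mnmP => i; rewrite invgK.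
have -> : (t^-1)%g = t.
  apply/eqP; rewrite eq_invg_mul; apply/eqP/permP => j; rewrite permM perm1.
  by apply/val_inj; rewrite /= !tE; do ![case: eqP => //=]; lia.
rewrite !mnmE /weight tE.
have xP : gt_pattern N mu (pat_val p) by apply/asboolP.
have := row_sum0_toggle xP kN (@crit p).
have rs0 r : row_sum N M (pat_val p) r = 0%N.
  by rewrite /row_sum big1 // => j _; apply/eqP; rewrite subn_eq0 pat_val_le.
have other r : (r <= N)%N -> (r != k) -> row_sum N 0 (pat_val (toggle_pat M k p)) r = row_sum N 0 (pat_val p) r.
  by move=> rN /negPf rk; apply: row_sum_ext => j; rewrite (toggle_patE pP kN (@crit p)) // /toggle rk.
have -> : row_sum N 0 (toggle M k (pat_val p)) k = row_sum N 0 (pat_val (toggle_pat M k p)) k.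
  by apply: row_sum_ext => j; rewrite (toggle_patE pP kN (@crit p)) //; lia.
rewrite !rs0; case/andP: (kN) => k0 kN'.
have e1 := @other k.-1; have e2 := @other k.+1.
have := row_sum_le xP 0 kN'; have := @row_sum_le _ _ _ xP 0 k.-1; rewrite prednK //.
have iN := ltn_ord i.
case: eqP => [ik|ik]; first by rewrite prednK // ik; lia.
case: eqP => [ik'|ik']; first by rewrite ik' prednK //; lia.
by have := other i; have := other i.+1; lia.
Qed.

Lemma msym_gt_sum (t : 'S_N) : msym t gt_sum = gt_sum.
Proof.
pose fixes (u : 'S_N) := msym u gt_sum = gt_sum.
have fM u v : fixes u -> fixes v -> fixes (u * v)%g.
  by move=> fu fv; rewrite /fixes msymMm fu fv.
have adj (i j : 'I_N) : j = i.+1 :> nat -> fixes (tperm i j).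
  move=> ji; apply: (@msym_gt_sum_adjacent j); first by have := ltn_ord j; lia.
  move=> r; case: tpermP => [->|->|/eqP n1 /eqP n2] /=; last first.
    by move: n1 n2; rewrite -!val_eqE /=; do ![case: eqP => //=]; lia.
  - by do ![case: eqP => //=]; lia.
  - by do ![case: eqP => //=]; lia.
have up (d : nat) : forall i j : 'I_N, j = (i + d.+1)%N :> nat -> fixes (tperm i j).
  elim: d => [|d IH] i j ji; first by apply: adj; lia.
  have kN : (i.+1 < N)%N by have := ltn_ord j; lia.
  (* Conjugation by an adjacent transposition shortens the distance between the exchanged indices by
     one. *)
  have -> : tperm i j = (tperm i (Ordinal kN) * tperm (Ordinal kN) j * tperm i (Ordinal kN))%g.
    rewrite -{1}[tperm i (Ordinal kN)]tpermV -mulgA -/(conjg _ _) tpermJ tpermR tpermD //; rewrite -val_eqE /=; lia.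
  by apply: (fM); [apply: (fM); [exact: adj|apply: IH => /=; lia]|exact: adj].
rewrite -/(fixes t); have [ts -> _] := prod_tpermP t.
elim/big_ind: _ => //; [by rewrite /fixes msym1m|].
move=> [i j] _ /=; have [ij|ij|ij] := ltngtP i j.
- by apply: (up (j - i.+1)%N); lia.
- by rewrite tpermC; apply: (up (i - j.+1)%N); lia.
- by rewrite (val_inj ij) tperm1 /fixes msym1m.
Qed.

End Stembridge.

(** * Cancellation of the non-dominant patterns *)

Section Cancellation.
Variables N M : nat.
Variables (mu la : nat -> nat).
Hypothesis muM : (mu 0 <= M)%N.
Hypothesis la_decr : forall k, (0 < k < N)%N -> (la k <= la k.-1)%N.

Definition is_dominant (p : pat N M) : bool := `[< dominant N la (pat_val p) >].

Definition twisted (p : pat N M) : {mpoly int[N]} :=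
  alternant N (fun i => la i + weight N (pat_val p) i)%N.

(** A symmetric factor can be moved inside the antisymmetrization, where each monomial merely shifts
    the exponent. *)
Lemma alternant_gt_sum : alternant N la * gt_sum N M mu = \sum_(p | is_gt mu p) twisted p.
Proof.
rewrite /alternant -antisymmetrizeM; last by move=> s; exact: msym_gt_sum.
rewrite mulr_sumr antisymmetrize_sum; apply: eq_bigr => p _.
rewrite /twisted /alternant -mpolyXD; congr (antisymmetrize (mpolyX _ _)).
by apply/mnmP => i; rewrite mnmDE !mnmE; lia.
Qed.

(** The largest failing [J] marks the rightmost failing column, and [k] is the least index failing
    there. Only columns from [J] on are consulted, and the toggle leaves them alone, so the same
    pair is selected again after toggling. *)
Definition first_failure (p : pat N M) (J k : nat) : Prop :=
  [/\ (0 < k < N)%N, ~~ dominant_at N la (pat_val p) k J,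
      forall k' J', (0 < k' < N)%N -> (J < J')%N -> dominant_at N la (pat_val p) k' J'
    & forall k', (0 < k' < k)%N -> dominant_at N la (pat_val p) k' J].

Lemma first_failure_unique p J k J' k' :
  first_failure p J k -> first_failure p J' k' -> J = J' /\ k = k'.
Proof.
move=> [kN d1 d2 d3] [k'N d1' d2' d3'].
have eJ : J = J'.
  case: (ltngtP J J') => // lt; first by rewrite (d2 _ _ _ lt) in d1'.
  by rewrite (d2' _ _ _ lt) in d1.
subst J'; split=> //; case: (ltngtP k k') => // lt; exfalso.
  by move/negP: d1; apply; apply: d3'; lia.
by move/negP: d1'; apply; apply: d3; lia.
Qed.

Lemma first_failure_exists p : is_gt mu p -> ~~ is_dominant p ->
  exists2 J, (J <= M)%N & exists k, first_failure p J k.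
Proof.
move=> /asboolP pP /asboolPn nd.
pose P J := [exists k : 'I_N, (0 < k)%N && ~~ dominant_at N la (pat_val p) k J].
have PI J k : (0 < k < N)%N -> ~~ dominant_at N la (pat_val p) k J -> P J.
  by move=> /andP[k0 kN] d; apply/existsP; exists (Ordinal kN); rewrite /= k0.
have exP : exists J, P J.
  apply: contrapT => nP; apply: nd => k J kN; apply: contrapT => /negP d.
  by apply: nP; exists J; apply: PI d.
(* Past [M] no column is left, and dominance is that of [la] itself; hence a largest failing [J]
   exists. *)
have ubP J : P J -> (J <= M)%N.
  move=> /existsP[k /andP[k0]]; apply: contraR; rewrite -ltnNge => MJ.
  have kN : (0 < k < N)%N by rewrite k0 ltn_ord.
  by apply: (dominant_at_large pP kN (la_decr kN)); apply: leq_trans muM (ltnW MJ).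
case: (ex_maxnP exP ubP) => J PJ maxJ; exists J; first exact: ubP.
have exk : exists k, (0 < k < N)%N && ~~ dominant_at N la (pat_val p) k J.
  by case/existsP: PJ => k /andP[k0 d]; exists k; rewrite k0 ltn_ord.
case: (ex_minnP exk) => k /andP[kN d] mink; exists k; split=> // [k' J' k'N JJ'|k' k'k].
  by apply/negPn/negP => d'; have := maxJ _ (PI _ _ k'N d'); rewrite leqNgt JJ'.
apply/negPn/negP => d'; have : (0 < k' < N)%N && ~~ dominant_at N la (pat_val p) k' J by rewrite d'; lia.
by move/mink; lia.
Qed.

Definition flip (p : pat N M) : pat N M :=
  if [pick q : 'I_M.+1 * 'I_N | `[< first_failure p q.1 q.2 >]] is Some q
  then toggle_pat q.1 q.2 p else p.

Lemma flipE p J k : (J <= M)%N -> first_failure p J k -> flip p = toggle_pat J k p.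
Proof.
rewrite -ltnS => JM f; have kN : (k < N)%N by case: f => /andP[].
rewrite /flip; case: pickP => [q /asboolP fq|/(_ (Ordinal JM, Ordinal kN))].
  by have [-> ->] := first_failure_unique f fq.
by move/asboolPn; case.
Qed.

Section OneFailure.
Variables (p : pat N M) (J k : nat).
Hypotheses (pP : is_gt mu p) (f : first_failure p J k).

Lemma first_failureP : (0 < k < N)%N /\
  ((la k + row_sum N J (pat_val p) k.+1 + row_sum N J (pat_val p) k.-1 =
      (la k.-1 + 2 * row_sum N J (pat_val p) k).+1)%N /\
   forall i, (J < pat_val p k i)%N -> (J < pat_val p k.-1 i)%N).
Proof.
case: (f) => kN nd d _; split=> //.
exact: (dominant_at_first_failure (asboolW pP) kN nd (d k J.+1 kN (ltnSn J))).
Qed.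

Lemma first_failure_toggle : first_failure (toggle_pat J k p) J k.
Proof.
have [kN [_ crit]] := first_failureP.
have e k' J' : (0 < k' < N)%N -> (J <= J')%N ->
    dominant_at N la (pat_val (toggle_pat J k p)) k' J' = dominant_at N la (pat_val p) k' J'.
  by move=> k'N JJ'; rewrite /dominant_at !(toggle_pat_row_sum muM pP kN crit) //; lia.
case: f => _ h1 h2 h3; split=> // [|k' J' k'N JJ'|k' k'k]; first by rewrite e.
  by rewrite e ?h2 // ltnW.
by rewrite e ?h3 //; lia.
Qed.

Lemma twisted_toggle : twisted p = - twisted (toggle_pat J k p).
Proof.
have [kN [dj crit]] := first_failureP.
have [h1 h2 h3] := weight_toggle (asboolW pP) kN crit dj.
have e r : weight N (pat_val (toggle_pat J k p)) r = weight N (toggle J k (pat_val p)) r.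
  have [rN|Nr] := ltnP r N.
    by apply: eq_weight => // *; apply: (toggle_patE muM pP kN crit).
  rewrite pat_val_weight_out // h3 ?pat_val_weight_out //; lia.
apply: (alternant_swap kN); rewrite ?e /rho; try lia.
by move=> r rk rk'; rewrite e h3.
Qed.

End OneFailure.

(** On the non-dominant patterns [flip] is an involution that changes the sign of the summand, so
    their sum is its own opposite. *)
Lemma twisted_sum : \sum_(p | is_gt mu p) twisted p = \sum_(p | is_gt mu p && is_dominant p) twisted p.
Proof.
rewrite (bigID is_dominant) /= [X in _ + X](_ : _ = 0) ?addr0 //.
have flipP p : is_gt mu p -> ~~ is_dominant p ->
    [/\ is_gt mu (flip p), ~~ is_dominant (flip p), flip (flip p) = p & twisted p = - twisted (flip p)].
  move=> pP nd; have [J JM [k f]] := first_failure_exists pP nd.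
  have [kN [dj crit]] := first_failureP pP f.
  have f' := first_failure_toggle pP f.
  rewrite (flipE JM f) (flipE JM f'); split.
  - exact: toggle_pat_gt.
  - by case: f' => kN' /negP nd' _ _; apply/asboolPn => d; apply: nd'; apply: d.
  - exact: (toggle_patK muM pP kN crit).
  - exact: twisted_toggle.
apply: mpoly_eq_opp; rewrite -sumrN.
rewrite [LHS](reindex_onto flip flip) /=; last first.
  by move=> p /andP[pP nd]; have [] := flipP p pP nd.
apply: eq_big => [p|p /andP[/andP[pP nd] /eqP e]]; last first.
  by have [_ _ _ ->] := flipP _ pP nd; rewrite e.
apply/idP/idP => [/andP[/andP[pP nd] /eqP e]|/andP[pP nd]].
  by have [+ + _ _] := flipP _ pP nd; rewrite e => -> ->.
by have [-> -> -> _] := flipP _ pP nd; rewrite eqxx.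
Qed.

Lemma alternant_gt_sum_dominant :
  alternant N la * gt_sum N M mu = \sum_(p | is_gt mu p && is_dominant p) twisted p.
Proof. by rewrite alternant_gt_sum twisted_sum. Qed.

End Cancellation.

Lemma alternant_ext N v w : (forall i, (i < N)%N -> v i = w i) -> alternant N v = alternant N w.
Proof.
by move=> e; congr (antisymmetrize (mpolyX _ _)); apply/mnmP => i; rewrite !mnmE e.
Qed.

Section Bialternant.
Variable N : nat.

(** The Vandermonde determinant, being the alternant of exponent [rho]. *)
Definition alt0 : {mpoly int[N]} := alternant N (fun=> 0%N).

Lemma alt0_neq0 : alt0 != 0.
Proof.
apply/eqP => /(congr1 (fun q => q@_(mnm_of N (fun i => 0 + rho N i)%N))).
rewrite alternant_coef // mcoeff0; case: forallP => // -[] i; exact: eqxx.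
Qed.

(** Jacobi's bialternant formula: over [la = 0] the highest pattern is the only dominant one, and
    its weight is [mu]. *)
Lemma alt0_gt_sum M mu : (mu 0 <= M)%N -> (forall i, mu i.+1 <= mu i)%N ->
  (forall i, (N <= i)%N -> mu i = 0%N) -> alt0 * gt_sum N M mu = alternant N mu.
Proof.
move=> muM mud mu0; rewrite alternant_gt_sum_dominant //.
have hP := highest_patternP mud mu0.
pose p0 := mk_pat N M (highest_pattern mu).
have p0E k i : (k <= N)%N -> pat_val p0 k i = highest_pattern mu k i.
  by move=> kN; apply: (mk_patK i hP muM kN).
rewrite (big_pred1 p0) => [|p].
  apply: alternant_ext => i iN; rewrite add0n -[RHS](weight_highest mu iN).
  by apply: eq_weight => // *; rewrite p0E.
apply/andP/eqP => [[/asboolP pP /asboolP pd]|->].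
  apply: pat_eq => k i kN; rewrite p0E // /highest_pattern; case: ltnP => ik.
    exact: (dominant0_row pP pd).
  by rewrite (gt_pattern0 pP).
split; apply/asboolP.
  apply: (gt_pattern_ext _ hP) => [k i kN|k i Nk]; first by rewrite p0E.
  by rewrite pat_val_out // Nk.
move=> k J kN; have := dominant_highest mud J kN; rewrite /dominant_at.
rewrite !(@row_sum_ext _ (pat_val p0) (highest_pattern mu)) // => i; apply: p0E; lia.
Qed.

End Bialternant.

(** * Schur polynomials *)

Section Parts.
Implicit Types k l : intpart.

Lemma nth_part_decr k i : (nth 0%N k i.+1 <= nth 0%N k i)%N.
Proof.
have /andP[sk _] := intpartP k.
have [ik|ik] := ltnP i.+1 (size k); last by rewrite nth_default.
have tr : transitive geq by move=> x y z; rewrite /= => h1 h2; exact: leq_trans h2 h1.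
by apply: (sorted_ltn_nth tr 0%N sk) => //; rewrite inE // ltnW.
Qed.

Lemma nth_part_gt0 k i : (0 < nth 0%N k i)%N = (i < size k)%N.
Proof.
have /andP[_ k0] := intpartP k.
have [ik|ik] := ltnP i (size k); last by rewrite nth_default.
by rewrite lt0n; apply: contra k0 => /eqP <-; rewrite mem_nth.
Qed.

Lemma intpart_eq k l : (forall i, nth 0%N k i = nth 0%N l i) -> k = l.
Proof.
move=> e; apply: val_inj; apply: (@eq_from_nth _ 0%N) => // .
case: (ltngtP (size k) (size l)) => // h.
  by have := nth_part_gt0 l (size k); rewrite h -e nth_default.
by have := nth_part_gt0 k (size l); rewrite h e nth_default.
Qed.

(** The default of [insubd], the empty partition, is not taken when [v] is weakly decreasing. *)
Definition part_of (N : nat) (v : nat -> nat) : intpart :=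
  insubd (IntPart (isT : is_intpart [::])) [seq x <- mkseq v N | (0 < x)%N].

Lemma nth_part_of N v i : (forall i, v i.+1 <= v i)%N -> (forall i, N <= i -> v i = 0)%N ->
  nth 0%N (part_of N v) i = v i.
Proof.
move=> vd v0.
have vle a b : (a <= b)%N -> (v b <= v a)%N.
  by move=> /subnK <-; elim: (b - a)%N => // d IH; apply: leq_trans IH; rewrite addSn.
have tr : transitive geq by move=> x y z; rewrite /= => h1 h2; exact: leq_trans h2 h1.
have sv n : sorted geq (mkseq v n).
  rewrite /mkseq sorted_map; apply: sub_sorted (iota_ltn_sorted 0 n) => a b /ltnW; exact: vle.
rewrite /part_of insubdK; last first.
  by rewrite unfold_in /is_intpart mem_filter ltnn /= andbT sorted_filter.
elim: N v0 => [|N IH] v0; first by rewrite /= nth_nil v0.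
rewrite mkseqS filter_rcons.
case: (ltnP 0 (v N)) => vN; last first.
  by rewrite IH // => j Nj; apply/eqP; rewrite -leqn0; apply: leq_trans vN; apply: vle.
have -> : [seq x <- mkseq v N | (0 < x)%N] = mkseq v N.
  apply/all_filterP/allP => x /mapP[j]; rewrite mem_iota => /andP[_ jN] ->.
  by apply: leq_trans vN (vle _ _ _); lia.
rewrite -mkseqS; have [iN|Ni] := ltnP i N.+1; first by rewrite nth_mkseq.
by rewrite nth_default ?size_mkseq // v0.
Qed.

Lemma size_part_le k N : (forall i, (N <= i)%N -> nth 0%N k i = 0%N) -> (size k <= N)%N.
Proof. by move=> k0; rewrite leqNgt -nth_part_gt0 k0. Qed.

Lemma psize_sum k N : (size k <= N)%N -> psize k = (\sum_(i < N) nth 0%N k i)%N.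
Proof.
move=> kN; rewrite /psize sumnE (big_nth 0%N) -(big_mkord xpredT (fun i => nth 0%N k i)).
rewrite (@big_cat_nat _ _ _ (size k) 0 N) //= [X in (_ + X)%N]big_nat [X in (_ + X)%N]big1 ?addn0 //.
by move=> i /andP[ki _]; rewrite nth_default.
Qed.

Lemma plength_le_psize k : (size k <= psize k)%N.
Proof.
rewrite (psize_sum (leqnn _)) -[X in (X <= _)%N](card_ord (size k)) -sum1_card.
by apply: leq_sum => i _; rewrite nth_part_gt0.
Qed.

End Parts.

(** * Semistandard tableaux as Gelfand-Tsetlin patterns *)

Section Tableaux.
Variables (k : intpart) (N : nat).
Local Notation mu := (nth 0%N k).
Implicit Types T : {ffun cell k -> 'I_N}.

Lemma semistandardP (T : {ffun cell k -> 'I_N}) : reflect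
  ((forall b b', row_of b = row_of b' -> (col_of b < col_of b')%N -> (T b <= T b')%N) /\
   (forall b b', col_of b = col_of b' -> (row_of b < row_of b')%N -> (T b < T b')%N))
  (semistandard T).
Proof.
apply: (iffP forallP) => [h|[h1 h2] b]; last first.
  apply/forallP => b'; apply/andP; split; apply/implyP => /andP[/eqP e l]; auto.
by split=> b b' e l; have /forallP/(_ b')/andP[/implyP h1 /implyP h2] := h b; auto;
  [apply: h1|apply: h2]; rewrite e eqxx.
Qed.

Lemma cell_eq (b b' : cell k) : row_of b = row_of b' -> col_of b = col_of b' -> b = b'.
Proof.
case: b b' => i c [i' c']; rewrite /row_of /col_of /= => /val_inj e.
by case: _ / e c' => c' /val_inj ->.
Qed.

Lemma cell_exists i c : (c < mu i)%N -> exists b : cell k, row_of b = i /\ col_of b = c.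
Proof.
move=> ci; have ik : (i < size k)%N by rewrite -nth_part_gt0; apply: leq_ltn_trans ci.
by exists (Tagged (fun i : 'I_(size k) => 'I_(nth 0%N k i)) (Ordinal ci : 'I_(nth 0%N k (Ordinal ik)))).
Qed.

(* Junk value 0 outside the diagram. *)
Definition entry (T : {ffun cell k -> 'I_N}) (i c : nat) : nat :=
  if [pick b : cell k | (row_of b == i) && (col_of b == c)] is Some b then T b else 0%N.

Lemma entryE T b : entry T (row_of b) (col_of b) = T b.
Proof.
rewrite /entry; case: pickP => [b' /andP[/eqP e1 /eqP e2]|/(_ b)]; last by rewrite !eqxx.
by rewrite (cell_eq e1 e2).
Qed.

Lemma entry_at T b i c : row_of b = i -> col_of b = c -> entry T i c = T b.
Proof. by move=> <- <-; rewrite entryE. Qed.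

Lemma entry_lt T i c : (c < mu i)%N -> (entry T i c < N)%N.
Proof. by move=> /cell_exists[b [<- <-]]; rewrite entryE. Qed.

Lemma semistandard_entry (T : {ffun cell k -> 'I_N}) : reflect
  ((forall i c c', (c' < mu i)%N -> (c < c')%N -> (entry T i c <= entry T i c')%N) /\
   (forall i i' c, (c < mu i')%N -> (c < mu i)%N -> (i < i')%N -> (entry T i c < entry T i' c)%N))
  (semistandard T).
Proof.
apply: (iffP (semistandardP T)) => -[h1 h2]; split.
- move=> i c c' c'i cc'; have [b [e1 e2]] := cell_exists c'i.
  have [b' [e1' e2']] := cell_exists (ltn_trans cc' c'i).
  by rewrite (entry_at T e1 e2) (entry_at T e1' e2'); apply: h1; rewrite ?e1 ?e1' ?e2 ?e2'.
- move=> i i' c ci' ci ii'; have [b [e1 e2]] := cell_exists ci.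
  have [b' [e1' e2']] := cell_exists ci'.
  by rewrite (entry_at T e1 e2) (entry_at T e1' e2'); apply: h2; rewrite ?e1 ?e1' ?e2 ?e2'.
- move=> b b' e l; rewrite -!entryE e; apply: h1 => //; exact: (ltn_ord (tagged b')).
- move=> b b' e l; rewrite -!entryE -e; apply: h2 => //; last exact: (ltn_ord (tagged b)).
  by rewrite e; exact: (ltn_ord (tagged b')).
Qed.

(** Rows of a semistandard tableau increase weakly, so the entries smaller than [s] fill the first
    [x s i] cells of row [i]. *)
Definition encodes (T : {ffun cell k -> 'I_N}) (x : nat -> nat -> nat) : Prop :=
  forall s i c, (s <= N)%N -> (c < mu i)%N -> (entry T i c < s)%N = (c < x s i)%N.

Definition tableau_pattern (T : {ffun cell k -> 'I_N}) (s i : nat) : nat :=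
  if (s <= N)%N then (\sum_(c < mu i) (entry T i c < s))%N else 0%N.

Lemma sum_cells (F : nat -> nat -> nat) :
  (\sum_(b : cell k) F (row_of b) (col_of b) = \sum_(i < size k) \sum_(c < mu i) F i c)%N.
Proof.
by rewrite (sig_big_dep _ _ (fun (i : 'I_(size k)) (c : 'I_(mu i)) => F i c)).
Qed.

Lemma sum_initial (P : pred nat) m : (forall c c', (c' < m)%N -> (c < c')%N -> P c' -> P c) ->
  forall c, (c < m)%N -> P c = (c < \sum_(c < m) P c)%N.
Proof.
elim: m => // m IH Pd c; rewrite big_ord_recr /= ltnS leq_eqVlt.
have le : (\sum_(i < m) P i <= m)%N.
  by rewrite -[X in (_ <= X)%N](card_ord m) -sum1_card; apply: leq_sum => i _; exact: leq_b1.
case: (boolP (P m)) => Pm.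
  have -> : (\sum_(i < m) P i = m)%N.
    rewrite -[RHS](card_ord m) -sum1_card; apply: eq_bigr => i _.
    by rewrite (Pd i m).
  by move=> /orP[/eqP->|cm]; rewrite addn1 ltnS ?Pm ?leqnn // (ltnW cm) (Pd c m).
rewrite addn0 => /orP[/eqP->|cm]; first by rewrite (negPf Pm) ltnNge le.
by apply: IH => // c1 c2 h; apply: Pd; rewrite ltnW.
Qed.

Lemma tableau_pattern_encodes T : semistandard T -> encodes T (tableau_pattern T).
Proof.
move=> /semistandard_entry[row _] s i c sN ci; rewrite /tableau_pattern sN.
apply: (sum_initial (P := fun c => (entry T i c < s)%N)) => // c1 c2 h1 h2.
by apply: leq_ltn_trans; apply: row.
Qed.

Lemma semistandard_entry_ge T i c : semistandard T -> (c < mu i)%N -> (i <= entry T i c)%N.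
Proof.
move=> /semistandard_entry[_ col]; elim: i => // i IH ci.
have ci' : (c < mu i)%N by apply: leq_trans ci (nth_part_decr k i).
by apply: leq_ltn_trans (IH ci') _; apply: col.
Qed.

Lemma semistandard_size T : semistandard T -> (size k <= N)%N.
Proof.
move=> ss; rewrite leqNgt; apply/negP => Nk.
have N0 : (0 < mu N)%N by rewrite nth_part_gt0.
by have := semistandard_entry_ge ss N0; rewrite leqNgt entry_lt.
Qed.

Lemma tableau_pattern_le T s i : (tableau_pattern T s i <= mu i)%N.
Proof.
rewrite /tableau_pattern; case: ifP => // _.
by rewrite -[X in (_ <= X)%N](card_ord (mu i)) -sum1_card; apply: leq_sum => j _; exact: leq_b1.
Qed.

Lemma tableau_pattern_gt T : semistandard T -> gt_pattern N mu (tableau_pattern T).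
Proof.
move=> ss; have enc := tableau_pattern_encodes ss.
split=> [s i si|s i sN|i].
- rewrite /tableau_pattern; case: ifP => // sN; rewrite big1 // => c _.
  by rewrite ltnNge (leq_trans si) // semistandard_entry_ge.
- apply/andP; split.
    case: (posnP (tableau_pattern T s.+1 i.+1)) => [->//|gt0].
    have c1 := tableau_pattern_le T s.+1 i.+1.
    rewrite -(prednK gt0); have ci : ((tableau_pattern T s.+1 i.+1).-1 < mu i.+1)%N by lia.
    have ci' := leq_trans ci (nth_part_decr k i).
    rewrite -enc //; last by rewrite ltnW.
    have := enc s.+1 i.+1 _ sN ci; rewrite (prednK gt0) leqnn ltnS; apply: leq_trans.
    by have /semistandard_entry[_ col] := ss; apply: col.
  by rewrite /tableau_pattern sN (ltnW sN); apply: leq_sum => c _; case: (ltnP (entry T i c) s) => // /leqW ->.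
- rewrite /tableau_pattern leqnn -[RHS](card_ord (mu i)) -sum1_card.
  by apply: eq_bigr => c _; rewrite entry_lt.
Qed.

Lemma encodes_inj T T' x : encodes T x -> encodes T' x -> T = T'.
Proof.
move=> e e'; apply/ffunP => b; apply: val_inj; rewrite /= -!entryE.
have cb : (col_of b < mu (row_of b))%N by exact: (ltn_ord (tagged b)).
have h s : (s <= N)%N -> (entry T (row_of b) (col_of b) < s)%N = (entry T' (row_of b) (col_of b) < s)%N.
  by move=> sN; rewrite e ?e'.
case: (ltngtP (entry T (row_of b) (col_of b)) (entry T' (row_of b) (col_of b))) => // lt.
  by have := h _ (ltnW (entry_lt T' cb)); rewrite lt ltnn.
by have := h _ (ltnW (entry_lt T cb)); rewrite lt ltnn.
Qed.

Lemma encodes_exists x : gt_pattern N mu x -> exists2 T, semistandard T & encodes T x.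
Proof.
move=> xP.
have ex (b : cell k) : exists r : 'I_N, forall s, (s <= N)%N -> (r < s)%N = (col_of b < x s (row_of b))%N.
  have cb : (col_of b < x N (row_of b))%N by rewrite (gt_pattern_top xP); exact: (ltn_ord (tagged b)).
  have exs : exists s, (col_of b < x s (row_of b))%N by exists N.
  (* The entry of a cell is the predecessor of the least level at which its row reaches past the
     cell. *)
  case: (ex_minnP exs) => -[|r]; first by rewrite (gt_pattern0 xP).
  move=> cr rmin; have rN : (r < N)%N by apply: rmin.
  exists (Ordinal rN) => s sN /=; apply/idP/idP => [rs|/rmin //].
  apply: leq_trans cr _; rewrite -(subnKC rs).
  have : (r.+1 + (s - r.+1) <= N)%N by lia.
  elim: (s - r.+1)%N => [|d IH] dN; first by rewrite addn0.
  rewrite addnS; apply: leq_trans (IH _) (gt_pattern_le xP _ _); lia.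
pose T : {ffun cell k -> 'I_N} := [ffun b => projT1 (cid (ex b))].
have enc : encodes T x.
  by move=> s i c sN /cell_exists[b [<- <-]]; rewrite entryE ffunE; case: cid => r /= ->.
exists T => //; apply/semistandard_entry; split.
- move=> i c c' ci' cc'; have ci := ltn_trans cc' ci'.
  rewrite -ltnS enc //; last by apply: entry_lt.
  by apply: ltn_trans cc' _; rewrite -enc //; apply: entry_lt.
- move=> i i' c ci' ci ii'; rewrite enc //; last by apply: ltnW; apply: entry_lt.
  have eN := entry_lt T ci'; have := enc (entry T i' c).+1 i' c eN ci'; rewrite ltnSn => /esym h.
  case: i' ii' ci' eN h => // i' ii' ci' eN h.
  apply: leq_trans h (leq_trans (gt_pattern_ge xP _ eN) _).
  by apply: (gt_pattern_decr_le xP) => //; exact: ltnW.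
Qed.

Lemma tableau_pattern_unique T x : gt_pattern N mu x -> encodes T x ->
  forall s i, (s <= N)%N -> tableau_pattern T s i = x s i.
Proof.
move=> xP enc s i sN; rewrite /tableau_pattern sN.
have xle : (x s i <= mu i)%N by apply: (gt_pattern_le_top xP).
rewrite (eq_bigr (fun c : 'I_(mu i) => (c < x s i) : nat)%N); last by move=> c _; rewrite enc.
rewrite -(big_mkord xpredT (fun c => (c < x s i) : nat)%N) (@big_cat_nat _ _ _ (x s i)) //=.
rewrite [X in (_ + X)%N]big_nat [X in (_ + X)%N]big1 ?addn0; last by move=> c; lia.
rewrite (eq_big_nat _ _ (F2 := fun=> 1%N)); last by move=> c /andP[_ ->].
by rewrite sum_nat_const_nat; lia.
Qed.

Lemma count_entries T s : (size k <= N)%N -> (s <= N)%N ->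
  (\sum_(b : cell k) (T b < s) = row_sum N 0 (tableau_pattern T) s)%N.
Proof.
move=> kN sN; rewrite (eq_bigr (fun b : cell k => (entry T (row_of b) (col_of b) < s) : nat)%N); last first.
  by move=> b _; rewrite entryE.
rewrite (sum_cells (fun i c => (entry T i c < s) : nat)%N) /row_sum.
rewrite -(big_mkord xpredT (fun i => tableau_pattern T s i - 0)%N) (@big_cat_nat _ _ _ (size k)) //=.
rewrite big_mkord [X in (_ + X)%N]big_nat [X in (_ + X)%N]big1 ?addn0.
  by apply: eq_bigr => i _; rewrite subn0 /tableau_pattern sN.
move=> i /andP[ki _]; apply/eqP; rewrite subn0 -leqn0.
by apply: leq_trans (tableau_pattern_le _ _ _) _; rewrite nth_default.
Qed.

Lemma tableau_monomial T : semistandard T ->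
  \prod_b 'X_(T b) = 'X_[mnm_of N (weight N (tableau_pattern T))] :> {mpoly int[N]}.
Proof.
move=> ss; have kN := semistandard_size ss.
transitivity ('X_[\big[mnm_add/0%MM]_b (U_(T b))%MM] : {mpoly int[N]}).
  by rewrite (big_morph (fun m => 'X_[m] : {mpoly int[N]}) (@mpolyXD _ _) (@mpolyX0 _ _)).
congr mpolyX; apply/mnmP => r.
rewrite mnm_sumE !mnmE /weight -!count_entries //; [|exact: ltnW..].
have -> : (\sum_(b : cell k) (T b < r.+1) = \sum_(b : cell k) (T b < r) + \sum_(b : cell k) U_(T b)%MM r)%N.
  rewrite -big_split; apply: eq_bigr => b _; rewrite mnm1E -val_eqE /=.
  by case: ltngtP; lia.
by rewrite addKn.
Qed.

Lemma schur_gt M : (mu 0 <= M)%N -> (size k <= N)%N -> schur k N = gt_sum N M mu.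
Proof.
move=> muM kN; rewrite /schur /gt_sum.
pose h T := mk_pat N M (tableau_pattern T).
have hE T s i : semistandard T -> (s <= N)%N -> pat_val (h T) s i = tableau_pattern T s i.
  by move=> ss sN; apply: mk_patK (tableau_pattern_gt ss) muM sN.
have hinj : {in [pred T | semistandard T] &, injective h}.
  move=> T T' ss ss' e; apply: (@encodes_inj _ _ (pat_val (h T))).
    by move=> s i c sN ci; rewrite hE //; apply: tableau_pattern_encodes.
  by move=> s i c sN ci; rewrite e hE //; apply: tableau_pattern_encodes.
pose S : {set {ffun cell k -> 'I_N}} := [set T : {ffun cell k -> 'I_N} | semistandard T].
transitivity (\sum_(p in h @: S) pat_monomial p).
  rewrite big_imset /=; last by move=> T T'; rewrite !inE; exact: hinj.
  apply: eq_big => [T|T ss]; first by rewrite inE.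
  rewrite tableau_monomial // /pat_monomial.
  by congr mpolyX; apply/mnmP => i; rewrite !mnmE; apply: eq_weight => // s j sN; rewrite hE.
apply: eq_bigl; move=> p; apply/imsetP/asboolP => [[T]|pP].
  rewrite inE => ss ->; apply: gt_pattern_ext (tableau_pattern_gt ss) _ => [s i sN|s i Ns].
    by rewrite hE.
  by rewrite pat_val_out // Ns.
have [T ss enc] := encodes_exists pP; exists T; rewrite ?inE //.
by apply: pat_eq => s i sN; rewrite hE // (tableau_pattern_unique pP).
Qed.

Lemma schur_eq0 : (N < size k)%N -> schur k N = 0.
Proof.
move=> Nk; rewrite /schur big_pred0 // => T; apply/negP => /semistandard_size.
by rewrite leqNgt Nk.
Qed.

End Tableaux.

(** * Changing the number of variables *)

Section Restriction.
Variables (N0 N : nat).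
Hypothesis NN0 : (N <= N0)%N.

Definition restrict_vars (p : {mpoly int[N0]}) : {mpoly int[N]} :=
  p \mPo [tuple (if insub (i : nat) is Some j then 'X_(j : 'I_N) else 0) | i < N0].

Lemma restrict_vars_prod (k : intpart) (T : {ffun cell k -> 'I_N0}) :
  restrict_vars (\prod_b 'X_(T b)) =
  \prod_b (if insub (T b : nat) is Some j then 'X_(j : 'I_N) else 0).
Proof.
rewrite /restrict_vars rmorph_prod; apply: eq_bigr => b _ /=.
by rewrite comp_mpolyXU -tnth_nth tnth_mktuple.
Qed.

(** The substitution kills the monomials of the tableaux that use a letter from [N] on; the others
    are the tableaux in [N] letters. *)
Lemma restrict_vars_schur k : restrict_vars (schur k N0) = schur k N.
Proof.
rewrite /schur /restrict_vars raddf_sum /=.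
rewrite (eq_bigr _ (fun T _ => restrict_vars_prod T)).
pose small (T : {ffun cell k -> 'I_N0}) := [forall b, T b < N]%N.
rewrite (bigID small) /= [X in _ + X]big1 ?addr0 => [|T /andP[_]]; last first.
  rewrite negb_forall => /existsP[b bN]; rewrite (bigD1 b) //= insubN ?mul0r //.
pose w (T : {ffun cell k -> 'I_N}) : {ffun cell k -> 'I_N0} := [ffun b => widen_ord NN0 (T b)].
have ssw T : semistandard (w T) = semistandard T.
  by apply: eq_forallb => b; apply: eq_forallb => b'; rewrite !ffunE.
have winj : injective w.
  move=> T T' /ffunP e; apply/ffunP => b; apply: val_inj.
  by have := e b; rewrite !ffunE => /(congr1 val).
pose S : {set {ffun cell k -> 'I_N}} := [set T : {ffun cell k -> 'I_N} | semistandard T].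
transitivity (\sum_(T in w @: S) \prod_b (if insub (T b : nat) is Some j then 'X_(j : 'I_N) else 0) : {mpoly int[N]}).
  apply: eq_bigl => T; apply/andP/imsetP => [[ss /forallP sm]|[T' + ->]].
    pose T' : {ffun cell k -> 'I_N} := [ffun b => Ordinal (sm b)].
    have e : T = w T' by apply/ffunP => b; apply: val_inj; rewrite !ffunE.
    by exists T' => //; rewrite inE -ssw -e.
  rewrite inE ssw => ->; split=> //; apply/forallP => b; rewrite !ffunE /=; exact: ltn_ord.
rewrite big_imset /=; last by move=> ? ? _ _; exact: winj.
apply: eq_big => [T|T _]; first by rewrite inE.
by apply: eq_bigr => b _; rewrite ffunE /= valK.
Qed.

Lemma restrict_varsM p q : restrict_vars (p * q) = restrict_vars p * restrict_vars q.
Proof. exact: rmorphM. Qed.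

End Restriction.

Lemma alternant_schur N (k : intpart) : (size k <= N)%N -> alt0 N * schur k N = alternant N (nth 0%N k).
Proof.
move=> kN; rewrite (@schur_gt _ _ (nth 0%N k 0)) // alt0_gt_sum // => i; first exact: nth_part_decr.
by move=> Ni; rewrite nth_default // (leq_trans kN).
Qed.

(** By the bialternant formula, this extracts the coefficient of the Schur polynomial of [mu] from a
    combination of Schur polynomials. *)
Definition partition_coef N (p : {mpoly int[N]}) (mu : nat -> nat) : int :=
  (alt0 N * p)@_(mnm_of N (fun i => mu i + rho N i)%N).

Lemma partition_coef_schur N (k mu : intpart) : (size mu <= N)%N ->
  partition_coef (schur k N) (nth 0%N mu) = (k == mu)%:R.
Proof.
move=> muN; rewrite /partition_coef; have [kN|Nk] := leqP (size k) N; last first.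
  rewrite schur_eq0 // mulr0 mcoeff0; case: eqP => // e.
  by rewrite e ltnNge muN in Nk.
rewrite alternant_schur // alternant_coef; try by move=> i _; exact: nth_part_decr.
congr (nat_of_bool _)%:R; apply/forallP/eqP => [h|-> //].
apply: intpart_eq => i; have [iN|Ni] := ltnP i N; first exact: (eqP (h (Ordinal iN))).
by rewrite !nth_default // (leq_trans _ Ni).
Qed.

Definition expands_in N (al be : intpart) (c : {fsfun intpart -> int with 0}) : Prop :=
  schur al N * schur be N = \sum_(k <- finsupp c) c k *: schur k N.

Lemma expands_in_coef al be c N (mu : intpart) : expands_in N al be c -> (size mu <= N)%N ->
  c mu = partition_coef (schur al N * schur be N) (nth 0%N mu).
Proof.
move=> -> muN; rewrite /partition_coef mulr_sumr raddf_sum /=.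
transitivity (\sum_(k <- finsupp c) c k * (k == mu)%:R).
  have [muc|muc] := boolP (mu \in finsupp c).
    rewrite (big_fsetD1 mu) //= eqxx mulr1 big_seq_cond big1 ?addr0 // => k.
    by rewrite andbT in_fsetD1 => /andP[/negPf ->]; rewrite mulr0.
  rewrite fsfun_dflt // big_seq_cond big1 // => k; rewrite andbT => kc.
  by case: eqP => [e|]; [rewrite -e kc in muc | rewrite mulr0].
apply: eq_bigr => k _; rewrite -scalerAr mcoeffZ.
by rewrite -(partition_coef_schur k muN).
Qed.

Lemma expands_in_restrict al be c N N' : (N' <= N)%N -> expands_in N al be c -> expands_in N' al be c.
Proof.
move=> NN' /(congr1 (restrict_vars N')); rewrite restrict_varsM !restrict_vars_schur // => e.
rewrite /expands_in e /restrict_vars raddf_sum /=; apply: eq_bigr => k _.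
by rewrite linearZ /=; congr (_ *: _); exact: restrict_vars_schur.
Qed.

Definition lr_pattern N M (al be mu : nat -> nat) (p : pat N M) : bool :=
  [&& is_gt be p, is_dominant al p & `[< forall i, (al i + weight N (pat_val p) i = mu i)%N >]].

Section Product.
Variables (N M : nat) (al be : intpart).
Hypotheses (beM : (nth 0%N be 0 <= M)%N).

Lemma alternant_schur_mul : (size al <= N)%N -> (size be <= N)%N ->
  alt0 N * (schur al N * schur be N) =
  \sum_(p : pat N M | is_gt (nth 0%N be) p && is_dominant (nth 0%N al) p) twisted (nth 0%N al) p.
Proof.
move=> alN beN; rewrite mulrA alternant_schur // (schur_gt beM) //.
apply: alternant_gt_sum_dominant => // -[|k] // _; exact: nth_part_decr.
Qed.

Lemma twisted_decr (p : pat N M) : is_gt (nth 0%N be) p -> is_dominant (nth 0%N al) p ->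
  (size al <= N)%N -> forall i,
  (nth 0 al i.+1 + weight N (pat_val p) i.+1 <= nth 0 al i + weight N (pat_val p) i)%N.
Proof.
move=> /asboolP pP /asboolP pd alN i; have [iN|Ni] := ltnP i.+1 N.
  exact: (dominant_weight_decr pP pd (k := i.+1)).
by rewrite nth_default ?(leq_trans alN) // pat_val_weight_out.
Qed.

Lemma partition_coef_mul (mu : intpart) : (size mu <= N)%N ->
  partition_coef (schur al N * schur be N) (nth 0%N mu) = #|[set p : pat N M | lr_pattern (nth 0%N al) (nth 0%N be) (nth 0%N mu) p]|%:Z.
Proof.
move=> muN; rewrite /partition_coef.
have [alN|Nal] := leqP (size al) N; last first.
  rewrite schur_eq0 // mul0r mulr0 mcoeff0 (_ : finset _ = finset.set0) ?cards0 //.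
  (* Weights vanish from index [N] on, so a pattern would force [al N = mu N = 0]. *)
  apply/setP => p; rewrite !inE; apply/negP => /and3P[_ _ /asboolP/(_ N)].
  by rewrite (nth_default _ muN) => /eqP; rewrite addn_eq0 -leqn0 leqNgt nth_part_gt0 Nal.
have [beN|Nbe] := leqP (size be) N; last first.
  rewrite (@schur_eq0 be) // !mulr0 mcoeff0 (_ : finset _ = finset.set0) ?cards0 //.
  apply/setP => p; rewrite !inE; apply/negP => /and3P[/asboolP/gt_pattern_top/(_ N) + _ _].
  by rewrite pat_val_out ?leqnn ?orbT // => /esym/eqP; rewrite -leqn0 leqNgt nth_part_gt0 Nbe.
rewrite alternant_schur_mul // raddf_sum /= -[RHS]natz -sumr_const.
rewrite [RHS](eq_bigl (fun p : pat N M => (is_gt (nth 0%N be) p && is_dominant (nth 0%N al) p) &&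
  `[< forall i, (nth 0 al i + weight N (pat_val p) i = nth 0 mu i)%N >])); last first.
  by move=> p; rewrite inE /lr_pattern andbA.
rewrite [RHS]big_mkcondr /=; apply: eq_bigr => p /andP[pP pd].
rewrite alternant_coef => [|i _|i _]; [|exact: twisted_decr|exact: nth_part_decr].
case: asboolP => [h|h]; first by case: forallP => // -[] i; rewrite h.
case: forallP => // h'; case: h => i; have [iN|Ni] := ltnP i N; first exact: (eqP (h' (Ordinal iN))).
by rewrite pat_val_weight_out // !nth_default // (leq_trans _ Ni).
Qed.

End Product.

Lemma sum_weight N (x : nat -> nat -> nat) (v : nat -> nat) : gt_pattern N v x ->
  (\sum_(i < N) weight N x i = \sum_(i < N) v i)%N.
Proof.
move=> xP; transitivity (row_sum N 0 x N - row_sum N 0 x 0)%N.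
  rewrite -(big_mkord xpredT (weight N x)) telescope_sumn_in //.
  by move=> i iN; apply: (row_sum_le xP 0).
rewrite [X in (_ - X)%N]/row_sum big1 ?subn0 => [|i _]; last by rewrite (gt_pattern0 xP).
by apply: eq_bigr => i _; rewrite (gt_pattern_top xP) subn0.
Qed.

Section Expansion.
Variables (al be : intpart) (N : nat).
Hypothesis N0 : (psize al + psize be <= N)%N.
Let M := nth 0%N be 0.
Let good (p : pat N M) := is_gt (nth 0%N be) p && is_dominant (nth 0%N al) p.
Let result (p : pat N M) := part_of N (fun i => nth 0 al i + weight N (pat_val p) i)%N.

Let alN : (size al <= N)%N.
Proof. by apply: leq_trans N0; rewrite (leq_trans (plength_le_psize al)) // leq_addr. Qed.

Let beN : (size be <= N)%N.
Proof. by apply: leq_trans N0; rewrite (leq_trans (plength_le_psize be)) // leq_addl. Qed.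

Lemma result_nth p i : good p -> nth 0%N (result p) i = (nth 0 al i + weight N (pat_val p) i)%N.
Proof.
move=> /andP[pP pd]; rewrite nth_part_of //; first exact: (twisted_decr pP pd alN).
by move=> j Nj; rewrite pat_val_weight_out // nth_default // (leq_trans alN).
Qed.

Lemma size_result_le_vars p : good p -> (size (result p) <= N)%N.
Proof.
move=> pg; apply: size_part_le => i Ni.
by rewrite result_nth // pat_val_weight_out // nth_default // (leq_trans alN).
Qed.

Lemma size_result p : good p -> (size (result p) <= psize al + psize be)%N.
Proof.
move=> pg; apply: leq_trans (plength_le_psize _) _.
rewrite (psize_sum (size_result_le_vars pg)) (psize_sum alN) (psize_sum beN).
case/andP: (pg) => /asboolP pP _; rewrite -(sum_weight pP) -big_split /= leq_eqVlt.
by apply/orP; left; apply/eqP; apply: eq_bigr => i _; rewrite result_nth.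
Qed.

Lemma schur_product_sum : schur al N * schur be N = \sum_(p | good p) schur (result p) N.
Proof.
apply: (mulfI (alt0_neq0 N)); rewrite (alternant_schur_mul (leqnn M)) // mulr_sumr.
apply: eq_bigr => p pg; rewrite alternant_schur; last exact: size_result_le_vars.
by apply: alternant_ext => i iN; rewrite result_nth.
Qed.

(** Equal shapes among the [result p] are grouped, and their multiplicity becomes the coefficient.
    The bound on the number of parts does not involve [N], which is what allows expansions in
    different numbers of variables to be compared. *)
Lemma expands_in_exists : exists2 c, expands_in N al be c &
  forall k, k \in finsupp c -> (size k <= psize al + psize be)%N.
Proof.
pose s := [seq result p | p <- enum good].
pose mult (k : intpart) : int := #|[set p | good p && (result p == k)]|%:Z.
pose c : {fsfun intpart -> int with 0} := [fsfun k in [fset k in s]%fset => mult k | 0].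
have sub : (finsupp c `<=` [fset k in s])%fset by exact: finsupp_sub.
exists c => [|k /(fsubsetP sub)]; last first.
  by rewrite in_fset /= => /mapP[p]; rewrite mem_enum => pg ->; apply: size_result.
rewrite /expands_in schur_product_sum (big_fset_incl _ sub) /=; last first.
  by move=> k _ kc; rewrite fsfun_dflt // scale0r.
have mem p : good p -> result p \in [fset k in s]%fset.
  by move=> pg; rewrite in_fset /=; apply: map_f; rewrite mem_enum.
symmetry; transitivity (\sum_(k <- [fset k in s]%fset) \sum_(p | good p)
    if result p == k then schur k N else 0).
  apply: eq_big_seq => k kA; rewrite fsfunE kA -big_mkcondr /= /mult -natz scaler_nat -sumr_const.
  by apply: eq_bigl => p; rewrite inE.
rewrite exchange_big /=; apply: eq_bigr => p pg; rewrite -big_mkcond /=.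
rewrite -big_filter (eq_filter (a2 := pred1 (result p))); last by move=> k; rewrite /= eq_sym.
by rewrite filter_pred1_uniq ?fset_uniq ?big_seq1 //; apply: mem.
Qed.
End Expansion.

Lemma schur_expansion_exists al be : exists c, schur_expansion al be c.
Proof.
have [c cN cs] := expands_in_exists (leqnn (psize al + psize be)).
exists c => N; have [NN0|N0N] := leqP N (psize al + psize be).
  exact: expands_in_restrict NN0 cN.
have [c' c'N c's] := expands_in_exists (ltnW N0N).
suff -> : c = c' by [].
have c'N0 := expands_in_restrict (ltnW N0N) c'N.
apply/fsfunP => k; have [kN|Nk] := leqP (size k) (psize al + psize be).
  by rewrite (expands_in_coef cN kN) (expands_in_coef c'N0 kN).
by rewrite !fsfun_dflt //; apply/negP; [move/c's|move/cs]; rewrite leqNgt Nk.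
Qed.

(** [N] and [M] are free within the bounds, so that the three factors of a Newell-Littlewood term
    can be counted in one finite type. *)
Lemma LR_coef_card N M (al be mu : intpart) : (nth 0%N be 0 <= M)%N -> (size mu <= N)%N ->
  LR_coef al be mu = #|[set p : pat N M | lr_pattern (nth 0%N al) (nth 0%N be) (nth 0%N mu) p]|%:Z.
Proof.
move=> beM muN; rewrite /LR_coef; set c := xget _ _.
have cP : schur_expansion al be c by apply: xgetPex; apply: schur_expansion_exists.
by rewrite (expands_in_coef (cP N) muN) (partition_coef_mul al beM muN).
Qed.

Lemma LR_coefC al be mu : LR_coef al be mu = LR_coef be al mu.
Proof.
rewrite /LR_coef (_ : schur_expansion al be = schur_expansion be al) //.
by apply/seteqP; split=> c h N; rewrite mulrC h.
Qed.

(** * Hives and the K-polytope *)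

(* The rhombus inequalities R, U, L of the triangle 0 <= i <= k <= n. *)
Definition hive_rhombi (R : numDomainType) (n : nat) (b : nat -> nat -> R) : Prop :=
  forall i k : nat, (i <= k)%N -> (k.+2 <= n)%N ->
  [/\ 0 <= b i k.+1 + b i.+1 k.+1 - b i.+1 k.+2 - b i k,
      0 <= b i k.+1 + b i.+1 k.+2 - b i k.+2 - b i.+1 k.+1
    & 0 <= b i.+1 k.+1 + b i.+1 k.+2 - b i k.+1 - b i.+2 k.+2].

(** By the rhombus inequality L, the increment at [(i, k)] is at least the one at [(i.+1, k.+1)], so
    nonnegativity spreads from the side [k = n] to every row. *)
Lemma hive_row_mono (R : realDomainType) n (b : nat -> nat -> R) : hive_rhombi n b ->
  (forall i, (i < n)%N -> b i n <= b i.+1 n) -> forall i k, (i < k <= n)%N -> b i k <= b i.+1 k.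
Proof.
move=> bP top i k /andP[ik kn]; rewrite -(subKn kn).
have : (i + (n - k) < n)%N by lia.
move: (n - k)%N => d; move: i {ik}; elim: d => [|d IH] i id.
  by rewrite subn0 top //; lia.
have := IH i.+1 ltac:(lia).
have [_ _] := bP i (n - d.+2)%N ltac:(lia) ltac:(lia).
have -> : (n - d.+2).+2 = (n - d)%N by lia.
have -> : (n - d.+2).+1 = (n - d.+1)%N by lia.
by lra.
Qed.

(** Increments in [i] are entries of the pattern, and the side [i = 0] carries [al]. Under this
    dictionary R is [row_dominant_at], while U and L are the two interlacing inequalities. *)
Definition hive_of (al : nat -> nat) (x : nat -> nat -> nat) (i k : nat) : nat :=
  (\sum_(0 <= j < k) al j + row_prefix x k i)%N.

Section Hives.
Variables (n : nat) (al be mu : nat -> nat).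

Lemma hive_ofSr x i k : (hive_of al x i k.+1 + row_prefix x k i = hive_of al x i k + al k + row_prefix x k.+1 i)%N.
Proof. by rewrite /hive_of big_nat_recr //=; lia. Qed.

Lemma hive_ofSl x i k : hive_of al x i.+1 k = (hive_of al x i k + x k i)%N.
Proof. by rewrite /hive_of row_prefixS addnA. Qed.

Lemma hive_of0 x k : hive_of al x 0 k = (\sum_(0 <= j < k) al j)%N.
Proof. by rewrite /hive_of /row_prefix [X in (_ + X)%N]big_geq ?addn0. Qed.

Lemma row_sum_prefix x k : gt_pattern n be x -> (k <= n)%N -> row_sum n 0 x k = row_prefix x k k.
Proof.
move=> xP kn; rewrite /row_sum /row_prefix -(big_mkord xpredT (fun i => x k i - 0)%N).
rewrite (@big_cat_nat _ _ _ k) //= [X in (_ + X)%N]big_nat [X in (_ + X)%N]big1 ?addn0.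
  by apply: eq_bigr => i _; rewrite subn0.
by move=> i /andP[ki _]; rewrite (gt_pattern0 xP).
Qed.

Section FromPattern.
Variables (M : nat) (p : pat n M).
Hypothesis pP : lr_pattern al be mu p.
Let x := pat_val p.
Let g i k : int := (hive_of al x i k)%:Z.

Lemma lr_pattern_gt : gt_pattern n be x.
Proof. by case/and3P: pP => /asboolP. Qed.

Lemma lr_pattern_hive_rhombi : hive_rhombi n g.
Proof.
have xP := lr_pattern_gt; case/and3P: pP => _ /asboolP pd _.
move=> i k ik kn; rewrite /g; split.
- have := (row_dominantP al xP (k := k.+1) kn).1 (fun J => pd k.+1 J kn) i ik.
  rewrite /row_dominant_at /=.
  have := hive_ofSr x i k; have := hive_ofSr x i.+1 k.+1; rewrite !row_prefixS.
  by have := hive_ofSl x i k.+1; lia.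
- rewrite !hive_ofSl; have := @gt_pattern_le _ _ _ xP k.+1 i kn.
  by rewrite -/x; lia.
- rewrite !hive_ofSl; have := @gt_pattern_ge _ _ _ xP k.+1 i kn.
  by rewrite -/x; lia.
Qed.

(** Row [k] has at most [k] nonzero entries, so diagonal labels contain full row sums and increase
    by [al i + weight i]. *)
Lemma lr_pattern_diag i : (i < n)%N -> hive_of al x i.+1 i.+1 = (hive_of al x i i + mu i)%N.
Proof.
move=> iN; have xP := lr_pattern_gt; case/and3P: pP => _ _ /asboolP/(_ i) <-.
rewrite /weight !row_sum_prefix //; last exact: ltnW.
have := row_sum_le xP 0 iN; rewrite !row_sum_prefix //; last exact: ltnW.
by have := hive_ofSr x i.+1 i; have := hive_ofSl x i i; rewrite -/x !row_prefixS; lia.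
Qed.

Lemma lr_pattern_top i : hive_of al x i.+1 n = (hive_of al x i n + be i)%N.
Proof. by rewrite hive_ofSl (gt_pattern_top lr_pattern_gt). Qed.

End FromPattern.

Section ToPattern.
Variables (M : nat) (g : nat -> nat -> int).
Hypotheses (beM : (be 0 <= M)%N) (gP : hive_rhombi n g).
Hypotheses (al0 : forall i, (n <= i)%N -> al i = 0%N) (be0 : forall i, (n <= i)%N -> be i = 0%N)
  (mu0 : forall i, (n <= i)%N -> mu i = 0%N).
Hypotheses (g00 : g 0%N 0%N = 0).
Hypothesis gal : forall j, (j < n)%N -> g 0%N j.+1 - g 0%N j = (al j)%:Z.
Hypothesis gbe : forall i, (i < n)%N -> g i.+1 n - g i n = (be i)%:Z.
Hypothesis gmu : forall i, (i < n)%N -> g i.+1 i.+1 - g i i = (mu i)%:Z.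

(** The absolute value only converts to [nat]: these differences are nonnegative by
    [hive_row_mono]. *)
Let x k i := if (i < k <= n)%N then `|g i.+1 k - g i k|%N else 0%N.

Lemma hive_row_ge0 i k : (i < k <= n)%N -> 0 <= g i.+1 k - g i k.
Proof.
move=> ik; rewrite subr_ge0; apply: hive_row_mono gP _ _ _ ik => j jn.
by rewrite -subr_ge0 gbe.
Qed.

Lemma xE k i : (i < k <= n)%N -> (x k i)%:Z = g i.+1 k - g i k.
Proof. by move=> h; rewrite /x h gez0_abs // hive_row_ge0. Qed.

Lemma x_gt_pattern : gt_pattern n be x.
Proof.
split=> [k i ki|k i kn|i].
- by rewrite /x ltnNge ki.
- have [ik|ki] := ltnP i k; last by rewrite /x ltnS !(ltnNge i k) ki /=.
  case: k ik kn => // k ik kn; have [_ h1 h2] := gP (ik : (i <= k)%N) kn.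
  have e1 : (x k.+1 i)%:Z = g i.+1 k.+1 - g i k.+1 by apply: xE; lia.
  have e2 : (x k.+2 i)%:Z = g i.+1 k.+2 - g i k.+2 by apply: xE; lia.
  have e3 : (x k.+2 i.+1)%:Z = g i.+2 k.+2 - g i.+1 k.+2 by apply: xE; lia.
  by move: e1 e2 e3; move: (x _ _) (x _ _) (x _ _); lia.
- have [iN|Ni] := ltnP i n; last by rewrite /x (ltnNge i) Ni be0.
  by apply/eqP; rewrite -eqz_nat xE ?iN ?leqnn // gbe.
Qed.

Lemma hive_of_x i k : (i <= k)%N -> (k <= n)%N -> (hive_of al x i k)%:Z = g i k.
Proof.
move=> ik kn; elim: i ik => [_|i IH ik].
  rewrite hive_of0; elim: k kn => [|k IH] kn; first by rewrite big_geq // g00.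
  by rewrite big_nat_recr //= PoszD IH ?(ltnW kn) // -gal //; lia.
by rewrite hive_ofSl PoszD IH ?(ltnW ik) // xE ?ik //; lia.
Qed.

Lemma hive_to_pattern : exists2 p : pat n M, lr_pattern al be mu p &
  forall i k, (i <= k)%N -> (k <= n)%N -> (hive_of al (pat_val p) i k)%:Z = g i k.
Proof.
have xP := x_gt_pattern; pose p := mk_pat n M x.
have pE k i : (k <= n)%N -> pat_val p k i = x k i by exact: mk_patK xP beM.
have rpE k i : (k <= n)%N -> row_prefix (pat_val p) k i = row_prefix x k i.
  by move=> kn; apply: eq_bigr => j _; rewrite pE.
have pP : gt_pattern n be (pat_val p).
  apply: gt_pattern_ext xP _ => [k i kn|k i nk]; first by rewrite pE.
  by rewrite pat_val_out // nk.
exists p; last by move=> i k ik kn; rewrite -hive_of_x // /hive_of rpE.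
apply/and3P; split; apply/asboolP => //.
- move=> k J kn; apply: ((row_dominantP al pP kn).2 _ J) => i ik.
  case: k kn ik => // k kn ik; have [h _ _] := gP (ik : (i <= k)%N) kn.
  rewrite /row_dominant_at /= !rpE ?(ltnW kn) //; last by lia.
  have := hive_ofSr x i k; have := hive_ofSr x i.+1 k.+1.
  have := @hive_of_x i k; have := @hive_of_x i k.+1; have := @hive_of_x i.+1 k.+1; have := @hive_of_x i.+1 k.+2.
  by rewrite !row_prefixS; lia.
- move=> i; have [iN|Ni] := ltnP i n; last by rewrite pat_val_weight_out // al0 // mu0.
  have := row_sum_le pP 0 iN; rewrite /weight !(row_sum_prefix pP) // ?(ltnW iN) // !rpE ?(ltnW iN) //.
  have := hive_ofSr x i.+1 i; have := hive_ofSl x i i.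
  have := @hive_of_x i i (leqnn _) (ltnW iN); have := @hive_of_x i.+1 i.+1 (leqnn _) iN.
  by have := gmu iN; rewrite !row_prefixS; lia.
Qed.

End ToPattern.

End Hives.

Lemma hive_of_inj n M (al al' be be' : nat -> nat) (p q : pat n M) :
  gt_pattern n be (pat_val p) -> gt_pattern n be' (pat_val q) ->
  (forall i k, (i <= k)%N -> (k <= n)%N -> hive_of al (pat_val p) i k = hive_of al' (pat_val q) i k) ->
  p = q.
Proof.
move=> pP qP e; apply: pat_eq => k i kn; have [ik|ki] := ltnP i k; last first.
  by rewrite (gt_pattern0 pP) // (gt_pattern0 qP).
have := e i.+1 k ik kn; rewrite !hive_ofSl e //; last exact: ltnW.
by move/addnI.
Qed.

Lemma hive_rhombi_sub (R : numDomainType) n (b : nat -> nat -> R) c :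
  hive_rhombi n b -> hive_rhombi n (fun i j => b i j - c).
Proof.
move=> h i k ik kn; have [r u l] := h i k ik kn.
by split; [apply: le_trans r _|apply: le_trans u _|apply: le_trans l _];
  rewrite -subr_ge0 le_eqVlt; apply/orP; left; apply/eqP; ring.
Qed.

Lemma hive_rhombi_ext (R : numDomainType) n (b b' : nat -> nat -> R) :
  (forall i k, (i <= k)%N -> (k <= n)%N -> b i k = b' i k) -> hive_rhombi n b -> hive_rhombi n b'.
Proof.
move=> e h i k ik kn; have [r u l] := h i k ik kn; rewrite !e in r u l; try lia.
by split.
Qed.

Lemma hive_rhombi_intr (R : numDomainType) n (b : nat -> nat -> R) (g : nat -> nat -> int) :
  (forall i k, (i <= k)%N -> (k <= n)%N -> b i k = (g i k)%:~R) -> hive_rhombi n b <-> hive_rhombi n g.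
Proof.
move=> e; split=> h i k ik kn; have [r u l] := h i k ik kn.
  rewrite !e -?rmorphD -?rmorphB ?ler0z in r u l; try lia.
  by split.
by rewrite !e -?rmorphD -?rmorphB ?ler0z //; lia.
Qed.

(** * Labellings of the trapezoid and its three triangles *)

Section Labels.
Variables (R : realType) (n : nat).
Implicit Types (a : labelling R n) (f : nat -> nat -> R).

Definition in_trapezoid (i j : nat) : bool := (i <= j <= minn (i + n) (2 * n))%N.

Lemma vertex_exists i j : in_trapezoid i j -> exists v : vertex n, ((val v).1 = i :> nat) /\ ((val v).2 = j :> nat).
Proof.
move=> ij; have iN : (i < (2 * n).+1)%N by rewrite /in_trapezoid in ij; lia.
have jN : (j < (2 * n).+1)%N by rewrite /in_trapezoid in ij; lia.
by exists (Sub (Ordinal iN, Ordinal jN) ij).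
Qed.

Lemma vertexP (v : vertex n) : in_trapezoid (val v).1 (val v).2.
Proof. exact: (valP v). Qed.

Lemma lab_vertex a (v : vertex n) : lab a (val v).1%:Z (val v).2%:Z = a v.
Proof.
rewrite /lab; case: pickP => [w /andP[/eqP[e1] /eqP[e2]]|/(_ v)]; last by rewrite !eqxx.
by congr (a _); apply: val_inj; apply/eqP; rewrite -pair_eqE /= -!val_eqE /= e1 e2 !eqxx.
Qed.

Lemma lab_eq a b : (forall i j : nat, in_trapezoid i j -> lab a i j = lab b i j) -> a = b.
Proof. by move=> e; apply/ffunP => v; rewrite -!lab_vertex e ?vertexP. Qed.

Definition mk_lab f : labelling R n := [ffun v : vertex n => f (val v).1 (val v).2].

Lemma lab_mk_lab f (i j : nat) : in_trapezoid i j -> lab (mk_lab f) i j = f i j.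
Proof. by move=> /vertex_exists[v [<- <-]]; rewrite lab_vertex ffunE. Qed.

Lemma lab_int a : (forall v, a v \is a Num.int) -> forall i j, lab a i j \is a Num.int.
Proof. by move=> aint i j; rewrite /lab; case: pickP => // _ _; exact: int_num0. Qed.

(** The indices are shifted so that the four vertices have natural coordinates, as in
    [hive_rhombi]. *)
Lemma rhombus_RE a (i j : nat) : rhombus_R a i.+1%:Z j.+2%:Z =
  lab a i j.+1 + lab a i.+1 j.+1 - lab a i.+1 j.+2 - lab a i j.
Proof. by rewrite /rhombus_R; do ![congr (_ + _); try congr (- _)]; congr (lab a _ _); lia. Qed.

Lemma rhombus_UE a (i j : nat) : rhombus_U a i.+1%:Z j.+1%:Z =
  lab a i j + lab a i.+1 j.+1 - lab a i j.+1 - lab a i.+1 j.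
Proof. by rewrite /rhombus_U; do ![congr (_ + _); try congr (- _)]; congr (lab a _ _); lia. Qed.

Lemma rhombus_LE a (i j : nat) : rhombus_L a i.+1%:Z j.+1%:Z =
  lab a i.+1 j + lab a i.+1 j.+1 - lab a i j - lab a i.+2 j.+1.
Proof. by rewrite /rhombus_L; do ![congr (_ + _); try congr (- _)]; congr (lab a _ _); lia. Qed.

Lemma nat_shift (i : int) (c : nat) : c%:Z <= i -> exists i' : nat, i = (i' + c)%N%:Z.
Proof. by move=> h; exists `|i - c%:Z|%N; lia. Qed.

Lemma rhombus_ineqs_mu a : rhombus_ineqs (tri_mu n) a <-> hive_rhombi n (fun i j => lab a i j).
Proof.
split=> [h i k ik kn|h i j].
  have [r u l] := h i.+1%:Z k.+2%:Z; rewrite rhombus_RE rhombus_UE rhombus_LE in r u l.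
  by split; [apply: r|apply: u|apply: l]; rewrite /tri_mu /=; lia.
split; rewrite /tri_mu /= => D.
- have [i' ei] := @nat_shift i 1 ltac:(lia); have [j' ej] := @nat_shift j 2 ltac:(lia).
  move: D; rewrite ei ej addn1 addn2 rhombus_RE => D.
  by have [] := h i' j' ltac:(lia) ltac:(lia); lra.
- have [i' ei] := @nat_shift i 1 ltac:(lia); have [j' ej] := @nat_shift j 2 ltac:(lia).
  move: D; rewrite ei ej addn1 addn2 rhombus_UE => D.
  by have [] := h i' j' ltac:(lia) ltac:(lia); lra.
- have [i' ei] := @nat_shift i 1 ltac:(lia); have [j' ej] := @nat_shift j 2 ltac:(lia).
  move: D; rewrite ei ej addn1 addn2 rhombus_LE => D.
  by have [] := h i' j' ltac:(lia) ltac:(lia); lra.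
Qed.

Lemma rhombus_ineqs_nu a : rhombus_ineqs (tri_nu n) a <->
  hive_rhombi n (fun i j => lab a (n + i)%N (n + j)%N).
Proof.
split=> [h i k ik kn|h i j].
  have [r u l] := h (n + i).+1%:Z (n + k).+2%:Z; rewrite rhombus_RE rhombus_UE rhombus_LE -!addnS in r u l.
  by split; [apply: r|apply: u|apply: l]; rewrite /tri_nu /=; lia.
split; rewrite /tri_nu /= => D.
- have [i' ei] := @nat_shift i n.+1 ltac:(lia); have [j' ej] := @nat_shift j n.+2 ltac:(lia).
  move: D; rewrite ei ej !addnS rhombus_RE ![(_ + n)%N]addnC -!addnS => D.
  by have [] := h i' j' ltac:(lia) ltac:(lia); lra.
- have [i' ei] := @nat_shift i n.+1 ltac:(lia); have [j' ej] := @nat_shift j n.+2 ltac:(lia).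
  move: D; rewrite ei ej !addnS rhombus_UE ![(_ + n)%N]addnC -!addnS => D.
  by have [] := h i' j' ltac:(lia) ltac:(lia); lra.
- have [i' ei] := @nat_shift i n.+1 ltac:(lia); have [j' ej] := @nat_shift j n.+2 ltac:(lia).
  move: D; rewrite ei ej !addnS rhombus_LE ![(_ + n)%N]addnC -!addnS => D.
  by have [] := h i' j' ltac:(lia) ltac:(lia); lra.
Qed.

(* The reflection of the third triangle exchanges R and L. *)
Lemma rhombus_ineqs_la a : rhombus_ineqs (tri_la n) a <->
  hive_rhombi n (fun i j => lab a j (n + i)%N).
Proof.
split=> [h i k ik kn|h i j].
  split.
  - have [_ _ l] := h k.+1%:Z (n + i).+1%:Z; move: l; rewrite rhombus_LE -!addnS => l.
    by have := l ltac:(rewrite /tri_la /=; lia); lra.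
  - have [_ u _] := h k.+2%:Z (n + i).+1%:Z; move: u; rewrite rhombus_UE -!addnS => u.
    by have := u ltac:(rewrite /tri_la /=; lia); lra.
  - have [r _ _] := h k.+2%:Z (n + i).+2%:Z; move: r; rewrite rhombus_RE -!addnS => r.
    by have := r ltac:(rewrite /tri_la /=; lia); lra.
split; rewrite /tri_la /= => D.
- have [i' ei] := @nat_shift i 2 ltac:(lia); have [j' ej] := @nat_shift j n.+2 ltac:(lia).
  move: D; rewrite ei ej !addnS addn0 rhombus_RE ![(_ + n)%N]addnC -!addnS => D.
  by have [] := h j' i' ltac:(lia) ltac:(lia); lra.
- have [i' ei] := @nat_shift i 2 ltac:(lia); have [j' ej] := @nat_shift j n.+1 ltac:(lia).
  move: D; rewrite ei ej !addnS addn0 rhombus_UE ![(_ + n)%N]addnC -!addnS => D.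
  by have [] := h j' i' ltac:(lia) ltac:(lia); lra.
- have [i' ei] := @nat_shift i 1 ltac:(lia); have [j' ej] := @nat_shift j n.+1 ltac:(lia).
  move: D; rewrite ei ej !addnS addn0 rhombus_LE ![(_ + n)%N]addnC -!addnS => D.
  by have [] := h j' i' ltac:(lia) ltac:(lia); lra.
Qed.

End Labels.

Definition integer_K_point (n : nat) (mu nu la : intpart) (G : nat -> nat -> int) : Prop :=
  [/\ [/\ G 0%N 0%N = 0, 2 * G 0%N n = (psize mu)%:Z + (psize nu)%:Z - (psize la)%:Z &
        forall j, (j <= n)%N -> G (n + j)%N (n + n)%N - G n (n + n)%N = G 0%N j],
      forall i, (i < n)%N -> [/\ G i.+1 i.+1 - G i i = (nth 0%N mu i)%:Z,
        G (n + i.+1)%N (n + i.+1)%N - G (n + i)%N (n + i)%N = (nth 0%N nu i)%:Z &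
        G i.+1 (n + i.+1)%N - G i (n + i)%N = (nth 0%N la i)%:Z],
      [/\ hive_rhombi n G, hive_rhombi n (fun i j => G (n + i)%N (n + j)%N) &
          hive_rhombi n (fun i j => G j (n + i)%N)] &
      forall i, (i < n)%N -> [/\ 0 <= G 0%N i.+1 - G 0%N i, 0 <= G i.+1 n - G i n &
        0 <= G n (n + i.+1)%N - G n (n + i)%N]].

Lemma telescope_int (g : nat -> int) (v : nat -> nat) n :
  (forall i, (i < n)%N -> g i.+1 - g i = (v i)%:Z) -> g n - g 0%N = (\sum_(i < n) v i)%N%:Z.
Proof.
elim: n => [|n IH] h; first by rewrite big_ord0 subrr.
rewrite big_ord_recr PoszD /= -IH => [|i iN]; last by apply: h; rewrite ltnW.
by rewrite -(h n) //; lia.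
Qed.

Section Conversion.
Variables (R : realType) (n : nat) (mu nu la : intpart).
Hypotheses (muN : (size mu <= n)%N) (nuN : (size nu <= n)%N) (laN : (size la <= n)%N).
Variables (a : labelling R n) (G : nat -> nat -> int).
Hypothesis aG : forall i j : nat, lab a i j = (G i j)%:~R.

Let diff (i j k l : nat) (i' j' k' l' : int) :
  i' = i%:Z -> j' = j%:Z -> k' = k%:Z -> l' = l%:Z ->
  lab a i' j' - lab a k' l' = (G i j - G k l)%:~R.
Proof. by move=> -> -> -> ->; rewrite rmorphB /= !aG. Qed.

Lemma K_polytope_integer : K_polytope mu nu la a <-> integer_K_point n mu nu la G.
Proof.
have rh b g : (forall i j, b i j = (g i j)%:~R :> R) -> hive_rhombi n b <-> hive_rhombi n g.
  by move=> e; apply: hive_rhombi_intr.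
have rmu := rhombus_ineqs_mu a; have rnu := rhombus_ineqs_nu a; have rla := rhombus_ineqs_la a.
rewrite (@rh _ G) in rmu; last by move=> i j; rewrite aG.
rewrite (@rh _ (fun i j => G (n + i)%N (n + j)%N)) in rnu; last by move=> i j; rewrite aG.
rewrite (@rh _ (fun i j => G j (n + i)%N)) in rla; last by move=> i j; rewrite aG.
split.
  case=> o sz gl kmu knu kla r1 r2 r3 c1 c2 c3.
  have o' : G 0%N 0%N = 0 by apply/eqP; rewrite -(intr_eq0 R) -aG o.
  have sz' : 2 * G 0%N n = (psize mu)%:Z + (psize nu)%:Z - (psize la)%:Z.
    apply: (@intr_inj R); move: sz; rewrite o aG !(rmorphM, rmorphB, rmorphD) /= subr0 => ->.
    by rewrite !pmulrn; lra.
  have diag i : (i < n)%N -> [/\ G i.+1 i.+1 - G i i = (nth 0%N mu i)%:Z,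
        G (n + i.+1)%N (n + i.+1)%N - G (n + i)%N (n + i)%N = (nth 0%N nu i)%:Z &
        G i.+1 (n + i.+1)%N - G i (n + i)%N = (nth 0%N la i)%:Z].
    move=> iN; split; apply: (@intr_inj R).
    - have := kmu i.+1 iN; rewrite (@diff i.+1 i.+1 i i) ?pmulrn /part //; lia.
    - have := knu i.+1 iN; rewrite (@diff (n + i.+1) (n + i.+1) (n + i) (n + i)) ?pmulrn /part //; lia.
    - have := kla i.+1 iN; rewrite (@diff i.+1 (n + i.+1) i (n + i)) ?pmulrn /part //; lia.
  split=> //; last first.
  - move=> i iN; split; rewrite -(ler0z R).
    + have := c1 i.+1 iN; rewrite (@diff 0 i.+1 0 i) //; lia.
    + have := c2 i.+1 iN; rewrite (@diff i.+1 n i n) //; lia.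
    + have := c3 i.+1 iN; rewrite (@diff n (n + i.+1) n (n + i)) //; lia.
  - by split; [apply/rmu|apply/rnu|apply/rla].
  split=> // j jn; case: (posnP j) => [->|j0]; first by rewrite addn0 subrr o'.
  move: jn; rewrite leq_eqVlt => /orP[/eqP ->|jn].
    (* At the end [j = n] gluing follows from the sizes: the three outer sides give |mu| + |nu| -
       |la| - [G 0 n] for the left-hand side, and |mu| + |nu| - |la| is twice [G 0 n]. *)
    have : G n n - G 0%N 0%N = (\sum_(i < n) nth 0%N mu i)%N%:Z.
      by apply: (telescope_int (g := fun i => G i i)) => i /diag[].
    have : G (n + n)%N (n + n)%N - G (n + 0)%N (n + 0)%N = (\sum_(i < n) nth 0%N nu i)%N%:Z.
      by apply: (telescope_int (g := fun i => G (n + i)%N (n + i)%N)) => i /diag[].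
    have : G n (n + n)%N - G 0%N (n + 0)%N = (\sum_(i < n) nth 0%N la i)%N%:Z.
      by apply: (telescope_int (g := fun i => G i (n + i)%N)) => i /diag[].
    by rewrite -!psize_sum // o' !addn0; lia.
  have := gl j ltac:(lia); rewrite (@diff (n + j) (n + n) n (n + n)); [|lia..].
  by rewrite (@diff 0 j 0 0) // o' subr0 => /intr_inj.
move=> [[o sz gl] diag [/rmu r1 /rnu r2 /rla r3] nn]; split=> //.
- by rewrite aG o.
- rewrite !aG o subr0; have /(congr1 (fun z => z%:~R : R)) := sz.
  by rewrite !(rmorphM, rmorphB, rmorphD) /= !pmulrn; lra.
- move=> j jn; have := gl j ltac:(lia) => /(congr1 (fun z => z%:~R : R)).
  by rewrite (@diff (n + j) (n + n) n (n + n)) ?(@diff 0 j 0 0) ?o ?subr0 //; lia.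
- move=> [|i] // iN; have [/(congr1 (fun z => z%:~R : R)) + _ _] := diag i iN.
  by rewrite (@diff i.+1 i.+1 i i) /part ?pmulrn //; lia.
- move=> [|i] // iN; have [_ /(congr1 (fun z => z%:~R : R)) + _] := diag i iN.
  by rewrite (@diff (n + i.+1) (n + i.+1) (n + i) (n + i)) /part ?pmulrn //; lia.
- move=> [|i] // iN; have [_ _ /(congr1 (fun z => z%:~R : R)) +] := diag i iN.
  by rewrite (@diff i.+1 (n + i.+1) i (n + i)) /part ?pmulrn //; lia.
- move=> [|i] // iN; have [+ _ _] := nn i iN; rewrite -(ler0z R).
  by rewrite (@diff 0 i.+1 0 i) //; lia.
- move=> [|i] // iN; have [_ + _] := nn i iN; rewrite -(ler0z R).
  by rewrite (@diff i.+1 n i n) //; lia.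
- move=> [|i] // iN; have [_ _ +] := nn i iN; rewrite -(ler0z R).
  by rewrite (@diff n (n + i.+1) n (n + i)) //; lia.
Qed.

End Conversion.

(** * Three hives glued along their sides *)

Section Triples.
Variables (n M : nat) (mu nu la : intpart).
Implicit Types q : pat n M * pat n M * pat n M.

(* The top rows of the three patterns are beta, alpha and gamma. *)
Definition top_row (p : pat n M) : nat -> nat := pat_val p n.

(** Shared sides agree because the top row of one pattern is the left side of another. In the
    triangle of [nu] the left side is gamma, shared with the third triangle, and alpha is the top
    row, on the side glued to that of the first triangle. *)
Definition nl_triple q : bool :=
  let: (p1, p2, p3) := q in
  [&& lr_pattern (top_row p2) (top_row p1) (nth 0%N mu) p1,
      lr_pattern (top_row p3) (top_row p2) (nth 0%N nu) p2
    & lr_pattern (top_row p1) (top_row p3) (nth 0%N la) p3].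

(** Each [hive_of] starts at 0, so the second and third hives are raised by the label of the first
    one at their common corner, [(n, n)] and [(0, n)] respectively. The third hive is read in
    reflected coordinates. *)
Definition triple_label q (i j : nat) : nat :=
  let: (p1, p2, p3) := q in
  if (j <= n)%N then hive_of (top_row p2) (pat_val p1) i j
  else if (n <= i)%N then
    (hive_of (top_row p2) (pat_val p1) n n + hive_of (top_row p3) (pat_val p2) (i - n) (j - n))%N
  else (hive_of (top_row p2) (pat_val p1) 0 n + hive_of (top_row p1) (pat_val p3) (j - n) i)%N.

Lemma hive_of_top al x k : hive_of al x k n = (\sum_(0 <= j < n) al j + \sum_(0 <= j < k) x n j)%N.
Proof. by []. Qed.

Section Faces.
Variables (p1 p2 p3 : pat n M).
Let q := (p1, p2, p3).

Lemma triple_label_mu i j : (i <= j <= n)%N ->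
  triple_label q i j = hive_of (top_row p2) (pat_val p1) i j.
Proof. by move=> /andP[_ jn]; rewrite /= jn. Qed.

Lemma triple_label_nu i j : (i <= j <= n)%N -> triple_label q (n + i) (n + j) =
  (hive_of (top_row p2) (pat_val p1) n n + hive_of (top_row p3) (pat_val p2) i j)%N.
Proof.
move=> /andP[ij jn] /=; rewrite leq_addr !addKn; case: ifP => // h.
have -> : j = 0%N by lia.
have -> : i = 0%N by lia.
by rewrite !addn0 hive_of0 big_geq ?addn0.
Qed.

Lemma triple_label_la i j : (i <= j <= n)%N -> triple_label q j (n + i) =
  (hive_of (top_row p2) (pat_val p1) 0 n + hive_of (top_row p1) (pat_val p3) i j)%N.
Proof.
move=> /andP[ij jn] /=; rewrite addKn; case: ifP => h.
  have -> : i = 0%N by lia.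
  by rewrite addn0 hive_of_top !hive_of0.
case: ifP => h'; last by [].
have -> : j = n by lia.
by rewrite subnn !hive_of0 !hive_of_top /top_row; lia.
Qed.

End Faces.

Lemma triple_label_integer q G : nl_triple q -> (size mu <= n)%N -> (size nu <= n)%N -> (size la <= n)%N ->
  (forall i j, in_trapezoid n i j -> G i j = (triple_label q i j)%:Z) ->
  integer_K_point n mu nu la G.
Proof.
case: q => -[p1 p2] p3 /and3P[h1 h2 h3] muN nuN laN e.
have emu i j : (i <= j)%N -> (j <= n)%N -> G i j = (hive_of (top_row p2) (pat_val p1) i j)%:Z.
  by move=> ij jn; rewrite e ?triple_label_mu ?ij // /in_trapezoid; lia.
have enu i j : (i <= j)%N -> (j <= n)%N -> G (n + i)%N (n + j)%N =
    (hive_of (top_row p2) (pat_val p1) n n + hive_of (top_row p3) (pat_val p2) i j)%N%:Z.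
  by move=> ij jn; rewrite e ?triple_label_nu ?ij // /in_trapezoid; lia.
have ela i j : (i <= j)%N -> (j <= n)%N -> G j (n + i)%N =
    (hive_of (top_row p2) (pat_val p1) 0 n + hive_of (top_row p1) (pat_val p3) i j)%N%:Z.
  by move=> ij jn; rewrite e ?triple_label_la ?ij // /in_trapezoid; lia.
have top k : (\sum_(0 <= j < k.+1) top_row p1 j = \sum_(0 <= j < k) top_row p1 j + top_row p1 k)%N.
  by rewrite big_nat_recr.
have d1 i : (i < n)%N -> G i.+1 i.+1 - G i i = (nth 0%N mu i)%:Z.
  by move=> iN; rewrite !emu // ?(ltnW iN) // (lr_pattern_diag h1) //; lia.
have d2 i : (i < n)%N -> G (n + i.+1)%N (n + i.+1)%N - G (n + i)%N (n + i)%N = (nth 0%N nu i)%:Z.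
  by move=> iN; rewrite !enu // ?(ltnW iN) // (lr_pattern_diag h2) //; lia.
have d3 i : (i < n)%N -> G i.+1 (n + i.+1)%N - G i (n + i)%N = (nth 0%N la i)%:Z.
  by move=> iN; rewrite !ela // ?(ltnW iN) // (lr_pattern_diag h3) //; lia.
have o : G 0%N 0%N = 0 by rewrite emu // hive_of0 big_geq.
have smu : G n n - G 0%N 0%N = (psize mu)%:Z.
  by rewrite (psize_sum muN); apply: (telescope_int (g := fun i => G i i)) => i /d1.
have snu : G (n + n)%N (n + n)%N - G (n + 0)%N (n + 0)%N = (psize nu)%:Z.
  by rewrite (psize_sum nuN); apply: (telescope_int (g := fun i => G (n + i)%N (n + i)%N)) => i /d2.
have sla : G n (n + n)%N - G 0%N (n + 0)%N = (psize la)%:Z.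
  by rewrite (psize_sum laN); apply: (telescope_int (g := fun i => G i (n + i)%N)) => i /d3.
split.
- split=> //.
    have := emu 0%N n (leq0n _) (leqnn _); have := emu n n (leqnn _) (leqnn _).
    have := enu n n (leqnn _) (leqnn _); have := ela n n (leqnn _) (leqnn _).
    move: smu snu sla; rewrite o !addn0 !hive_of_top ?hive_of0 ?(@big_geq _ _ _ 0 0) // /top_row; lia.
  move=> j jn; have := enu j n jn (leqnn _); have := enu 0%N n (leq0n _) (leqnn _).
  have := emu 0%N j (leq0n _) jn.
  by rewrite !addn0 !hive_of_top ?hive_of0 ?(@big_geq _ _ _ 0 0) // /top_row; lia.
- by move=> i iN; split; [apply: d1|apply: d2|apply: d3].
- split.
  + apply: (hive_rhombi_ext _ (lr_pattern_hive_rhombi h1)) => i j ij jn.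
    by rewrite emu.
  + have := hive_rhombi_sub (- (hive_of (top_row p2) (pat_val p1) n n)%:Z) (lr_pattern_hive_rhombi h2).
    by apply: hive_rhombi_ext => i j ij jn; rewrite enu //; lia.
  + have := hive_rhombi_sub (- (hive_of (top_row p2) (pat_val p1) 0 n)%:Z) (lr_pattern_hive_rhombi h3).
    by apply: hive_rhombi_ext => i j ij jn; rewrite ela //; lia.
- move=> i iN; split.
  + by rewrite !emu // ?(ltnW iN) // !hive_of0 big_nat_recr //=; lia.
  + by rewrite !emu // ?(ltnW iN) // (lr_pattern_top h1); lia.
  + by rewrite !ela // ?(ltnW iN) // (lr_pattern_top h3); lia.
Qed.

Lemma triple_label_inj q q' : nl_triple q -> nl_triple q' ->
  (forall i j, in_trapezoid n i j -> triple_label q i j = triple_label q' i j) -> q = q'.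
Proof.
case: q q' => -[p1 p2] p3 [[p1' p2'] p3'] /and3P[h1 h2 h3] /and3P[h1' h2' h3'] e.
have emu i j : (i <= j)%N -> (j <= n)%N ->
    hive_of (top_row p2) (pat_val p1) i j = hive_of (top_row p2') (pat_val p1') i j.
  move=> ij jn; have := e i j; rewrite !triple_label_mu ?ij // => -> //.
  by rewrite /in_trapezoid; lia.
have enu i j : (i <= j)%N -> (j <= n)%N ->
    hive_of (top_row p3) (pat_val p2) i j = hive_of (top_row p3') (pat_val p2') i j.
  move=> ij jn; have := e (n + i)%N (n + j)%N; rewrite !triple_label_nu ?ij // emu // => /(_ _)/addnI -> //.
  by rewrite /in_trapezoid; lia.
have ela i j : (i <= j)%N -> (j <= n)%N ->
    hive_of (top_row p1) (pat_val p3) i j = hive_of (top_row p1') (pat_val p3') i j.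
  move=> ij jn; have := e j (n + i)%N; rewrite !triple_label_la ?ij // emu // => /(_ _)/addnI -> //.
  by rewrite /in_trapezoid; lia.
congr (_, _, _).
- exact: (hive_of_inj (lr_pattern_gt h1) (lr_pattern_gt h1') emu).
- exact: (hive_of_inj (lr_pattern_gt h2) (lr_pattern_gt h2') enu).
- exact: (hive_of_inj (lr_pattern_gt h3) (lr_pattern_gt h3') ela).
Qed.

Lemma integer_triple_exists G : (psize mu + psize nu + psize la <= M)%N ->
  (size mu <= n)%N -> (size nu <= n)%N -> (size la <= n)%N ->
  integer_K_point n mu nu la G ->
  exists2 q, nl_triple q & forall i j, in_trapezoid n i j -> G i j = (triple_label q i j)%:Z.
Proof.
move=> bM muN nuN laN [[o sz gl] diag [r1 r2 r3] nn].
pose al i := if (i < n)%N then `|G 0%N i.+1 - G 0%N i|%N else 0%N.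
pose be i := if (i < n)%N then `|G i.+1 n - G i n|%N else 0%N.
pose ga i := if (i < n)%N then `|G n (n + i.+1)%N - G n (n + i)%N|%N else 0%N.
have alE i : (i < n)%N -> G 0%N i.+1 - G 0%N i = (al i)%:Z.
  by move=> iN; rewrite /al iN; have [h _ _] := nn i iN; rewrite gez0_abs.
have beE i : (i < n)%N -> G i.+1 n - G i n = (be i)%:Z.
  by move=> iN; rewrite /be iN; have [_ h _] := nn i iN; rewrite gez0_abs.
have gaE i : (i < n)%N -> G n (n + i.+1)%N - G n (n + i)%N = (ga i)%:Z.
  by move=> iN; rewrite /ga iN; have [_ _ h] := nn i iN; rewrite gez0_abs.
have al0 i : (n <= i)%N -> al i = 0%N by rewrite /al ltnNge => ->.
have be0 i : (n <= i)%N -> be i = 0%N by rewrite /be ltnNge => ->.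
have ga0 i : (n <= i)%N -> ga i = 0%N by rewrite /ga ltnNge => ->.
have p0 (k : intpart) i : (size k <= n)%N -> (n <= i)%N -> nth 0%N k i = 0%N.
  by move=> kn ni; rewrite nth_default // (leq_trans kn).
have smu : G n n - G 0%N 0%N = (psize mu)%:Z.
  by rewrite (psize_sum muN); apply: (telescope_int (g := fun i => G i i)) => i /diag[].
have snu : G (n + n)%N (n + n)%N - G (n + 0)%N (n + 0)%N = (psize nu)%:Z.
  by rewrite (psize_sum nuN); apply: (telescope_int (g := fun i => G (n + i)%N (n + i)%N)) => i /diag[].
have sla : G n (n + n)%N - G 0%N (n + 0)%N = (psize la)%:Z.
  by rewrite (psize_sum laN); apply: (telescope_int (g := fun i => G i (n + i)%N)) => i /diag[].
have sal : G 0%N n - G 0%N 0%N = (\sum_(i < n) al i)%N%:Z by exact: telescope_int.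
have sbe : G n n - G 0%N n = (\sum_(i < n) be i)%N%:Z.
  by apply: (telescope_int (g := fun i => G i n)).
have sga : G n (n + n)%N - G n (n + 0)%N = (\sum_(i < n) ga i)%N%:Z.
  by apply: (telescope_int (g := fun i => G n (n + i)%N)).
have bound (v : nat -> nat) : (forall i, (n <= i)%N -> v i = 0%N) -> (v 0 <= \sum_(i < n) v i)%N.
  move=> v0; case: (posnP n) => [n0|npos]; first by rewrite v0 // n0.
  by rewrite (bigD1 (Ordinal npos)) //= leq_addr.
have glz := gl n (leqnn _).
have g0 := gl 0%N (leq0n _).
(* The sizes of alpha, beta and gamma add up pairwise to |mu|, |nu| and |la|, so each of them is at
   most [M]. *)
have ab : (al 0 <= M)%N by have := bound al al0; move: sal sbe sga smu snu sla; rewrite !addn0 o; lia.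
have bb : (be 0 <= M)%N by have := bound be be0; move: sal sbe sga smu snu sla; rewrite !addn0 o; lia.
have cb : (ga 0 <= M)%N by have := bound ga ga0; move: sal sbe sga smu snu sla; rewrite !addn0 o; lia.
have [p1 h1 e1] := @hive_to_pattern n al be (nth 0%N mu) M G bb r1 al0 be0 (fun i => p0 mu i muN) o alE beE
  (fun i iN => let: And3 h _ _ := diag i iN in h).
have := @hive_to_pattern n ga al (nth 0%N nu) M _ ab
  (hive_rhombi_sub (G n n) r2) ga0 al0 (fun i => p0 nu i nuN).
case=> [|j jn|i iN|i iN|p2 h2 e2].
- by rewrite addn0 subrr.
- by rewrite addn0 -gaE //; lia.
- by have := gl i.+1 iN; have := gl i (ltnW iN); rewrite -alE //; lia.
- by have [_ + _] := diag i iN; lia.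
have := @hive_to_pattern n be ga (nth 0%N la) M _ cb
  (hive_rhombi_sub (G 0%N n) r3) be0 ga0 (fun i => p0 la i laN).
case=> [|j jn|i iN|i iN|p3 h3 e3].
- by rewrite addn0 subrr.
- by rewrite addn0 -beE //; lia.
- by rewrite -gaE //; lia.
- by have [_ _ +] := diag i iN; lia.
have t1 : top_row p1 = be by apply/funext => i; rewrite /top_row (gt_pattern_top (lr_pattern_gt h1)).
have t2 : top_row p2 = al by apply/funext => i; rewrite /top_row (gt_pattern_top (lr_pattern_gt h2)).
have t3 : top_row p3 = ga by apply/funext => i; rewrite /top_row (gt_pattern_top (lr_pattern_gt h3)).
exists (p1, p2, p3); first by rewrite /= t1 t2 t3 h1 h2 h3.
move=> i j; rewrite /in_trapezoid => ij.
have [jn|nj] := leqP j n.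
  by rewrite triple_label_mu ?t2 ?e1 //; lia.
have [ni|iN] := leqP n i.
  rewrite -(subnKC ni) -(subnKC (ltnW nj)) triple_label_nu; last by lia.
  by rewrite t2 t3 PoszD e1 // e2; lia.
rewrite -(subnKC (ltnW nj)) triple_label_la; last by lia.
by rewrite t1 t2 PoszD e1 // e3; lia.
Qed.

End Triples.

Lemma lr_pattern_top_le n M (be mu : intpart) al (p : pat n M) :
  (size mu <= n)%N -> lr_pattern al (nth 0%N be) (nth 0%N mu) p -> (nth 0%N be 0 <= psize mu)%N.
Proof.
move=> muN pP; have /and3P[_ _ /asboolP w] := pP; have xP := lr_pattern_gt pP.
have [n0|n0] := posnP n; first by rewrite -(gt_pattern_top xP) pat_val_out // n0 orbT.
apply: (@leq_trans (\sum_(i < n) nth 0 be i)%N).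
  by rewrite (bigD1 (Ordinal n0)) //= leq_addr.
by rewrite -(sum_weight xP) (psize_sum muN); apply: leq_sum => i _; rewrite -w leq_addl.
Qed.

(** The bound [M] depends on [mu] only, so one finite type serves every [be] in the infinite sum. If
    the first part of [be] exceeds [M], there is no pattern at all, since that part is at most |mu|
    for every pattern counted. *)
Lemma LR_coef_patterns n M (al be mu : intpart) : (size mu <= n)%N -> (psize mu <= M)%N ->
  LR_coef al be mu = #|[set p : pat n M | lr_pattern (nth 0%N al) (nth 0%N be) (nth 0%N mu) p]|%:Z.
Proof.
move=> muN muM; have [beM|Mbe] := leqP (nth 0%N be 0) M; first exact: LR_coef_card.
have empty M' : [set p : pat n M' | lr_pattern (nth 0%N al) (nth 0%N be) (nth 0%N mu) p] = finset.set0.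
  apply/setP => p; rewrite !inE; apply/negP => /(lr_pattern_top_le muN).
  by rewrite leqNgt (leq_ltn_trans muM Mbe).
by rewrite (LR_coef_card al (leqnn (nth 0%N be 0)) muN) !empty !cards0.
Qed.

(** * The Newell-Littlewood coefficient as a number of triples *)

Section Count.
Variables (n : nat) (mu nu la : intpart).
Hypotheses (muN : (size mu <= n)%N) (nuN : (size nu <= n)%N) (laN : (size la <= n)%N).
Let M := (psize mu + psize nu + psize la)%N.

Definition tops (q : pat n M * pat n M * pat n M) : intpart * intpart * intpart :=
  let: (p1, p2, p3) := q in
  (part_of n (top_row p2), part_of n (top_row p1), part_of n (top_row p3)).

Lemma part_of_top (k : intpart) (p : pat n M) : gt_pattern n (nth 0%N k) (pat_val p) ->
  top_row p = nth 0%N k /\ part_of n (top_row p) = k.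
Proof.
move=> pP; have e : top_row p = nth 0%N k.
  by apply/funext => i; rewrite /top_row (gt_pattern_top pP).
split=> //; apply: intpart_eq => i; rewrite nth_part_of e // => [j|j nj]; first exact: nth_part_decr.
by rewrite -e /top_row pat_val_out // nj orbT.
Qed.

Lemma nth_top (p : pat n M) v : gt_pattern n v (pat_val p) -> nth 0%N (part_of n (top_row p)) = top_row p.
Proof.
move=> pP; apply/funext => i; apply: nth_part_of => [j|j nj].
  exact: (gt_pattern_decr pP).
by rewrite /top_row pat_val_out // nj orbT.
Qed.

Lemma nl_triple_tops al be ga p1 p2 p3 :
  (nl_triple mu nu la (p1, p2, p3) && (tops (p1, p2, p3) == (al, be, ga))) =
  [&& lr_pattern (nth 0%N al) (nth 0%N be) (nth 0%N mu) p1,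
      lr_pattern (nth 0%N ga) (nth 0%N al) (nth 0%N nu) p2
    & lr_pattern (nth 0%N be) (nth 0%N ga) (nth 0%N la) p3].
Proof.
apply/andP/and3P => [[/and3P[h1 h2 h3] /eqP[<- <- <-]]|[h1 h2 h3]].
  by rewrite (nth_top (lr_pattern_gt h1)) (nth_top (lr_pattern_gt h2)) (nth_top (lr_pattern_gt h3)).
have [e1 e1'] := part_of_top (lr_pattern_gt h1); have [e2 e2'] := part_of_top (lr_pattern_gt h2).
have [e3 e3'] := part_of_top (lr_pattern_gt h3).
by rewrite /= e1' e2' e3' e1 e2 e3 h1 h2 h3.
Qed.

(** The triples are sorted by their top rows: the fibre over a given (alpha, beta, gamma) is a
    product of three sets of patterns, and only finitely many fibres are nonempty. *)
Lemma NL_coef_triples : NL_coef mu nu la = #|[set q : pat n M * pat n M * pat n M | nl_triple mu nu la q]|%:Z.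
Proof.
rewrite /NL_coef.
have term al be ga : LR_coef al be mu * LR_coef al ga nu * LR_coef be ga la =
    #|[set q : pat n M * pat n M * pat n M | nl_triple mu nu la q && (tops q == (al, be, ga))]|%:Z.
  (* In the second triangle the pattern has shape alpha over gamma, hence the exchange of the two
     factors. *)
  rewrite (LR_coefC al ga) !(@LR_coef_patterns n M) //; try by rewrite /M; lia.
  rewrite -!PoszM -!cardsX; congr (Posz _); apply: eq_card => -[[p1 p2] p3].
  by rewrite !inE /= -andbA -nl_triple_tops.
pose A := [fset x in [seq tops q | q <- enum [set q | nl_triple mu nu la q]]]%fset.
rewrite (@fsbigTE _ _ _ _ A) => [|[[al be] ga] pA]; last first.
  rewrite term (_ : finset _ = finset.set0) ?cards0 //; apply/setP => q; rewrite !inE.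
  apply/negP => /andP[qP /eqP e]; case/negP: pA; rewrite in_fset /= -e.
  by apply: map_f; rewrite mem_enum inE.
rewrite -[RHS]natz -sumr_const.
transitivity (\sum_(x <- A) \sum_(q in [set q | nl_triple mu nu la q]) if tops q == x then 1 else 0 : int).
  apply: eq_bigr => -[[al be] ga] _; rewrite term -big_mkcondr /= -natz -sumr_const.
  by apply: eq_bigl => q; rewrite !inE.
rewrite exchange_big /=; apply: eq_bigr => q qP; rewrite -big_mkcond /=.
rewrite -big_filter (eq_filter (a2 := pred1 (tops q))); last by move=> k; rewrite /= eq_sym.
rewrite filter_pred1_uniq ?fset_uniq ?big_seq1 // in_fset /=.
by apply: map_f; rewrite mem_enum.
Qed.

Lemma has_card_K_polytope (R : realType) :
  has_card (integer_points (@K_polytope R n mu nu la)) (NL_coef mu nu la).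
Proof.
pose Q := [set q : pat n M * pat n M * pat n M | nl_triple mu nu la q].
pose f (q : pat n M * pat n M * pat n M) : labelling R n := @mk_lab R n (fun i j => (triple_label q i j)%:R).
have lf q i j : in_trapezoid n i j -> lab (f q) i j = (triple_label q i j)%:R.
  by move=> ij; rewrite lab_mk_lab.
pose F := [fset x in [seq f q | q <- enum Q]]%fset.
have -> : integer_points (@K_polytope R n mu nu la) = [set` F]%classic.
  apply/seteqP; split=> [a [aK aint]|a /=].
    pose G (i j : nat) : int := Num.floor (lab a i j).
    have aG (i j : nat) : lab a i j = (G i j)%:~R.
      by apply/esym/eqP; rewrite /G -intrEfloor; apply: lab_int.
    have Gpt := (K_polytope_integer muN nuN laN aG).1 aK.
    have [q qP e] := integer_triple_exists (leqnn M) muN nuN laN Gpt.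
    rewrite /= in_fset /=; apply/mapP; exists q; first by rewrite mem_enum inE.
    by apply: lab_eq => i j ij; rewrite lf // aG e.
  rewrite in_fset /= => /mapP[q]; rewrite mem_enum inE => qP ->.
  have fint v : f q v \is a Num.int by rewrite ffunE; exact: natr_int.
  split=> //; pose G (i j : nat) : int := Num.floor (lab (f q) i j).
  have aG (i j : nat) : lab (f q) i j = (G i j)%:~R.
    by apply/esym/eqP; rewrite /G -intrEfloor; apply: lab_int.
  apply/(K_polytope_integer muN nuN laN aG); apply: (triple_label_integer qP) => // i j ij.
  by apply: (@intr_inj R); rewrite -aG lf // pmulrn.
split; first exact: finite_fset.
rewrite set_fsetK NL_coef_triples card_fseq undup_id ?size_map -?cardE //.
rewrite map_inj_in_uniq ?enum_uniq // => q q'; rewrite !mem_enum !inE => qP q'P e.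
apply: (triple_label_inj qP q'P) => i j ij.
by apply/eqP; rewrite -(eqr_nat R) -!lf // e.
Qed.

End Count.

(** * Quasi-polynomial counting *)

Definition upd (T : Type) (v : nat -> T) (k : nat) (y : T) : nat -> T :=
  fun i => if i == k then y else v i.

Lemma upd_upd (T : Type) (v : nat -> T) k y z : upd (upd v k y) k z = upd v k z.
Proof. by apply/funext => i; rewrite /upd; case: eqP. Qed.

Lemma upd_id (T : Type) (v : nat -> T) k : upd v k (v k) = v.
Proof. by apply/funext => i; rewrite /upd; case: eqP => [->|]. Qed.

Lemma updE (T : Type) (v : nat -> T) k y : upd v k y k = y.
Proof. by rewrite /upd eqxx. Qed.

(** The ends of a fibre are floors, and later eliminations substitute them into counts that already
    contain floors; the class is therefore closed under nesting. *)
Inductive quasi_linear : ((nat -> int) -> int) -> Prop :=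
| QLvar k : quasi_linear (fun x => x k)
| QLcst c : quasi_linear (fun=> c)
| QLadd f g : quasi_linear f -> quasi_linear g -> quasi_linear (fun x => f x + g x)
| QLscale c f : quasi_linear f -> quasi_linear (fun x => c * f x)
| QLfloor f c : 0 < c -> quasi_linear f -> quasi_linear (fun x => (f x %/ c)%Z).

Lemma quasi_linear_subst f g k : quasi_linear f -> quasi_linear g ->
  quasi_linear (fun x => f (upd x k (g x))).
Proof.
move=> fP gP; elim: fP => [i|c|f1 f2 _ h1 _ h2|c f1 _ h|f1 c c0 _ h].
- by rewrite /upd; case: (i == k) => //; exact: QLvar.
- exact: QLcst.
- exact: QLadd.
- exact: QLscale.
- exact: QLfloor.
Qed.

Lemma quasi_linear_sum (I : Type) (r : seq I) (P : pred I) (F : I -> (nat -> int) -> int) :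
  (forall i, quasi_linear (F i)) -> quasi_linear (fun x => \sum_(i <- r | P i) F i x).
Proof.
move=> h; elim: r => [|i r IH].
  by rewrite (_ : (fun x => _) = fun=> 0); [exact: QLcst|apply/funext => x; rewrite big_nil].
case Pi: (P i).
  by rewrite (_ : (fun x => _) = fun x => F i x + \sum_(i <- r | P i) F i x);
    [exact: QLadd|apply/funext => x; rewrite big_cons Pi].
by rewrite (_ : (fun x => _) = fun x => \sum_(i <- r | P i) F i x) //; apply/funext => x; rewrite big_cons Pi.
Qed.

(** The free factor [e] lets a period be replaced by its multiples, so that two summands get a
    common one; a floor with denominator [c] multiplies the period by [c]. *)
Lemma quasi_linear_period f k : quasi_linear f -> exists2 d : int, 0 < d &
  forall e, exists s, forall x y z, f (upd x k (y + d * e * z)) = f (upd x k y) + s * z.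
Proof.
elim=> [i|c|f1 f2 _ [d1 d10 h1] _ [d2 d20 h2]|c f1 _ [d d0 h]|f1 c c0 _ [d d0 h]].
- exists 1 => // e; rewrite /upd; case: (i == k); first by exists e => *; ring.
  by exists 0 => *; ring.
- by exists 1 => // e; exists 0 => *; ring.
- exists (d1 * d2); first by rewrite mulr_gt0.
  move=> e; have [s1 e1] := h1 (d2 * e); have [s2 e2] := h2 (d1 * e).
  exists (s1 + s2) => x y z; have := e1 x y z; have := e2 x y z.
  have -> : d2 * (d1 * e) * z = d1 * d2 * e * z by ring.
  have -> : d1 * (d2 * e) * z = d1 * d2 * e * z by ring.
  by move=> -> ->; ring.
- by exists d => // e; have [s es] := h e; exists (c * s) => x y z; rewrite es; ring.
- exists (d * c); first by rewrite mulr_gt0.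
  move=> e; have [s es] := h e; exists s => x y z.
  have -> : d * c * e * z = d * e * (c * z) by ring.
  by rewrite es (_ : s * (c * z) = (s * z) * c); [rewrite addrC divzMDl ?gt_eqF // addrC | ring].
Qed.

Lemma divz_unique (n q d : int) : 0 < d -> q * d <= n -> n < (q + 1) * d -> (n %/ d)%Z = q.
Proof.
move=> d0 h1 h2; apply/eqP; rewrite eq_le lez_divRL // h1 andbT.
by rewrite -ltzD1 ltz_divLR.
Qed.

Lemma divz_progression (q s r d : int) : 0 < d -> 0 <= s < d -> 0 <= r < d ->
  ((q * d + s - r)%R %/ d)%Z - ((q * d + s - 1 - r)%R %/ d)%Z = (s == r)%:Z.
Proof.
move=> d0 /andP[s0 sd] /andP[r0 rd].
have e : (q - 1) * d = q * d - d by ring.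
have e' : (q + 1) * d = q * d + d by ring.
case: (ltgtP s r) => sr.
- by rewrite !(@divz_unique _ (q - 1)) ?subrr // ?subrK ?e; lia.
- by rewrite !(@divz_unique _ q) ?subrr // ?e'; lia.
- have -> : ((q * d + s - r)%R %/ d)%Z = q by apply: divz_unique => //; rewrite ?e'; lia.
  have -> : ((q * d + s - 1 - r)%R %/ d)%Z = q - 1 by apply: divz_unique => //; rewrite ?subrK ?e; lia.
  by rewrite opprB addrCA subrr addr0.
Qed.

Section QuasiPolynomials.
Variable R : realFieldType.

Inductive quasi_poly : ((nat -> int) -> R) -> Prop :=
| QPlin f : quasi_linear f -> quasi_poly (fun x => (f x)%:~R)
| QPcst c : quasi_poly (fun=> c)
| QPadd f g : quasi_poly f -> quasi_poly g -> quasi_poly (fun x => f x + g x)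
| QPmul f g : quasi_poly f -> quasi_poly g -> quasi_poly (fun x => f x * g x).

Lemma quasi_poly_subst f g k : quasi_poly f -> quasi_linear g ->
  quasi_poly (fun x => f (upd x k (g x))).
Proof.
move=> fP gP; elim: fP => [f1 f1P|c|f1 f2 _ h1 _ h2|f1 f2 _ h1 _ h2].
- by apply: (QPlin (f := fun x => f1 (upd x k (g x)))); apply: quasi_linear_subst.
- exact: QPcst.
- exact: QPadd.
- exact: QPmul.
Qed.

Lemma quasi_poly_sum (I : Type) (r : seq I) (P : pred I) (F : I -> (nat -> int) -> R) :
  (forall i, quasi_poly (F i)) -> quasi_poly (fun x => \sum_(i <- r | P i) F i x).
Proof.
move=> h; elim: r => [|i r IH].
  by rewrite (_ : (fun x => _) = fun=> 0); [exact: QPcst|apply/funext => x; rewrite big_nil].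
case Pi: (P i).
  by rewrite (_ : (fun x => _) = fun x => F i x + \sum_(i <- r | P i) F i x);
    [exact: QPadd|apply/funext => x; rewrite big_cons Pi].
by rewrite (_ : (fun x => _) = fun x => \sum_(i <- r | P i) F i x) //; apply/funext => x; rewrite big_cons Pi.
Qed.

Lemma quasi_poly_sub f g : quasi_poly f -> quasi_poly g -> quasi_poly (fun x => f x - g x).
Proof.
move=> fP gP; rewrite (_ : (fun x => _) = fun x => f x + -1 * g x).
  by apply: QPadd => //; apply: QPmul => //; exact: QPcst.
by apply/funext => x; rewrite mulN1r.
Qed.

Lemma quasi_poly_exp f j : quasi_poly f -> quasi_poly (fun x => f x ^+ j).
Proof.
move=> fP; elim: j => [|j IH].
  by rewrite (_ : (fun x => _) = fun=> 1); [exact: QPcst|apply/funext => x; rewrite expr0].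
by rewrite (_ : (fun x => _) = fun x => f x * f x ^+ j); [exact: QPmul|apply/funext => x; rewrite exprS].
Qed.

Lemma quasi_poly_horner (p : {poly R}) f : quasi_poly f -> quasi_poly (fun x => p.[f x]).
Proof.
move=> fP; rewrite (_ : (fun x => _) = fun x => \sum_(i < size p) p`_i * f x ^+ i).
  by apply: quasi_poly_sum => i; apply: QPmul; [exact: QPcst|exact: quasi_poly_exp].
by apply/funext => x; rewrite horner_coef.
Qed.

Lemma quasi_poly_period f k : quasi_poly f -> exists2 d : int, 0 < d &
  forall e r, exists (P : (nat -> int) -> {poly R}) (D : nat),
    [/\ forall x, (size (P x) <= D)%N, forall j, quasi_poly (fun x => (P x)`_j) &
        forall x z, f (upd x k (r + d * e * z)) = (P x).[z%:~R]].
Proof.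
elim=> [f1 f1P|c|f1 f2 _ [d1 d10 h1] _ [d2 d20 h2]|f1 f2 _ [d1 d10 h1] _ [d2 d20 h2]].
- have [d d0 h] := quasi_linear_period k f1P; exists d => // e r; have [s es] := h e.
  exists (fun x => (f1 (upd x k r))%:~R%:P + s%:~R *: 'X), 2%N; split.
  + move=> x; apply: leq_trans (size_polyD _ _) _; rewrite geq_max; apply/andP; split.
      by apply: leq_trans (size_polyC_leq1 _) _.
    by apply: leq_trans (size_scale_leq _ _) _; rewrite size_polyX.
  + move=> j; rewrite (_ : (fun x => _) = fun x => (j == 0%N)%:R * (f1 (upd x k r))%:~R + s%:~R * (j == 1%N)%:R).
      apply: QPadd; last exact: QPcst.
      apply: QPmul; first exact: QPcst.
      by apply: (QPlin (f := fun x => f1 (upd x k r))); apply: quasi_linear_subst => //; exact: QLcst.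
    by apply/funext => x; rewrite coefD coefC coefZ coefX; case: (j == 0%N); rewrite ?mul1r ?mul0r.
  + by move=> x z; rewrite es !hornerE rmorphD rmorphM.
- exists 1 => // e r; exists (fun=> c%:P), 1%N; split=> [x|j|x z].
  + exact: size_polyC_leq1.
  + exact: QPcst.
  + by rewrite hornerC.
- exists (d1 * d2); first by rewrite mulr_gt0.
  move=> e r; have [P1 [D1 [s1 c1 e1]]] := h1 (d2 * e) r; have [P2 [D2 [s2 c2 e2]]] := h2 (d1 * e) r.
  exists (fun x => P1 x + P2 x), (maxn D1 D2); split=> [x|j|x z].
  + apply: leq_trans (size_polyD _ _) _; rewrite geq_max !leq_max s1 s2 orbT //.
  + by rewrite (_ : (fun x => _) = fun x => (P1 x)`_j + (P2 x)`_j);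
      [exact: QPadd|apply/funext => x; rewrite coefD].
  + by rewrite hornerD -e1 -e2; congr (f1 (upd _ _ _) + f2 (upd _ _ _)); ring.
- exists (d1 * d2); first by rewrite mulr_gt0.
  move=> e r; have [P1 [D1 [s1 c1 e1]]] := h1 (d2 * e) r; have [P2 [D2 [s2 c2 e2]]] := h2 (d1 * e) r.
  exists (fun x => P1 x * P2 x), (D1 + D2)%N; split=> [x|j|x z].
  + apply: leq_trans (size_polyMleq _ _) _; apply: leq_trans (leq_pred _) _.
    by apply: leq_add.
  + rewrite (_ : (fun x => _) = fun x => \sum_(i < j.+1) (P1 x)`_i * (P2 x)`_(j - i)).
      by apply: quasi_poly_sum => i; exact: QPmul.
    by apply/funext => x; rewrite coefM.
  + by rewrite hornerM -e1 -e2; congr (f1 (upd _ _ _) * f2 (upd _ _ _)); ring.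
Qed.

Lemma poly_antidifference j : exists B : {poly R}, forall z, B.[z] - B.[z - 1] = z ^+ j.
Proof.
elim/ltn_ind: j => j IH.
have /choice[B BP] : forall i : nat, exists B : {poly R}, (i < j)%N -> forall z, B.[z] - B.[z - 1] = z ^+ i.
  by move=> i; case: (ltnP i j) => [/IH[B BP]|_]; [exists B|exists 0].
(* Telescoping [z^(j+1)] leaves terms of lower degree. *)
pose c (i : nat) : R := (-1) ^+ (j.+1 - i) *+ 'C(j.+1, i).
exists (j.+1%:R^-1 *: ('X^(j.+1) + \sum_(i < j) c i *: B i)) => z.
have j0 : j.+1%:R != 0 :> R by rewrite pnatr_eq0.
apply: (mulfI j0).
rewrite !hornerZ !hornerD !hornerXn !horner_sum mulrBr !mulVKf // opprD addrACA -sumrB.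
have -> : \sum_(i < j) ((c i *: B i).[z] - (c i *: B i).[z - 1]) = \sum_(i < j) c i * z ^+ i.
  by apply: eq_bigr => i _; rewrite !hornerZ -mulrBr BP.
have -> : (z - 1) ^+ j.+1 = \sum_(i < j.+2) c i * z ^+ i.
  rewrite addrC exprDn; apply: eq_bigr => i _.
  by rewrite /c mulrnAl.
have c1 : c j.+1 = 1 by rewrite /c subnn expr0 binn.
have c0 : c j = - j.+1%:R by rewrite /c subSn // subnn expr1 binSn mulNrn.
by rewrite !big_ord_recr /= c0 c1; ring.
Qed.

Lemma quasi_poly_antidifference f k : quasi_poly f -> exists2 Q, quasi_poly Q &
  forall x y, Q (upd x k y) - Q (upd x k (y - 1)) = f (upd x k y).
Proof.
move=> fP; have [d d0 /(_ 1) h] := quasi_poly_period k fP.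
have /choice[P h1] := h; have {h h1}/choice[D PD] := h1.
have /choice[B BP] := poly_antidifference.
pose P0 r x := P r (upd x k 0).
pose S (r : int) x (z : R) := \sum_(j < D r) (P0 r x)`_j * (B j).[z].
exists (fun x => \sum_(r < `|d|%N) S r%:Z x ((x k - r%:Z) %/ d)%Z%:~R).
  apply: quasi_poly_sum => r; apply: quasi_poly_sum => j; apply: QPmul.
    have [_ c _] := PD r%:Z.
    by apply: (quasi_poly_subst (f := fun x => (P r%:Z x)`_j) (g := fun=> 0)) => //; exact: QLcst.
  apply: quasi_poly_horner; apply: (QPlin (f := fun x => ((x k - r%:Z) %/ d)%Z)); apply: QLfloor => //.
  by apply: QLadd; [exact: QLvar|exact: QLcst].
move=> x y; rewrite !updE -sumrB.
have r0d : (`|(y %% d)%Z| < `|d|)%N by have := ltz_pmod y d0; have := modz_ge0 y (lt0r_neq0 d0); lia.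
have dy := divz_eq y d.
have r0E : (`|(y %% d)%Z|%N)%:Z = (y %% d)%Z by rewrite gez0_abs // modz_ge0 // gt_eqF.
have P0E r z : S r (upd x k z) = S r x.
  by apply/funext => w; apply: eq_bigr => j _; rewrite /P0 upd_upd.
have m0 := modz_ge0 y (lt0r_neq0 d0); have m1 := ltz_pmod y d0.
rewrite (bigD1 (Ordinal r0d)) //= [X in _ + X]big1 ?addr0; last first.
  move=> r; rewrite -val_eqE /= => rr0; rewrite !P0E.
  have rd := ltn_ord r.
  have := @divz_progression (y %/ d)%Z (y %% d)%Z r%:Z d d0; rewrite -dy m0 m1.
  have -> : (0 <= r%:Z < d) by apply/andP; split=> //; move: (nat_of_ord r) rd => r1; lia.
  move=> /(_ isT isT); rewrite -r0E eqz_nat eq_sym (negPf rr0) => /subr0_eq ->.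
  exact: subrr.
have e1 : ((y - (y %% d)%Z) %/ d = y %/ d)%Z by rewrite {1}dy addrK mulzK // gt_eqF.
have e2 : ((y - 1 - (y %% d)%Z) %/ d = (y %/ d)%Z - 1)%Z.
  have := @divz_progression (y %/ d)%Z (y %% d)%Z (y %% d)%Z d d0; rewrite -dy m0 m1 eqxx e1.
  move=> /(_ isT isT) e; have {}e : (y %/ d)%Z - ((y - 1 - (y %% d)%Z)%R %/ d)%Z = 1 by exact: e.
  by move: ((y %/ d)%Z) (((y - 1 - (y %% d)%Z)%R %/ d)%Z) e => u v euv; clear -euv; lia.
rewrite !P0E r0E e1 e2.
have [_ _ ev] := PD (y %% d)%Z; have [sz _ _] := PD (y %% d)%Z.
have -> : upd x k y = upd (upd x k 0) k ((y %% d)%Z + d * 1 * (y %/ d)%Z).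
  by rewrite upd_upd; congr (upd _ _ _); lia.
rewrite ev (horner_coef_wide _ (sz _)) -sumrB; apply: eq_bigr => j _.
by rewrite -mulrBr -BP rmorphB.
Qed.

Lemma quasi_poly_univariate f : quasi_poly f -> exists2 d : nat, (0 < d)%N &
  exists p : nat -> {poly R}, forall t : nat, f (upd (fun=> 0) 0 t%:Z) = (p (t %% d)%N).[t%:R].
Proof.
move=> fP; have [d d0 /(_ 1) h] := quasi_poly_period 0 fP.
have /choice[P h1] := h; have {h h1}/choice[D PD] := h1.
have dE : (`|d|%N)%:Z = d by rewrite gez0_abs // ltW.
exists `|d|%N; first by lia.
exists (fun r => P r%:Z (fun=> 0) \Po (d%:~R^-1 *: ('X - r%:R%:P))) => t.
have [_ _ ev] := PD (t %% `|d|)%N%:Z.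
have -> : t%:Z = (t %% `|d|)%N%:Z + d * 1 * (t %/ `|d|)%N%:Z.
  by rewrite {1}(divn_eq t `|d|%N) PoszD PoszM dE mulr1 mulrC addrC.
rewrite ev horner_comp !hornerE; congr (_.[_]).
apply: (mulfI (x := d%:~R)); first by rewrite intr_eq0 gt_eqF.
rewrite mulVKf; last by rewrite intr_eq0 gt_eqF.
have -> : t%:R = (t %/ `|d|)%N%:R * d%:~R + (t %% `|d|)%N%:R :> R.
  have dR : d%:~R = (`|d|%N)%:R :> R by rewrite -[in LHS]dE pmulrn.
  by rewrite {1}(divn_eq t `|d|%N) natrD natrM dR.
by rewrite -?pmulrn; ring.
Qed.
End QuasiPolynomials.

Section IntervalSums.
Variable R : nmodType.
Implicit Types (u v w : int) (F : int -> R).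

(* The sum over the half-open interval ]u, v], meaningful only for u <= v. *)
Definition isum u v F : R := \sum_(0 <= i < `|v - u|%N) F (u + i.+1%:Z).

Lemma isum_split w u v F : u <= w -> w <= v -> isum u v F = isum u w F + isum w v F.
Proof.
move=> uw wv; rewrite /isum (@big_cat_nat _ _ _ `|w - u|%N) //=; last by lia.
congr (_ + _); rewrite -{1}[(`|w - u|)%N]add0n big_addn.
have -> : (`|v - u| - `|w - u| = `|v - w|)%N by lia.
by apply: eq_bigr => i _; congr F; lia.
Qed.

Lemma eq_isum u v F G : u <= v -> (forall y, u < y -> y <= v -> F y = G y) -> isum u v F = isum u v G.
Proof. by move=> uv e; apply: eq_big_nat => i iv; apply: e; lia. Qed.

Lemma isum0 u v F : u <= v -> (forall y, u < y -> y <= v -> F y = 0) -> isum u v F = 0.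
Proof. by move=> uv e; rewrite (@eq_isum u v F (fun=> 0)) // /isum big1. Qed.

Lemma isumxx u F : isum u u F = 0.
Proof. by rewrite /isum subrr big_geq. Qed.
End IntervalSums.

Lemma isum_telescope (R : zmodType) (u v : int) (F : int -> R) : u <= v ->
  isum u v (fun y => F y - F (y - 1)) = F v - F u.
Proof.
move=> uv; have [n ->] : exists n : nat, v = u + n%:Z by exists `|v - u|%N; lia.
have en : `|(u + n%:Z - u)%R|%N = n by lia.
rewrite /isum en; elim: n {en} => [|n IH]; first by rewrite big_geq // addr0 subrr.
rewrite big_nat_recr //= IH (_ : u + n.+1%:Z - 1 = u + n%:Z); last by lia.
by rewrite addrC addrA subrK.
Qed.

(** * Homogeneous forms and elimination of one variable *)

Section Elimination.
Variables (R : realFieldType) (m : nat).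
Local Notation form := (nat -> int).
Implicit Types (f g h : form) (v p : nat -> R) (x : nat -> int) (F A : seq form).

Definition evf f v : R := \sum_(i < m) (f i)%:~R * v i.
Definition evz f x : int := \sum_(i < m) f i * x i.
Definition emb x : nat -> R := fun i => (x i)%:~R.

Lemma evf_emb f x : evf f (emb x) = (evz f x)%:~R.
Proof. by rewrite /evz rmorph_sum; apply: eq_bigr => i _; rewrite /emb rmorphM. Qed.

Lemma emb_upd x k y : emb (upd x k y) = upd (emb x) k y%:~R.
Proof. by apply/funext => i; rewrite /emb /upd; case: eqP. Qed.

Lemma emb_upd0 x k : emb (upd x k 0) = upd (emb x) k 0.
Proof. by rewrite emb_upd. Qed.

Definition cone F v : Prop := forall f, f \in F -> 0 <= evf f v.

(* [v] lies in the closed face of the arrangement [A] containing [p]. *)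
Definition same_face A p v : Prop := forall f, f \in A ->
  (0 <= evf f p -> 0 <= evf f v) /\ (evf f p <= 0 -> evf f v <= 0).

(* [g] is given by one quasi-polynomial on the integer points of each closed
   face of some arrangement.  As the faces are closed, all these
   quasi-polynomials agree at the origin. *)
Definition piecewise_quasi_poly F (g : (nat -> int) -> R) : Prop :=
  exists A, forall p, cone F p -> exists2 q, quasi_poly q &
    forall x, cone F (emb x) -> same_face A p (emb x) -> g x = q x.

Section OneVariable.
Variable k : nat.
Hypothesis km : (k < m)%N.

Lemma evf_upd f v y : evf f (upd v k y) = evf f (upd v k 0) + (f k)%:~R * y.
Proof.
rewrite /evf (bigD1 (Ordinal km)) //= [in RHS](bigD1 (Ordinal km)) //= !updE mulr0 add0r addrC.
congr (_ + _); apply: eq_bigr => i; rewrite -val_eqE /= => /negPf ik.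
by rewrite /upd ik.
Qed.

Lemma evf_upd_const f v y : f k = 0 -> evf f (upd v k y) = evf f v.
Proof. by move=> f0; rewrite (evf_upd f v y) -[in RHS](upd_id v k) (evf_upd f v (v k)) f0 !mul0r. Qed.

Definition root f v : R := - evf f (upd v k 0) / (f k)%:~R.

Lemma evf_root f v y : f k != 0 -> evf f (upd v k y) = (f k)%:~R * (y - root f v).
Proof.
move=> f0; have f0' : (f k)%:~R != 0 :> R by rewrite intr_eq0.
by rewrite evf_upd /root mulrBr [_ * (_ / _)]mulrC divfK // opprK addrC.
Qed.

Definition comb f g : form := fun i => f k * g i - g k * f i.

Lemma comb_at f g : comb f g k = 0.
Proof. by rewrite /comb mulrC subrr. Qed.

Lemma evf_comb f g v : f k != 0 -> g k != 0 ->
  evf (comb f g) v = (f k * g k)%:~R * (root f v - root g v).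
Proof.
move=> f0 g0; have f0' : (f k)%:~R != 0 :> R by rewrite intr_eq0.
have g0' : (g k)%:~R != 0 :> R by rewrite intr_eq0.
have -> : evf (comb f g) v = (f k)%:~R * evf g v - (g k)%:~R * evf f v.
  rewrite /evf !mulr_sumr -sumrB; apply: eq_bigr => i _.
  by rewrite /comb rmorphB !rmorphM /= mulrBl !mulrA.
rewrite -{1 2}(upd_id v k) !evf_root // rmorphM /=; ring.
Qed.

(** Both branches divide by a positive integer, as [QLfloor] demands. *)
Definition root_floor f x : int :=
  if 0 < f k then (- evz f (upd x k 0) %/ f k)%Z else (evz f (upd x k 0) %/ - f k)%Z.

(** The greatest integer strictly below the root, so that a half-open interval starting here still
    contains an integral root. *)
Definition root_pred f x : int :=
  if 0 < f k then ((- evz f (upd x k 0) - 1) %/ f k)%Z else ((evz f (upd x k 0) - 1) %/ - f k)%Z.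

Lemma root_floor_ge f x y : f k != 0 -> (y <= root_floor f x) = (y%:~R <= root f (emb x)).
Proof.
move=> f0; rewrite /root_floor /root -emb_upd0 evf_emb.
case: ltgtP f0 => // fk _.
  by rewrite lez_divRL // ler_pdivlMr ?ltr0z // -rmorphM -rmorphN ler_int.
by rewrite lez_divRL ?oppr_gt0 // ler_ndivlMr ?ltrz0 // -rmorphM -rmorphN ler_int mulrN lerNl.
Qed.

Lemma root_pred_ge f x y : f k != 0 -> (y <= root_pred f x) = (y%:~R < root f (emb x)).
Proof.
move=> f0; rewrite /root_pred /root -emb_upd0 evf_emb.
case: ltgtP f0 => // fk _.
  by rewrite lez_divRL // ltr_pdivlMr ?ltr0z // -rmorphM -rmorphN ltr_int lerBrDr lezD1.
by rewrite lez_divRL ?oppr_gt0 // ltr_ndivlMr ?ltrz0 // -rmorphM -rmorphN ltr_int lerBrDr lezD1 mulrN ltrNl.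
Qed.

Lemma quasi_linear_evz f : quasi_linear (fun x => evz f (upd x k 0)).
Proof.
apply: quasi_linear_sum => i; apply: QLscale; rewrite /upd.
by case: eqP => _; [exact: QLcst|exact: QLvar].
Qed.

Lemma quasi_linear_opp (l : (nat -> int) -> int) : quasi_linear l -> quasi_linear (fun x => - l x).
Proof.
move=> lP; rewrite (_ : (fun x => _) = fun x => -1 * l x); first exact: QLscale.
by apply/funext => x; rewrite mulN1r.
Qed.

Lemma quasi_linear_root_floor f : f k != 0 -> quasi_linear (root_floor f).
Proof.
rewrite /root_floor; case: ltgtP => // fk _; apply: QLfloor; rewrite ?oppr_gt0 //.
  exact/quasi_linear_opp/quasi_linear_evz.
exact: quasi_linear_evz.
Qed.

Lemma quasi_linear_root_pred f : f k != 0 -> quasi_linear (root_pred f).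
Proof.
rewrite /root_pred; case: ltgtP => // fk _; apply: QLfloor; rewrite ?oppr_gt0 //.
  by apply: QLadd; [exact/quasi_linear_opp/quasi_linear_evz|exact: QLcst].
by apply: QLadd; [exact: quasi_linear_evz|exact: QLcst].
Qed.

(* Fourier-Motzkin elimination of the variable k. *)
Definition project F : seq form :=
  [seq f <- F | f k == 0] ++
  [seq comb f g | f <- [seq f <- F | 0 < f k], g <- [seq g <- F | g k < 0]].

(** Pairs of all signs are combined: the sign of [comb f g] compares the roots of [f] and [g], so on
    a closed face of the refinement all weak inequalities between roots at [p] persist. *)
Definition refine A : seq form :=
  [seq f <- A | f k == 0] ++
  [seq comb f g | f <- [seq f <- A | f k != 0], g <- [seq g <- A | g k != 0]].

Lemma project_at F f : f \in project F -> f k = 0.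
Proof.
rewrite mem_cat mem_filter => /orP[/andP[/eqP //]|/allpairsP[[f1 f2] [_ _ ->]]].
exact: comb_at.
Qed.

Lemma evf_comb_ge0 f g v : 0 < f k -> g k < 0 -> (0 <= evf (comb f g) v) = (root f v <= root g v).
Proof.
move=> f0 g0; rewrite evf_comb; [|by rewrite gt_eqF|by rewrite lt_eqF].
by rewrite nmulr_rge0 ?subr_le0 // ltrz0 pmulr_rlt0.
Qed.

Lemma cone_project F v : cone (project F) v <->
  (forall f, f \in F -> f k = 0 -> 0 <= evf f v) /\
  (forall f g, f \in F -> g \in F -> 0 < f k -> g k < 0 -> root f v <= root g v).
Proof.
split=> [h|[h1 h2] f].
  split=> [f fF f0|f g fF gF f0 g0].
    by apply: h; rewrite mem_cat mem_filter f0 eqxx fF.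
  have : 0 <= evf (comb f g) v.
    apply: h; rewrite mem_cat; apply/orP; right; apply/allpairsP; exists (f, g).
    by rewrite !mem_filter f0 g0 fF gF.
  by rewrite evf_comb_ge0.
rewrite mem_cat mem_filter => /orP[/andP[/eqP f0 fF]|/allpairsP[[f1 f2] /= [+ + ->]]].
  exact: h1.
rewrite !mem_filter => /andP[f10 f1F] /andP[f20 f2F].
by rewrite evf_comb_ge0 // h2.
Qed.

Lemma cone_project_of F v : cone F v -> cone (project F) v.
Proof.
move=> h; apply/cone_project; split=> [f fF _|f g fF gF f0 g0]; first exact: h.
have f0' : f k != 0 by rewrite gt_eqF.
have g0' : g k != 0 by rewrite lt_eqF.
have hv w : evf w v = evf w (upd v k (v k)) by rewrite upd_id.
have := h f fF; have := h g gF.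
rewrite (hv f) (hv g) (evf_root _ _ f0') (evf_root _ _ g0').
rewrite nmulr_rge0 ?ltrz0 // pmulr_rge0 ?ltr0z // subr_le0 subr_ge0.
by move=> h1 h2; exact: le_trans h2 h1.
Qed.

Lemma same_face_refine A p v f g : same_face (refine A) p v ->
  f \in A -> g \in A -> f k != 0 -> g k != 0 -> root f p <= root g p -> root f v <= root g v.
Proof.
move=> sf fA gA f0 g0; have [] := sf (comb f g).
  rewrite mem_cat; apply/orP; right; apply/allpairsP; exists (f, g).
  by rewrite !mem_filter f0 g0 fA gA.
rewrite !evf_comb //; have : (f k * g k)%:~R != 0 :> R by rewrite intr_eq0 mulf_neq0.
move=> c0 h1 h2 pq; case: (ltgtP ((f k * g k)%:~R : R) 0) c0 => // c _.
  by move: h1; rewrite !(nmulr_rge0 _ c) !subr_le0; apply.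
by move: h2; rewrite !(pmulr_rle0 _ c) !subr_le0; apply.
Qed.

Lemma same_face_refine0 A p v f : same_face (refine A) p v -> f \in A -> f k = 0 ->
  (0 <= evf f p -> 0 <= evf f v) /\ (evf f p <= 0 -> evf f v <= 0).
Proof. by move=> sf fA f0; apply: sf; rewrite mem_cat mem_filter f0 eqxx fA. Qed.

End OneVariable.
End Elimination.

Lemma count_lt (T : eqType) (a b : pred T) (s : seq T) w : (forall x, a x -> b x) ->
  w \in s -> b w -> ~~ a w -> (count a s < count b s)%N.
Proof.
move=> ab; elim: s => // x s IH; rewrite inE => /orP[/eqP -> bx /negPf nax|ws bw naw] /=.
  by rewrite bx nax add0n add1n ltnS; apply: sub_count.
rewrite -addnS; apply: leq_add; last exact: IH.
by case: (a x) (ab x) => // ->.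
Qed.

Lemma seq_max_exists (R : realDomainType) (T : eqType) (phi : T -> R) (s : seq T) x : x \in s ->
  exists2 y, y \in s & forall z, z \in s -> phi z <= phi y.
Proof.
elim: s x => // a s IH x _; case: s IH => [|b s] IH.
  by exists a; rewrite ?mem_head // => z; rewrite inE => /eqP ->.
have [y ys ymax] := IH b (mem_head _ _).
case: (leP (phi a) (phi y)) => ay.
  exists y; first by rewrite in_cons ys orbT.
  by move=> z; rewrite inE => /orP[/eqP ->|/ymax].
exists a; rewrite ?mem_head // => z; rewrite inE => /orP[/eqP ->//|/ymax zy].
exact: le_trans zy (ltW ay).
Qed.

(** * Summation over one fibre *)

Section Step.
Variables (R : realFieldType) (m k : nat).
Hypothesis km : (k < m)%N.
Local Notation form := (nat -> int).
Local Notation evf := (evf m).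
Local Notation root := (root m k).
Local Notation root_floor := (root_floor m k).
Local Notation root_pred := (root_pred m k).
Implicit Types (v : nat -> R) (f h w : form).
Variables (F A : seq form) (g : (nat -> int) -> R).
Hypothesis gP : forall p, cone m F p -> exists2 q, quasi_poly q &
    forall x, cone m F (emb R x) -> same_face m A p (emb R x) -> g x = q x.

Let B := A ++ F.
Let AB f : f \in A -> f \in B. Proof. by rewrite mem_cat => ->. Qed.
Let FB f : f \in F -> f \in B. Proof. by rewrite mem_cat => ->; rewrite orbT. Qed.

Variables (p : nat -> R) (l u : form).
Hypotheses (pF : cone m (project k F) p) (lF : l \in F) (uF : u \in F) (l0 : 0 < l k) (u0 : u k < 0).
Hypothesis lmax : forall f, f \in F -> 0 < f k -> root f p <= root l p.
Hypothesis umin : forall f, f \in F -> f k < 0 -> root u p <= root f p.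

Let l0' : l k != 0. Proof. by rewrite gt_eqF. Qed.
Let u0' : u k != 0. Proof. by rewrite lt_eqF. Qed.

Definition ordered_as (v : nat -> R) : Prop := forall f h, f \in B -> h \in B -> f k != 0 -> h k != 0 ->
  root f p <= root h p -> root f v <= root h v.

Let ok x := cone m (project k F) (emb R x) /\ same_face m (refine k B) p (emb R x).

Lemma ok_ordered x : ok x -> ordered_as (emb R x).
Proof. by move=> [_ sf] f h fB hB f0 h0; apply: (same_face_refine km sf). Qed.

Lemma lu_le : root l p <= root u p.
Proof. by have [_ h] := (cone_project km F p).1 pF; exact: h. Qed.

Lemma fiber_cone v (y : R) : cone m (project k F) v -> ordered_as v ->
  root l v <= y -> y <= root u v -> cone m F (upd v k y).
Proof.
move=> /(cone_project km)[h1 _] ord ly yu f fF; case: (ltgtP (f k) 0) => f0.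
- rewrite evf_root ?lt_eqF // nmulr_rge0 ?ltrz0 // subr_le0.
  by apply: le_trans yu (ord _ _ (FB uF) (FB fF) u0' _ (umin fF f0)); rewrite lt_eqF.
- rewrite evf_root ?gt_eqF // pmulr_rge0 ?ltr0z // subr_ge0.
  by apply: le_trans (ord _ _ (FB fF) (FB lF) _ l0' (lmax fF f0)) ly; rewrite gt_eqF.
- by rewrite evf_upd_const // h1.
Qed.

Lemma cone_fiber v (y : R) : cone m F (upd v k y) -> root l v <= y <= root u v.
Proof.
move=> h; have := h l lF; have := h u uF; rewrite !evf_root //.
by rewrite nmulr_rge0 ?ltrz0 // pmulr_rge0 ?ltr0z // subr_le0 subr_ge0 => -> ->.
Qed.

Lemma face_fiber v (y y' : R) : same_face m (refine k B) p v ->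
  (forall w, w \in A -> w k != 0 -> (root w p <= y -> root w v <= y') /\ (y <= root w p -> y' <= root w v)) ->
  same_face m A (upd p k y) (upd v k y').
Proof.
move=> sf h w wA; case: (ltgtP (w k) 0) => w0; last first.
- by rewrite !evf_upd_const //; apply: (same_face_refine0 sf (AB wA)).
- have w0' : w k != 0 by rewrite gt_eqF.
  rewrite !evf_root // !pmulr_rge0 ?ltr0z // !pmulr_rle0 ?ltr0z // !subr_ge0 !subr_le0.
  exact: h.
- have w0' : w k != 0 by rewrite lt_eqF.
  rewrite !evf_root // !nmulr_rge0 ?ltrz0 // !nmulr_rle0 ?ltrz0 // !subr_ge0 !subr_le0.
  by have [h1 h2] := h w wA w0'.
Qed.

(** The lower end of the fibre lies on a face of its own. The interval contains the root of [l] if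
    that is an integer, and nothing otherwise. *)
Lemma point_sum : exists2 q, quasi_poly q &
  forall x, ok x -> isum (root_pred l x) (root_floor l x) (fun y => g (upd x k y)) = q x.
Proof.
have pc : cone m F (upd p k (root l p)) by apply: fiber_cone; rewrite ?lu_le.
have [q qP qE] := gP pc; have [Q QP QE] := quasi_poly_antidifference k qP.
exists (fun x => Q (upd x k (root_floor l x)) - Q (upd x k (root_pred l x))).
  apply: quasi_poly_sub; apply: quasi_poly_subst => //.
    exact: quasi_linear_root_floor.
  exact: quasi_linear_root_pred.
move=> x okx; have ord := ok_ordered okx; have [xF sf] := okx.
have le : root_pred l x <= root_floor l x.
  by rewrite (@root_floor_ge R) // ltW // -(@root_pred_ge R).
rewrite -(isum_telescope (fun y => Q (upd x k y)) le); apply: eq_isum => // y.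
rewrite ltNge (@root_pred_ge R) // (@root_floor_ge R) // -leNgt => h1 h2.
have yE : y%:~R = root l (emb R x) by apply/eqP; rewrite eq_le h1 h2.
have lu : root l (emb R x) <= root u (emb R x) by apply: ord; rewrite ?lu_le //; exact: FB.
rewrite QE; apply: qE; rewrite emb_upd yE; first exact: fiber_cone.
apply: face_fiber => // w wA w0.
have wB := AB wA; have lB := FB lF.
by split; apply: ord.
Qed.

Let between f h w := (w k != 0) && (root f p < root w p < root h p).

Let root_floor_le f h x : f k != 0 -> h k != 0 ->
  root f (emb R x) <= root h (emb R x) -> root_floor f x <= root_floor h x.
Proof.
move=> f0 h0 fh; rewrite (@root_floor_ge R) //; apply: le_trans fh.
by rewrite -(@root_floor_ge R).
Qed.

(** As no root lies strictly in between at [p], the midpoint selects a closed face that contains the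
    whole interval over every [x] in the face of [p]. If the two roots coincide at [p], they
    coincide at [x] as well and the interval is empty. *)
Lemma gap_sum f h : f \in B -> h \in B -> f k != 0 -> h k != 0 ->
  root l p <= root f p -> root f p <= root h p -> root h p <= root u p ->
  ~~ has (between f h) B ->
  exists2 q, quasi_poly q &
  forall x, ok x -> isum (root_floor f x) (root_floor h x) (fun y => g (upd x k y)) = q x.
Proof.
move=> fB hB f0 h0 lf fh hu /hasPn nb.
have [fh'|eqfh] : root f p < root h p \/ root f p = root h p.
- by case: (ltgtP (root f p) (root h p)) fh => // ? _; [left|right].
- pose y' := (root f p + root h p) / 2.
  have fy : root f p < y' by rewrite /y'; lra.
  have yh : y' < root h p by rewrite /y'; lra.
  have pc : cone m F (upd p k y') by apply: fiber_cone => //; lra.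
  have [q qP qE] := gP pc; have [Q QP QE] := quasi_poly_antidifference k qP.
  exists (fun x => Q (upd x k (root_floor h x)) - Q (upd x k (root_floor f x))).
    by apply: quasi_poly_sub; apply: quasi_poly_subst => //; apply: quasi_linear_root_floor.
  move=> x okx; have ord := ok_ordered okx; have [xF sf] := okx.
  have le : root_floor f x <= root_floor h x by apply: root_floor_le => //; apply: ord.
  rewrite -(isum_telescope (fun y => Q (upd x k y)) le); apply: eq_isum => // y.
  rewrite ltNge !(@root_floor_ge R) // -ltNge => h1 h2.
  have lf' : root l (emb R x) <= root f (emb R x) by apply: ord => //; exact: FB.
  have hu' : root h (emb R x) <= root u (emb R x) by apply: ord => //; exact: FB.
  rewrite QE; apply: qE; rewrite emb_upd; first by apply: fiber_cone => //; lra.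
  apply: face_fiber => // w wA w0.
  have := nb w (AB wA); rewrite /between w0 /= negb_and -!leNgt => /orP[wf|hw].
    have := ord w f (AB wA) fB w0 f0 wf; split; first by lra.
    by move=> yw; lra.
  have := ord h w hB (AB wA) h0 w0 hw; split; last by lra.
  by move=> wy; lra.
- exists (fun=> 0) => [|x okx]; first exact: QPcst.
  have ord := ok_ordered okx.
  have -> : root_floor f x = root_floor h x; last exact: isumxx.
  by apply/eqP; rewrite eq_le !root_floor_le //; apply: ord => //; rewrite eqfh.
Qed.

Lemma interval_sum N f h : f \in B -> h \in B -> f k != 0 -> h k != 0 ->
  root l p <= root f p -> root f p <= root h p -> root h p <= root u p ->
  (count (between f h) B <= N)%N ->
  exists2 q, quasi_poly q &
  forall x, ok x -> isum (root_floor f x) (root_floor h x) (fun y => g (upd x k y)) = q x.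
Proof.
elim: N f h => [|N IH] f h fB hB f0 h0 lf fh hu cnt.
  by apply: gap_sum => //; rewrite has_count -leqNgt.
have [/hasP[w wB /andP[w0 /andP[fw wh]]]|] := boolP (has (between f h) B); last exact: gap_sum.
have [|||q1 q1P e1] := IH f w fB wB f0 w0 lf; try lra.
  rewrite -ltnS; apply: leq_trans cnt; apply: (count_lt (w := w)) => //.
  - by move=> z /andP[z0 /andP[h1 h2]]; apply/andP; split=> //; lra.
  - by rewrite /between w0 fw.
  - by rewrite /between ltxx !andbF.
have [||||q2 q2P e2] := IH w h wB hB w0 h0; try lra.
  rewrite -ltnS; apply: leq_trans cnt; apply: (count_lt (w := w)) => //.
  - by move=> z /andP[z0 /andP[h1 h2]]; apply/andP; split=> //; lra.
  - by rewrite /between w0 fw.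
  - by rewrite /between ltxx !andbF.
exists (fun x => q1 x + q2 x); first exact: QPadd.
move=> x okx; have ord := ok_ordered okx.
rewrite (isum_split _ (w := root_floor w x)) ?e1 ?e2 // root_floor_le //.
  by apply: ord => //; exact: ltW.
by apply: ord => //; exact: ltW.
Qed.

Lemma fiber_sum : exists2 q, quasi_poly q &
  forall x, ok x -> isum (root_pred l x) (root_floor u x) (fun y => g (upd x k y)) = q x.
Proof.
have [q1 q1P e1] := point_sum.
have [q2 q2P e2] := interval_sum (FB lF) (FB uF) l0' u0' (lexx _) lu_le (lexx _) (leqnn _).
exists (fun x => q1 x + q2 x); first exact: QPadd.
move=> x okx; have ord := ok_ordered okx.
have lu : root l (emb R x) <= root u (emb R x) by apply: ord; rewrite ?lu_le //; exact: FB.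
rewrite (isum_split _ (w := root_floor l x)) ?e1 ?e2 // ?root_floor_le //.
by rewrite (@root_floor_ge R) // ltW // -(@root_pred_ge R).
Qed.

End Step.

(** With [box_lower], the inequality |v_k| <= C t, the variable t being numbered 0. It ensures that
    each fibre has a lower and an upper bound, and provides a summation range that does not depend
    on a face. *)
Definition box_upper (C : int) (k : nat) : nat -> int := fun i => C * (i == 0%N)%:Z - (i == k)%:Z.
Definition box_lower (C : int) (k : nat) : nat -> int := fun i => C * (i == 0%N)%:Z + (i == k)%:Z.

Section Box.
Variables (R : realFieldType) (m k : nat) (C : int).
Hypotheses (k0 : (0 < k)%N) (km : (k < m)%N).

Lemma evf_coordinate (v : nat -> R) i : (i < m)%N -> \sum_(j < m) (j == i :> nat)%:Z%:~R * v j = v i.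
Proof.
move=> im; rewrite (bigD1 (Ordinal im)) //= eqxx mul1r big1 ?addr0 // => j.
by rewrite -val_eqE /= => /negPf ->; rewrite mul0r.
Qed.

Lemma evf_box_upper (v : nat -> R) : evf m (box_upper C k) v = C%:~R * v 0%N - v k.
Proof.
rewrite -[X in C%:~R * X](@evf_coordinate v 0) ?(leq_ltn_trans _ km) // -[X in _ - X](@evf_coordinate v k) //.
rewrite mulr_sumr -sumrB; apply: eq_bigr => i _.
by rewrite /box_upper rmorphB rmorphM mulrBl mulrA.
Qed.

Lemma evf_box_lower (v : nat -> R) : evf m (box_lower C k) v = C%:~R * v 0%N + v k.
Proof.
rewrite -[X in C%:~R * X](@evf_coordinate v 0) ?(leq_ltn_trans _ km) // -[X in _ + X](@evf_coordinate v k) //.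
rewrite mulr_sumr -big_split; apply: eq_bigr => i _.
by rewrite /box_lower rmorphD rmorphM mulrDl mulrA.
Qed.

Lemma box_upper_at : box_upper C k k = -1.
Proof. by rewrite /box_upper eqxx gtn_eqF // mulr0 sub0r. Qed.

Lemma box_lower_at : box_lower C k k = 1.
Proof. by rewrite /box_lower eqxx gtn_eqF // mulr0 add0r. Qed.

Lemma root_box_upper (v : nat -> R) : root m k (box_upper C k) v = C%:~R * v 0%N.
Proof.
by rewrite /root evf_box_upper box_upper_at updE /upd ltn_eqF // subr0 rmorphN1 invrN1 mulrN1 opprK.
Qed.

Lemma root_box_lower (v : nat -> R) : root m k (box_lower C k) v = - (C%:~R * v 0%N).
Proof.
by rewrite /root evf_box_lower box_lower_at updE /upd ltn_eqF // addr0 divr1.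
Qed.

Variables (F : seq (nat -> int)) (g : (nat -> int) -> R).
Hypotheses (bu : box_upper C k \in F) (bl : box_lower C k \in F).
Hypothesis g0 : forall x, ~ cone m F (emb R x) -> g x = 0.

(** The 1 is subtracted because [isum] leaves out its lower end. *)
Definition sum_out (x : nat -> int) : R :=
  isum (- (C * x 0%N) - 1) (C * x 0%N) (fun y => g (upd x k y)).

Lemma sum_out0 x : ~ cone m (project k F) (emb R x) -> sum_out x = 0.
Proof.
move=> nc; rewrite /sum_out /isum big1 // => i _; apply: g0 => c; apply: nc => f fF.
have := cone_project_of km c fF; rewrite emb_upd evf_upd_const //.
exact: project_at fF.
Qed.

(** Since [g] vanishes off the cone, the box range can be shrunk to the fibre between the bounds [l]
    and [u] that are extremal at [p]; they stay extremal, hence inside the box, on the whole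
    face. *)
Lemma piecewise_sum_out : piecewise_quasi_poly m F g -> piecewise_quasi_poly m (project k F) sum_out.
Proof.
move=> [A gP]; exists (refine k (A ++ F)) => p pF.
have [l lF lmax] : exists2 l, l \in [seq f <- F | 0 < f k] &
    forall f, f \in [seq f <- F | 0 < f k] -> root m k f p <= root m k l p.
  by apply: (@seq_max_exists R _ (fun f => root m k f p) _ (box_lower C k)); rewrite mem_filter bl box_lower_at.
have [u uF umin] : exists2 u, u \in [seq f <- F | f k < 0] &
    forall f, f \in [seq f <- F | f k < 0] -> - root m k f p <= - root m k u p.
  by apply: (@seq_max_exists R _ (fun f => - root m k f p) _ (box_upper C k)); rewrite mem_filter bu box_upper_at.
rewrite !mem_filter in lF uF; case/andP: lF uF => l0 lF /andP[u0 uF].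
have lmax' f : f \in F -> 0 < f k -> root m k f p <= root m k l p.
  by move=> fF f0; apply: lmax; rewrite mem_filter f0.
have umin' f : f \in F -> f k < 0 -> root m k u p <= root m k f p.
  by move=> fF f0; rewrite -lerN2; apply: umin; rewrite mem_filter f0.
have [q qP qE] := fiber_sum km gP pF lF uF l0 u0 lmax' umin'.
exists q => // x xF sf; rewrite -qE //.
have l0' : l k != 0 by rewrite gt_eqF.
have u0' : u k != 0 by rewrite lt_eqF.
have [_ rl] := (cone_project km F (emb R x)).1 xF.
have lu := rl _ _ lF uF l0 u0.
have lb : root m k (box_lower C k) (emb R x) <= root m k l (emb R x).
  apply: (same_face_refine km sf); rewrite ?mem_cat ?bl ?lF ?orbT ?box_lower_at ?lmax' ?box_lower_at //.
have ub : root m k u (emb R x) <= root m k (box_upper C k) (emb R x).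
  apply: (same_face_refine km sf); rewrite ?mem_cat ?bu ?uF ?orbT ?box_upper_at ?umin' ?box_upper_at //.
rewrite root_box_lower in lb; rewrite root_box_upper in ub.
have out y : g (upd x k y) != 0 -> root m k l (emb R x) <= y%:~R <= root m k u (emb R x).
  move=> gy; have : cone m F (emb R (upd x k y)) by apply: contrapT => /g0 e; rewrite e eqxx in gy.
  by rewrite emb_upd; apply: (cone_fiber km lF uF l0 u0).
have e1 : - (C * x 0%N) - 1 <= root_pred m k l x.
  rewrite (@root_pred_ge R) // rmorphB rmorphN rmorphM /=.
  by move: lb; rewrite /emb; lra.
have e2 : root_pred m k l x <= root_floor m k u x.
  by rewrite (@root_floor_ge R) //; apply: le_trans lu; rewrite ltW // -(@root_pred_ge R).
have e3 : root_floor m k u x <= C * x 0%N.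
  rewrite -(ler_int R) rmorphM; apply: le_trans ub; rewrite -(@root_floor_ge R) //.
rewrite /sum_out (isum_split _ e1 (le_trans e2 e3)) (isum_split _ e2 e3).
rewrite (isum0 e1) ?(isum0 e3) ?add0r ?addr0 //.
  move=> y h1 h2; apply/eqP/negPn/negP => /out /andP[h3 h4].
  by move: h1; rewrite ltNge (@root_floor_ge R) // h4.
move=> y h1 h2; apply/eqP/negPn/negP => /out /andP[h3 h4].
by move: h2; rewrite (@root_pred_ge R) // ltNge h3.
Qed.

End Box.

(** * Summing out all variables but t *)

Section Iteration.
Variables (R : realFieldType) (N : nat) (C : int) (F0 : seq (nat -> int)).
Local Notation m := N.+1.
Hypothesis C0 : 0 <= C.
Hypothesis boxF0 : forall k, (0 < k <= N)%N -> box_upper C k \in F0 /\ box_lower C k \in F0.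

Fixpoint projections (j : nat) : seq (nat -> int) :=
  if j is j'.+1 then project j (projections j') else F0.

Fixpoint lattice_count (j : nat) : (nat -> int) -> R :=
  if j is j'.+1 then sum_out j C (lattice_count j')
  else fun x => if `[< cone m F0 (emb R x) >] then 1 else 0.

Lemma project_keep k f F : f \in F -> f k = 0 -> f \in project k F.
Proof. by move=> fF fk; rewrite mem_cat mem_filter fk eqxx fF. Qed.

Lemma box_projections j k : (j < k <= N)%N ->
  box_upper C k \in projections j /\ box_lower C k \in projections j.
Proof.
elim: j => [|j IH] jk; first exact: boxF0.
have [h1 h2] := IH ltac:(lia); have e : (j.+1 == k) = false by lia.
by split; apply: project_keep => //; rewrite /box_upper /box_lower e mulr0 ?subr0 ?addr0.
Qed.

Lemma projections_at j f i : f \in projections j -> (0 < i <= j)%N -> f i = 0.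
Proof.
elim: j f => [|j IH] f; first by lia.
rewrite /= => fP ij; have [->|ij'] := eqVneq i j.+1; first exact: project_at fP.
move: fP; rewrite mem_cat mem_filter => /orP[/andP[_ fP]|].
  by apply: IH => //; lia.
move=> /allpairsP[[f1 f2] /= []]; rewrite !mem_filter => /andP[_ h1] /andP[_ h2] ->.
by rewrite /comb (IH f1) ?(IH f2) ?mulr0 ?subrr //; lia.
Qed.

Lemma cone_projections j v : (j <= N)%N -> cone m F0 v -> cone m (projections j) (v : nat -> R).
Proof. by elim: j => // j IH jN h; apply: cone_project_of => //; apply: IH => //; lia. Qed.

Lemma lattice_count0 j x : (j <= N)%N -> ~ cone m (projections j) (emb R x) -> lattice_count j x = 0.
Proof.
elim: j x => [|j IH] x jN /= nc; first by case: asboolP.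
by apply: sum_out0 nc => // y; apply: IH; exact: ltnW.
Qed.

Lemma piecewise_lattice_count j : (j <= N)%N -> piecewise_quasi_poly m (projections j) (lattice_count j).
Proof.
elim: j => [|j IH] jN.
  exists [::] => p _; exists (fun=> 1); first exact: QPcst.
  by move=> x h _ /=; case: asboolP.
have [h1 h2] := @box_projections j j.+1 ltac:(lia).
apply: piecewise_sum_out => //; last by apply: IH; lia.
by move=> x; apply: lattice_count0; lia.
Qed.

(* On the ray of the multiples of (1, 0, ..., 0) there is a single closed face,
   which contains the origin; hence the formula also holds for t = 0. *)
Lemma lattice_count_quasi_poly (v : nat -> R) : cone m F0 v -> v 0%N = 1 ->
  exists2 q, quasi_poly q & forall t : nat, lattice_count N (upd (fun=> 0) 0 t%:Z) = q (upd (fun=> 0) 0 t%:Z).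
Proof.
move=> h v0; have [A AP] := piecewise_lattice_count (leqnn N).
pose p : nat -> R := emb R (upd (fun=> 0) 0%N 1).
have scale f (t : nat) : evf m f (emb R (upd (fun=> 0) 0%N t%:Z)) = t%:R * evf m f p.
  rewrite /evf mulr_sumr; apply: eq_bigr => i _; rewrite /p /emb /upd.
  by case: eqP => _; rewrite ?mulr0 // mulr1 mulrC pmulrn.
have pc : cone m (projections N) p.
  move=> f fP; have := cone_projections (leqnn N) h fP; congr (_ <= _).
  apply: eq_bigr => i _; rewrite /p /emb /upd; case: eqP => [->|/eqP i0]; first by rewrite v0.
  by rewrite (projections_at fP) ?mul0r //; have := ltn_ord i; lia.
have [q qP qE] := AP p pc; exists q => // t; apply: qE.
  by move=> f fP; rewrite scale mulr_ge0 ?ler0n ?pc.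
by move=> f _; rewrite scale; split=> h'; [rewrite mulr_ge0|rewrite mulr_ge0_le0].
Qed.

(** The index set of the nested sums in [lattice_count], listed so that their value becomes the
    length of a duplicate-free list. *)
Fixpoint box_points (j : nat) (x : nat -> int) : seq (nat -> int) :=
  if j is j'.+1 then
    flatten [seq box_points j' (upd x j (- (C * x 0%N) - 1 + i.+1%:Z))
            | i <- iota 0 `|(C * x 0%N - (- (C * x 0%N) - 1))%R|%N]
  else [:: x].

Lemma lattice_count_points j x :
  lattice_count j x = \sum_(z <- box_points j x) (if `[< cone m F0 (emb R z) >] then 1 else 0).
Proof.
elim: j x => [|j IH] x; first by rewrite big_seq1.
rewrite /= big_flatten big_map /sum_out /isum /index_iota subn0.
by apply: eq_bigr => i _; rewrite IH.
Qed.

Lemma mem_box_points j (x z : nat -> int) : 0 <= x 0%N -> reflect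
  ((forall i, (i == 0%N) || (j < i)%N -> z i = x i) /\ forall i, (0 < i <= j)%N -> `|z i| <= C * x 0%N)
  (z \in box_points j x).
Proof.
move=> x0; apply: (iffP idP).
  elim: j x x0 => [|j IH] x x0; first by rewrite inE => /eqP ->; split=> // i; lia.
  move=> /flattenP[s /mapP[i]]; rewrite mem_iota => iB -> /IH /= /(_ x0) [h1 h2].
  rewrite {1}/upd /= in h2.
  split=> [k hk|k hk].
    have kj : (k == j.+1) = false by lia.
    by rewrite h1 /upd ?kj //; lia.
  have [e|kj] := eqVneq k j.+1; last by apply: h2; lia.
  rewrite e h1 ?updE ?ltnSn ?orbT //.
  have := mulr_ge0 C0 x0; move: (C * x 0%N) iB => B iB B0; lia.
elim: j x x0 => [|j IH] x x0 [h1 h2].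
  by rewrite inE; apply/eqP/funext => i; apply: h1; case: i.
have zB := h2 j.+1 ltac:(lia).
apply/flattenP; exists (box_points j (upd x j.+1 (z j.+1))).
  apply/mapP; exists `|(z j.+1 + C * x 0%N)%R|%N.
    by rewrite mem_iota; move: (C * x 0%N) (z j.+1) zB => B y yB; lia.
  congr (box_points j (upd x _ _)).
  by move: (C * x 0%N) (z j.+1) zB => B y yB; lia.
apply: IH; first by rewrite /upd.
split=> [i hi|i hi]; last by rewrite /upd /=; apply: h2; lia.
by rewrite /upd; case: eqP => [->//|ij]; apply: h1; lia.
Qed.

Lemma uniq_box_points j (x : nat -> int) : 0 <= x 0%N -> uniq (box_points j x).
Proof.
elim: j x => //= j IH x x0; elim: (iota _ _) (iota_uniq 0 `|(C * x 0%N - (- (C * x 0%N) - 1))%R|%N) => //= i s IHs /andP[si us].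
rewrite cat_uniq IHs // andbT IH //=; apply/hasPn => z /flattenP[r /mapP[i' i's ->]] z1.
apply/negP => z2; case/negP: si.
have at_j i0 : z \in box_points j (upd x j.+1 (- (C * x 0%N) - 1 + i0.+1%:Z)) ->
    z j.+1 = - (C * x 0%N) - 1 + i0.+1%:Z.
  by case/mem_box_points => // h _; rewrite h ?updE // ltnSn orbT.
have := at_j i z2; rewrite (at_j i' z1) => e.
by have -> : i = i' by lia.
Qed.
End Iteration.

(** * Lattice points of bounded homogeneous systems *)

Section ConicSystems.
Variables (R : realType) (V : finType).
Let N := #|V|.

(* The variables of a form are t, numbered 0, and the entries of a. *)
Definition system_vector (t : R) (a : {ffun V -> R}) : nat -> R := fun i =>
  if i is i'.+1 then if insub i' is Some o then a (enum_val (o : 'I_#|V|)) else 0 else t.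

Definition conic (S : R -> {ffun V -> R} -> Prop) : Prop :=
  exists F, forall t a, S t a <-> cone N.+1 F (system_vector t a).

Lemma system_vector_vertex t a v : system_vector t a (enum_rank v).+1 = a v.
Proof. by rewrite /= valK enum_rankK. Qed.

Lemma system_vector_coord t a k : (0 < k <= N)%N -> exists v, system_vector t a k = a v /\ k = (enum_rank v).+1.
Proof.
case: k => // k /= kN; rewrite insubT; exists (enum_val (Sub k kN : 'I_#|V|)).
by rewrite enum_valK.
Qed.

Definition integer_solutions (S : R -> {ffun V -> R} -> Prop) (t : nat) : set {ffun V -> R} :=
  [set a | S t%:R a /\ forall v, a v \is a Num.int]%classic.

(** Boundedness allows the box inequalities to be added without losing solutions. The solution [a0]
    at t = 1 puts the ray of t into the last projection, so that one quasi-polynomial covers every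
    t, including 0. *)
Theorem conic_quasi_polynomial S (C : nat) a0 : conic S ->
  (forall t a, S t a -> forall v, `|a v| <= C%:R * t) -> S 1 a0 ->
  exists2 q : nat -> R, quasi_polynomial q & forall t : nat,
    finite_set (integer_solutions S t) /\ q t = #|` fset_set (integer_solutions S t)|%:R.
Proof.
move=> [F FP] bounded Sa0.
pose F0 := F ++ [seq box_upper C%:Z k | k <- iota 1 N] ++ [seq box_lower C%:Z k | k <- iota 1 N].
have boxF0 k : (0 < k <= N)%N -> box_upper C%:Z k \in F0 /\ box_lower C%:Z k \in F0.
  move=> kN; rewrite !mem_cat; split; apply/orP; right; apply/orP; [left|right];
    by apply: map_f; rewrite mem_iota; lia.
have F0P t a : S t a <-> cone N.+1 F0 (system_vector t a).
  split=> [Sta f|h]; last by apply/FP => f fF; apply: h; rewrite mem_cat fF.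
  rewrite !mem_cat => /orP[fF|/orP[/mapP[k]|/mapP[k]]]; first exact: ((FP t a).1 Sta f fF).
    rewrite mem_iota => kN ->; rewrite evf_box_upper; last by lia.
    have [v [-> _]] := @system_vector_coord t a k ltac:(lia).
    by have := bounded t a Sta v; rewrite ler_norml => /andP[_]; rewrite subr_ge0 -pmulrn.
  rewrite mem_iota => kN ->; rewrite evf_box_lower; last by lia.
  have [v [-> _]] := @system_vector_coord t a k ltac:(lia).
  by have := bounded t a Sta v; rewrite ler_norml => /andP[+ _]; rewrite -subr_ge0 opprK addrC -pmulrn.
have C0 : 0 <= C%:Z by [].
have [q qP qE] := lattice_count_quasi_poly C0 boxF0 ((F0P 1 a0).1 Sa0) (erefl _).
have [d d0 [P PE]] := quasi_poly_univariate qP.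
exists (fun t => q (upd (fun=> 0) 0 t%:Z)); first by exists d => //; exists P.
move=> t; pose x := upd (fun=> 0 : int) 0 t%:Z.
have x0 : 0 <= x 0%N by [].
pose Z := [seq z <- box_points C%:Z N x | `[< cone N.+1 F0 (emb R z) >]].
pose lab_of (z : nat -> int) : {ffun V -> R} := [ffun v => (z (enum_rank v).+1)%:~R].
have embZ z : z \in Z -> emb R z = system_vector t%:R (lab_of z).
  rewrite mem_filter => /andP[_ /(mem_box_points C0 N z x0)[h _]].
  apply/funext => -[|i]; first by rewrite /emb h // /x updE /= pmulrn.
  rewrite /emb /=; case: insubP => [o _ <-|iN]; first by rewrite ffunE enum_valK.
  by rewrite h //= ltnS leqNgt.
have SZ z : z \in Z -> S t%:R (lab_of z).
  by move=> zZ; apply/F0P; rewrite -embZ //; move: zZ; rewrite mem_filter => /andP[/asboolP].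
have -> : integer_solutions S t = [set` [fset a in [seq lab_of z | z <- Z]]%fset]%classic.
  apply/seteqP; split=> [a [Sta aint]|a /=]; last first.
    by rewrite in_fset /= => /mapP[z zZ ->]; split; [exact: SZ|move=> v; rewrite ffunE; exact: intr_int].
  rewrite /= in_fset /=; apply/mapP.
  pose z (i : nat) : int := if i is _.+1 then Num.floor (system_vector t%:R a i) else t%:Z.
  have zE : emb R z = system_vector t%:R a.
    apply/funext => -[|i]; first by rewrite /emb /= pmulrn.
    rewrite /emb /z; apply/eqP; rewrite -intrEfloor /=.
    by case: insubP => [o _ _|_]; [exact: aint|exact: int_num0].
  have zR i : (z i)%:~R = system_vector t%:R a i by rewrite -zE.
  exists z.
    rewrite mem_filter; apply/andP; split; first by apply/asboolP; rewrite zE; apply/F0P.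
    apply/(mem_box_points C0 N z x0); split=> [[|i] //= iN|i iN].
      apply: (@intr_inj R); rewrite -/(z i.+1) zR /=.
      by rewrite insubN // -leqNgt.
    have [v [e _]] := @system_vector_coord t%:R a i iN.
    rewrite -(ler_int R) intr_norm zR e (le_trans (bounded _ _ Sta v)) // rmorphM /= /x updE -!pmulrn.
    exact: lexx.
  by apply/ffunP => v; rewrite ffunE zR system_vector_vertex.
split; first exact: finite_fset.
rewrite set_fsetK card_fseq undup_id ?size_map.
  rewrite -qE lattice_count_points -big_mkcond /= -big_filter big_const_seq count_predT.
  by rewrite -Monoid.iteropE /=; elim: (size _) => //= n ->; rewrite -addn1 natrD addrC.
rewrite map_inj_in_uniq ?filter_uniq ?uniq_box_points // => z z' zZ z'Z e.
apply/funext => i; apply: (@intr_inj R).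
by have := congr1 (fun f => f i) (embZ z zZ); rewrite e -embZ.
Qed.

End ConicSystems.

(** * Dilations of the K-polytope *)

Section ConicClosure.
Variables (R : realType) (V : finType).
Implicit Types (L : R -> {ffun V -> R} -> R) (S : R -> {ffun V -> R} -> Prop).
Local Notation m := #|V|.+1.

Definition integral_form L : Prop := exists f : nat -> int, forall t a, evf m f (system_vector t a) = L t a.

Lemma integral_form_coord k L : (k < m)%N -> (forall t a, system_vector t a k = L t a) -> integral_form L.
Proof.
move=> km e; exists (fun i => (i == k)%:Z) => t a.
by rewrite -e -[RHS](@evf_coordinate _ m _ k).
Qed.

Lemma integral_form_t : integral_form (fun t _ => t).
Proof. by apply: (@integral_form_coord 0). Qed.

Lemma integral_form_entry v : integral_form (fun _ a => a v).
Proof.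
apply: (@integral_form_coord (enum_rank v).+1) => [|t a]; first by rewrite ltnS; exact: ltn_ord.
exact: system_vector_vertex.
Qed.

Lemma integral_form0 : integral_form (fun _ _ => 0).
Proof. by exists (fun=> 0) => t a; rewrite /evf big1 // => i _; rewrite mul0r. Qed.

Lemma integral_formD L1 L2 : integral_form L1 -> integral_form L2 ->
  integral_form (fun t a => L1 t a + L2 t a).
Proof.
move=> [f1 e1] [f2 e2]; exists (fun i => f1 i + f2 i) => t a.
by rewrite -e1 -e2 -big_split; apply: eq_bigr => i _; rewrite rmorphD mulrDl.
Qed.

Lemma integral_formZ (c : int) L : integral_form L -> integral_form (fun t a => c%:~R * L t a).
Proof.
move=> [f e]; exists (fun i => c * f i) => t a.
by rewrite -e mulr_sumr; apply: eq_bigr => i _; rewrite rmorphM mulrA.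
Qed.

Lemma integral_formB L1 L2 : integral_form L1 -> integral_form L2 ->
  integral_form (fun t a => L1 t a - L2 t a).
Proof.
move=> h1 h2; have := integral_formD h1 (integral_formZ (-1) h2).
by move=> [f e]; exists f => t a; rewrite e rmorphN1 mulN1r.
Qed.

Lemma integral_formZn (c : nat) L : integral_form L -> integral_form (fun t a => L t a * c%:R).
Proof.
by move=> /(integral_formZ c%:Z)[f e]; exists f => t a; rewrite e -pmulrn mulrC.
Qed.

Lemma conic_ext S S' : (forall t a, S t a <-> S' t a) -> conic S' -> conic S.
Proof. by move=> e [F FP]; exists F => t a; rewrite e. Qed.

Lemma conic_ge0 L : integral_form L -> conic (fun t a => 0 <= L t a).
Proof.
move=> [f e]; exists [:: f] => t a; rewrite -e.
split=> [h f'|h]; last by apply: h; rewrite inE.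
by rewrite inE => /eqP ->.
Qed.

Lemma conic_and S S' : conic S -> conic S' -> conic (fun t a => S t a /\ S' t a).
Proof.
move=> [F FP] [F' FP']; exists (F ++ F') => t a; split.
  move=> [/FP h /FP' h'] f; rewrite mem_cat => /orP[]; [exact: h|exact: h'].
by move=> h; split; [apply/FP|apply/FP'] => f fF; apply: h; rewrite mem_cat fF ?orbT.
Qed.

Lemma conic_eq L1 L2 : integral_form L1 -> integral_form L2 -> conic (fun t a => L1 t a = L2 t a).
Proof.
move=> h1 h2; apply: conic_ext (conic_and (conic_ge0 (integral_formB h1 h2)) (conic_ge0 (integral_formB h2 h1))) => t a.
split=> [->|[]]; first by rewrite subrr.
by rewrite !subr_ge0 => h h'; apply/eqP; rewrite eq_le h h'.
Qed.

Lemma conic_true : conic (fun (_ : R) (_ : {ffun V -> R}) => True).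
Proof. by exists [::] => t a; split. Qed.

Lemma conic_forall (P : pred nat) (n : nat) (S : nat -> R -> {ffun V -> R} -> Prop) :
  (forall i, P i -> (i < n)%N) -> (forall i, P i -> conic (S i)) ->
  conic (fun t a => forall i, P i -> S i t a).
Proof.
elim: n P => [|n IH] P Pn h.
  by apply: conic_ext conic_true => t a; split=> // _ i /Pn.
have c : conic (fun t a => forall i, P i && (i < n)%N -> S i t a).
  by apply: IH => i /andP[]; [|move=> Pi _; exact: h].
have [Pi|nPi] := boolP (P n).
  apply: conic_ext (conic_and c (h n Pi)) => t a.
  split=> [H|[H H'] i Pi']; first by split=> [i /andP[Pi' _]|]; apply: H.
  by have [->//|i'] := eqVneq i n; apply: H; rewrite Pi' ltn_neqAle i' -ltnS Pn.
apply: conic_ext c => t a; split=> H i; first by case/andP => Pi _; exact: H.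
move=> Pi; apply: H; rewrite Pi ltn_neqAle -ltnS Pn // andbT.
by apply: contra nPi => /eqP <-.
Qed.

Lemma conic_scale S c t a : conic S -> 0 <= c -> S t a -> S (c * t) [ffun v => c * a v].
Proof.
move=> [F FP] c0 /FP h; apply/FP => f /h fv.
suff -> : evf m f (system_vector (c * t) [ffun v => c * a v]) = c * evf m f (system_vector t a).
  exact: mulr_ge0.
rewrite mulr_sumr; apply: eq_bigr => -[[|i] im] _ /=; first by rewrite mulrCA.
by case: insub => [o|]; rewrite ?ffunE ?mulr0 // mulrCA.
Qed.

End ConicClosure.

Section ScaledPolytope.
Variables (R : realType) (n : nat) (mu nu la : intpart).
Implicit Types (t : R) (a : labelling R n).

(** The K-polytope made homogeneous in [t]. The size condition is doubled to have integral
    coefficients, and the rhombi are those of the three hives. *)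
Definition scaled_K t a : Prop :=
  (0 <= t /\ lab a 0 0 = 0) /\
  (lab a 0 n%:Z * 2%:R - lab a 0 0 * 2%:R = t * (psize mu)%:R + t * (psize nu)%:R - t * (psize la)%:R /\
   forall j : nat, (1 <= j <= n.-1)%N -> lab a (n%:Z + j%:Z) (2 * n%:Z) - lab a n%:Z (2 * n%:Z) =
      lab a 0 j%:Z - lab a 0 0) /\
  (forall i : nat, (1 <= i <= n)%N ->
    (t * (part mu i)%:R = lab a i%:Z i%:Z - lab a (i%:Z - 1) (i%:Z - 1) /\
     t * (part nu i)%:R = lab a (n%:Z + i%:Z) (n%:Z + i%:Z) - lab a (n%:Z + i%:Z - 1) (n%:Z + i%:Z - 1)) /\
    t * (part la i)%:R = lab a i%:Z (n%:Z + i%:Z) - lab a (i%:Z - 1) (n%:Z + i%:Z - 1)) /\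
  ((hive_rhombi n (fun i j => lab a i j) /\ hive_rhombi n (fun i j => lab a (n + i)%N (n + j)%N)) /\
    hive_rhombi n (fun i j => lab a j (n + i)%N)) /\
  (forall i : nat, (1 <= i <= n)%N ->
    (0 <= lab a 0 i%:Z - lab a 0 (i%:Z - 1) /\ 0 <= lab a i%:Z n%:Z - lab a (i%:Z - 1) n%:Z) /\
     0 <= lab a n%:Z (n%:Z + i%:Z) - lab a n%:Z (n%:Z + i%:Z - 1)).

Lemma integral_form_lab (i j : int) : integral_form (fun _ a => lab (a : labelling R n) i j).
Proof.
rewrite /lab; case: pickP => [v _|_]; first exact: integral_form_entry.
exact: integral_form0.
Qed.

Lemma conic_hive_rhombi (f g : nat -> nat -> int) :
  conic (fun (_ : R) a => hive_rhombi n (fun i j => lab (a : labelling R n) (f i j) (g i j))).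
Proof.
have il := integral_form_lab.
apply: (@conic_ext _ _ _ (fun _ a => forall k, (k < n)%N -> forall i, (i <= k)%N && (k.+2 <= n)%N ->
  (0 <= lab a (f i k.+1) (g i k.+1) + lab a (f i.+1 k.+1) (g i.+1 k.+1)
     - lab a (f i.+1 k.+2) (g i.+1 k.+2) - lab a (f i k) (g i k) /\
   0 <= lab a (f i k.+1) (g i k.+1) + lab a (f i.+1 k.+2) (g i.+1 k.+2)
     - lab a (f i k.+2) (g i k.+2) - lab a (f i.+1 k.+1) (g i.+1 k.+1)) /\
   0 <= lab a (f i.+1 k.+1) (g i.+1 k.+1) + lab a (f i.+1 k.+2) (g i.+1 k.+2)
     - lab a (f i k.+1) (g i k.+1) - lab a (f i.+2 k.+2) (g i.+2 k.+2))).
  move=> t a; split=> [h k kn i /andP[ik kn']|h i k ik kn].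
    by have [r u l] := h i k ik kn'.
  by have [] := h k ltac:(lia) i ltac:(lia) => -[].
apply: (@conic_forall _ _ _ n) => // k _; apply: (@conic_forall _ _ _ n) => [i|i _]; first by lia.
by apply: conic_and; [apply: conic_and|]; apply: conic_ge0;
  do 2![apply: integral_formB => //]; apply: integral_formD.
Qed.

Lemma conic_scaled_K : conic scaled_K.
Proof.
have il := integral_form_lab; have it := @integral_form_t R (vertex n).
have it' c : integral_form (fun t (_ : {ffun vertex n -> R}) => t * c%:R) by apply: integral_formZn.
have z0 := @integral_form0 R (vertex n).
apply: conic_and; last apply: conic_and; last apply: conic_and; last apply: conic_and.
- by apply: conic_and; [exact: conic_ge0|exact: conic_eq].
- apply: conic_and.
    apply: conic_eq; first by apply: integral_formB; apply: integral_formZn.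
    by apply: integral_formB => //; apply: integral_formD.
  apply: (@conic_forall _ _ _ n.+1) => [i|i _]; first by lia.
  by apply: conic_eq; apply: integral_formB.
- apply: (@conic_forall _ _ _ n.+1) => [i|i _]; first by lia.
  by apply: conic_and; [apply: conic_and|]; apply: conic_eq => //; apply: integral_formB.
- apply: conic_and; [apply: conic_and|].
  + exact: (conic_hive_rhombi (fun i j => i%:Z) (fun i j => j%:Z)).
  + exact: (conic_hive_rhombi (fun i j => (n + i)%N%:Z) (fun i j => (n + j)%N%:Z)).
  + exact: (conic_hive_rhombi (fun i j => j%:Z) (fun i j => (n + i)%N%:Z)).
- apply: (@conic_forall _ _ _ n.+1) => [i|i _]; first by lia.
  by apply: conic_and; [apply: conic_and|]; apply: conic_ge0; apply: integral_formB.
Qed.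

(** The scaled partitions are left abstract in order to cover both [pscale t] and, for [t = 1], the
    given partitions themselves. *)
Lemma K_polytope_scaled (t : nat) (mu' nu' la' : intpart) a :
  psize mu' = (t * psize mu)%N -> psize nu' = (t * psize nu)%N -> psize la' = (t * psize la)%N ->
  (forall i, part mu' i = (t * part mu i)%N) -> (forall i, part nu' i = (t * part nu i)%N) ->
  (forall i, part la' i = (t * part la i)%N) ->
  K_polytope mu' nu' la' a <-> scaled_K t%:R a.
Proof.
move=> smu snu sla pmu pnu pla.
have rmu := rhombus_ineqs_mu a; have rnu := rhombus_ineqs_nu a; have rla := rhombus_ineqs_la a.
split.
  case=> o sz gl kmu knu kla /rmu r1 /rnu r2 /rla r3 c1 c2 c3.
  split; [by []|split; [|split; [|split]]].
  - by split=> //; move: sz; rewrite smu snu sla !natrM; lra.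
  - move=> i iN; split; [split|].
    + by rewrite -kmu // pmu natrM.
    + by rewrite -knu // pnu natrM.
    + by rewrite -kla // pla natrM.
  - by [].
  - by move=> i iN; split; [split; [exact: c1|exact: c2]|exact: c3].
move=> [[_ o] [[sz gl] [d [[[/rmu r1 /rnu r2] /rla r3] c]]]]; split=> //.
- by rewrite smu snu sla !natrM; lra.
- by move=> i iN; rewrite pmu natrM; have [[-> _] _] := d i iN.
- by move=> i iN; rewrite pnu natrM; have [[_ ->] _] := d i iN.
- by move=> i iN; rewrite pla natrM; have [_ ->] := d i iN.
- by move=> i iN; have [[h _] _] := c i iN.
- by move=> i iN; have [[_ h] _] := c i iN.
- by move=> i iN; have [_ h] := c i iN.
Qed.

(** Labels increase from [(0, 0)] along the side [i = 0] to [(0, k)], then along row [k] through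
    [(i, k)] to [(k, k)], and along the diagonal to [(n, n)]. *)
Lemma hive_bounds (b : nat -> nat -> R) : hive_rhombi n b ->
  (forall j, (j < n)%N -> b 0%N j <= b 0%N j.+1) -> (forall i, (i < n)%N -> b i n <= b i.+1 n) ->
  (forall i, (i < n)%N -> b i i <= b i.+1 i.+1) ->
  forall i k, (i <= k)%N -> (k <= n)%N -> b 0%N 0%N <= b i k <= b n n.
Proof.
move=> bP left top diag i k ik kn; have row := hive_row_mono bP top; apply/andP; split.
  apply: (@le_trans _ _ (b 0%N k)).
    by elim: k kn {ik} => // k IH kn; apply: le_trans (IH (ltnW kn)) (left k kn).
  elim: i ik => // i IH ik; apply: le_trans (IH (ltnW ik)) (row i k _).
  by rewrite ik.
apply: (@le_trans _ _ (b k k)).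
  rewrite -(subnKC ik); have : (i + (k - i) <= k)%N by lia.
  have -> : b i (i + (k - i))%N = b i k by congr b; lia.
  have -> : b (i + (k - i))%N (i + (k - i))%N = b (i + (k - i))%N k by congr b; lia.
  elim: (k - i)%N => [|d IH] dk; first by rewrite addn0.
  by rewrite addnS; apply: le_trans (IH _) (row _ _ _); lia.
rewrite -(subnKC kn); have : (k + (n - k) <= n)%N by lia.
elim: (n - k)%N => [|d IH] dn; first by rewrite addn0.
by rewrite addnS; apply: le_trans (IH _) (diag _ _); lia.
Qed.

Lemma telescope_real (g : nat -> R) (t : R) (v : nat -> nat) k :
  (forall i, (i < k)%N -> g i.+1 - g i = t * (v i)%:R) -> g k - g 0%N = t * (\sum_(i < k) v i)%N%:R.
Proof.
elim: k => [|k IH] h; first by rewrite big_ord0 mulr0 subrr.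
rewrite big_ord_recr natrD mulrDr /= -IH => [|i ik]; last by apply: h; rewrite ltnW.
by rewrite -(h k) //; ring.
Qed.

(** Each hive lies between its extreme corner labels: 0 and t|mu|, then t|mu| and t(|mu| + |nu|),
    and for the third a label in [0, t|mu|] and the same label plus t|la|. *)
Lemma scaled_K_bounded t a : (size mu <= n)%N -> (size nu <= n)%N -> (size la <= n)%N -> scaled_K t a ->
  forall v, `|a v| <= (psize mu + psize nu + psize la)%N%:R * t.
Proof.
move=> muN nuN laN [[t0 o] [[sz gl] [d [[[r1 r2] r3] c]]]].
pose A (i j : nat) := lab a i j.
have AE (i j : nat) (i' j' : int) : i' = i%:Z -> j' = j%:Z -> lab a i' j' = A i j by move=> -> ->.
have diff (i j k l : nat) (i' j' k' l' : int) : i' = i%:Z -> j' = j%:Z -> k' = k%:Z -> l' = l%:Z ->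
  lab a i' j' - lab a k' l' = A i j - A k l by move=> -> -> -> ->.
have dmu i : (i < n)%N -> A i.+1 i.+1 - A i i = t * (nth 0%N mu i)%:R.
  move=> iN; have [[+ _] _] := d i.+1 iN; rewrite /part /= => ->.
  by apply/esym/diff; lia.
have dnu i : (i < n)%N -> A (n + i.+1)%N (n + i.+1)%N - A (n + i)%N (n + i)%N = t * (nth 0%N nu i)%:R.
  move=> iN; have [[_ +] _] := d i.+1 iN; rewrite /part /= => ->.
  by apply/esym/diff; lia.
have dla i : (i < n)%N -> A i.+1 (n + i.+1)%N - A i (n + i)%N = t * (nth 0%N la i)%:R.
  move=> iN; have [_] := d i.+1 iN; rewrite /part /= => ->.
  by apply/esym/diff; lia.
have al i : (i < n)%N -> A 0%N i <= A 0%N i.+1.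
  by move=> iN; have [[+ _] _] := c i.+1 iN; rewrite (@diff 0%N i.+1 0%N i) ?subr_ge0 //; lia.
have be i : (i < n)%N -> A i n <= A i.+1 n.
  by move=> iN; have [[_ +] _] := c i.+1 iN; rewrite (@diff i.+1 n i n) ?subr_ge0 //; lia.
have ga i : (i < n)%N -> A n (n + i)%N <= A n (n + i.+1)%N.
  by move=> iN; have [_] := c i.+1 iN; rewrite (@diff n (n + i.+1)%N n (n + i)%N) ?subr_ge0 //; lia.
have smu : A n n - A 0%N 0%N = t * (psize mu)%:R.
  by rewrite (psize_sum muN); apply: (telescope_real (g := fun i => A i i)).
have snu : A (n + n)%N (n + n)%N - A (n + 0)%N (n + 0)%N = t * (psize nu)%:R.
  by rewrite (psize_sum nuN); apply: (telescope_real (g := fun i => A (n + i)%N (n + i)%N)).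
have sla : A n (n + n)%N - A 0%N (n + 0)%N = t * (psize la)%:R.
  by rewrite (psize_sum laN); apply: (telescope_real (g := fun i => A i (n + i)%N)).
have szA : A 0%N n * 2%:R - A 0%N 0%N * 2%:R = t * (psize mu)%:R + t * (psize nu)%:R - t * (psize la)%:R by [].
have oA : A 0%N 0%N = 0 by [].
have glA j : (j <= n)%N -> A (n + j)%N (n + n)%N - A n (n + n)%N = A 0%N j.
  move=> jn; case: (posnP j) => [->|j0]; first by rewrite addn0 subrr oA.
  have [->|jn'] := eqVneq j n; first by move: snu sla smu szA; rewrite !addn0 oA; lra.
  have := gl j ltac:(lia); rewrite o subr0 => h.
  by rewrite -[RHS]h; apply/esym/diff; lia.
have mul_ge0 k : 0 <= t * k%:R by rewrite mulr_ge0 ?ler0n.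
have b1 := @hive_bounds A r1 al be (fun i iN => ltac:(by rewrite -subr_ge0 dmu)).
have b2 := @hive_bounds (fun i j => A (n + i)%N (n + j)%N) r2 (fun i iN => ltac:(by rewrite /= addn0; apply: ga))
  (fun i iN => ltac:(by rewrite -(lerD2r (- A n (n + n)%N)) !glA ?(ltnW iN) //; apply: al))
  (fun i iN => ltac:(by rewrite -subr_ge0 dnu)).
have b3 := @hive_bounds (fun i j => A j (n + i)%N) r3 (fun i iN => ltac:(by rewrite /= addn0; apply: be)) ga
  (fun i iN => ltac:(by rewrite -subr_ge0 dla)).
move=> v; rewrite -lab_vertex -/(A _ _); have := vertexP v.
move: (nat_of_ord (val v).1) (nat_of_ord (val v).2) => i j; rewrite /in_trapezoid => ij.
have tmu := mul_ge0 (psize mu); have tnu := mul_ge0 (psize nu); have tla := mul_ge0 (psize la).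
have a0n := b1 0%N n (leq0n _) (leqnn _).
rewrite ler_norml !natrD !mulrDl !(mulrC _ t); apply/andP.
rewrite /= in b2 b3; rewrite !addn0 in b2 b3 snu sla.
have [jn|nj] := leqP j n.
  have /andP[? ?] := b1 i j ltac:(lia) jn; split; lra.
have [ni|iN] := leqP n i.
  have /andP[] := b2 (i - n)%N (j - n)%N ltac:(lia) ltac:(lia).
  by rewrite !subnKC ?(ltnW nj) // => ? ?; split; lra.
have /andP[] := b3 (j - n)%N i ltac:(lia) ltac:(lia).
by rewrite subnKC ?(ltnW nj) // => ? ?; case/andP: a0n => ? ?; split; lra.
Qed.

End ScaledPolytope.

Local Open Scope classical_set_scope.
Local Open Scope ring_scope.

Lemma nth_pscale t (k : intpart) i : nth 0%N (pscale t k) i = (t * nth 0%N k i)%N.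
Proof.
rewrite /= /scale_parts; case: (posnP t) => [->|t0].
  rewrite (eq_in_filter (a2 := pred0)) ?filter_pred0 ?nth_nil // => x /mapP[y _ ->].
  by rewrite mul0n.
have /andP[_ k0] := intpartP k.
rewrite (eq_in_filter (a2 := predT)) ?filter_predT; last first.
  move=> x /mapP[y yk ->]; rewrite muln_gt0 t0 lt0n /=.
  by apply/eqP => y0; rewrite y0 in yk; rewrite yk in k0.
have [ik|ki] := ltnP i (size k); first by rewrite (nth_map 0%N).
by rewrite !nth_default ?size_map ?muln0.
Qed.

Lemma size_pscale t (k : intpart) : (size (pscale t k) <= size k)%N.
Proof. by apply: size_part_le => i ki; rewrite nth_pscale nth_default ?muln0. Qed.

Lemma psize_pscale t (k : intpart) : psize (pscale t k) = (t * psize k)%N.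
Proof.
rewrite (psize_sum (size_pscale t k)) (psize_sum (leqnn _)) big_distrr /=.
by apply: eq_bigr => i _; rewrite -nth_pscale.
Qed.

Lemma part_pscale t (k : intpart) i : part (pscale t k) i = (t * part k i)%N.
Proof. exact: nth_pscale. Qed.

Section Dilation.
Variables (R : realType) (n : nat) (mu nu la : intpart).
Local Notation P := (@K_polytope R n mu nu la).

Lemma K_polytope_pscale t (a : labelling R n) :
  K_polytope (pscale t mu) (pscale t nu) (pscale t la) a <-> scaled_K mu nu la t%:R a.
Proof. by apply: K_polytope_scaled => *; rewrite ?psize_pscale ?part_pscale. Qed.

Lemma K_polytope_unscaled (a : labelling R n) : P a <-> scaled_K mu nu la 1 a.
Proof. by apply: (@K_polytope_scaled _ _ _ _ _ 1) => *; rewrite mul1n. Qed.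

(** A conic system is stable under multiplication by [t] and by its inverse; the two inclusions use
    one each. *)
Lemma dilate_K_polytope t : (0 < t)%N ->
  dilate t P = K_polytope (pscale t mu) (pscale t nu) (pscale t la).
Proof.
move=> t0; have t0' : (0 : R) < t%:R by rewrite ltr0n.
have cS := @conic_scaled_K R n mu nu la.
apply/seteqP; split=> [_ [a /K_polytope_unscaled aK <-]|b /K_polytope_pscale bK].
  by apply/K_polytope_pscale; have := conic_scale cS (ltW t0') aK; rewrite mulr1.
exists [ffun v => t%:R^-1 * b v].
  have ti : 0 <= t%:R^-1 :> R by rewrite invr_ge0 ltW.
  by apply/K_polytope_unscaled; have := conic_scale cS ti bK; rewrite mulVf // lt0r_neq0.
by apply/ffunP => v; rewrite !ffunE mulVKf // gt_eqF.
Qed.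

Lemma integer_solutions_scaled_K t :
  integer_solutions (scaled_K mu nu la) t =
  integer_points (@K_polytope R n (pscale t mu) (pscale t nu) (pscale t la)).
Proof. by apply/seteqP; split=> a [/K_polytope_pscale h h']; split=> //; apply/K_polytope_pscale. Qed.

End Dilation.

(* For t = 0 the Ehrhart quasi-polynomial of an empty polytope is 0, while
   NL_coef (pscale 0 mu) (pscale 0 nu) (pscale 0 la) = 1: hence the guard. *)
Theorem theorem4p6 (R : realType) (n : nat) (mu nu la : intpart) :
  (0 < n)%N ->
  (plength mu <= n)%N -> (plength nu <= n)%N -> (plength la <= n)%N ->
  [/\ has_card (integer_points (@K_polytope R n mu nu la)) (NL_coef mu nu la),
      forall t : nat,
        has_card
          (integer_points
             (@K_polytope R n (pscale t mu) (pscale t nu) (pscale t la)))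
          (NL_coef (pscale t mu) (pscale t nu) (pscale t la))
    & exists2 q : nat -> R,
        ehrhart_quasi_polynomial (@K_polytope R n mu nu la) q
      & forall t : nat, (0 < t)%N \/ @K_polytope R n mu nu la !=set0 ->
          (NL_coef (pscale t mu) (pscale t nu) (pscale t la))%:~R = q t].
Proof.
move=> n0 muN nuN laN; have cS := @conic_scaled_K R n mu nu la.
have card t : has_card
    (integer_points (@K_polytope R n (pscale t mu) (pscale t nu) (pscale t la)))
    (NL_coef (pscale t mu) (pscale t nu) (pscale t la)).
  by apply: has_card_K_polytope; apply: leq_trans (size_pscale _ _) _.
split=> //; first exact: has_card_K_polytope.
have [[a0 /K_polytope_unscaled Sa0]|/set0P/negP/negPn/eqP P0] := pselect (@K_polytope R n mu nu la !=set0).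
  have [q qP qE] := conic_quasi_polynomial cS (fun t a => scaled_K_bounded muN nuN laN) Sa0.
  exists q; first split=> // t t0.
    by have := qE t; rewrite integer_solutions_scaled_K dilate_K_polytope.
  by move=> t _; have [_ ->] := card t; have [_ ->] := qE t; rewrite integer_solutions_scaled_K pmulrn.
have empty t : (0 < t)%N -> dilate t (@K_polytope R n mu nu la) = set0.
  by move=> t0; rewrite P0 /dilate image_set0.
have int0 : integer_points (set0 : set (labelling R n)) = set0 by rewrite /integer_points set0I.
(* All positive dilations of an empty polytope are empty, so the zero function counts their
   points. *)
exists (fun=> 0).
  split; first by exists 1%N => //; exists (fun=> 0) => t; rewrite horner0.
  by move=> t t0; rewrite empty // int0 fset_set0 cardfs0.
move=> t [t0|[a]]; last by rewrite P0.
by have [_ ->] := card t; rewrite -dilate_K_polytope // empty // int0 fset_set0 cardfs0.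
Qed.
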